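(* Let $1<\beta<p$ and suppose $\int_\Omega b(x)\phi_1^\beta\,dx<0$. Then there exists $\delta_1>0$ such that the problem $$-\mathcal L_K u=\lambda|u|^{p-2}u+b(x)|u|^{\beta-2}u\ \text{ in }\Omega,\qquad u=0\ \text{ on }\mathbb R^n\setminus\Omega$$ has at least two non-negative (weak) solutions whenever $\lambda_1<\lambda<\lambda_1+\delta_1$, the two solutions being minimizers of $J_\lambda$ on $\mathcal N_\lambda^+$ and $\mathcal N_\lambda^-$ respectively. Moreover: (i) $\lim_{\lambda\to\lambda_1^+}\ \inf_{u\in\mathcal N_\lambda^-}J_\lambda(u)=+\infty$; (ii) if $\lambda_k\to\lambda_1^+$ and $u_k$ is a minimizer of $J_{\lambda_k}$ on $\mathcal N_{\lambda_k}^-$, then $\lim_{k\to\infty}\|u_k\|=+\infty$.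
   Context: Let $p\ge 2$, $\alpha\in(0,1)$, $n>p\alpha$, and let $\Omega\subset\mathbb R^n$ be a bounded domain with smooth boundary. Let $b:\Omega\to\mathbb R$ be continuous, bounded and sign-changing (it takes both positive and negative values). Let $K:\mathbb R^n\setminus\{0\}\to(0,\infty)$ satisfy: (a) $mK\in L^1(\mathbb R^n)$ with $m(x)=\min\{1,|x|^p\}$; (b) there is $\theta>0$ with $K(x)\ge\theta|x|^{-(n+p\alpha)}$; (c) $K(x)=K(-x)$. The operator is $\mathcal L_Ku(x)=2\int_{\mathbb R^n}|u(y)-u(x)|^{p-2}(u(y)-u(x))K(x-y)\,dy$. Let $Q=\mathbb R^{2n}\setminus((\mathbb R^n\setminus\Omega)\times(\mathbb R^n\setminus\Omega))$ and let $X_0$ be the space of measurable $u:\mathbb R^n\to\mathbb R$ with $u|_\Omega\in L^p(\Omega)$, $(u(x)-u(y))K(x-y)^{1/p}\in L^p(Q)$ and $u=0$ a.e. on $\mathbb R^n\setminus\Omega$, with norm $\|u\|=\left(\int_Q|u(x)-u(y)|^pK(x-y)\,dx\,dy\right)^{1/p}$. A weak solution of the problem is $u\in X_0$ with $\int_Q|u(x)-u(y)|^{p-2}(u(x)-u(y))(v(x)-v(y))K(x-y)\,dx\,dy=\lambda\int_\Omega|u|^{p-2}uv\,dx+\int_\Omega b|u|^{\beta-2}uv\,dx$ for all $v\in X_0$. For $\lambda>0$ put $J_\lambda(u)=\frac1p\|u\|^p-\frac\lambda p\int_\Omega|u|^p\,dx-\frac1\beta\int_\Omega b|u|^\beta\,dx$,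 $\phi_u(t)=J_\lambda(tu)$ for $t>0$, $\mathcal N_\lambda=\{u\in X_0:\|u\|^p-\lambda\int_\Omega|u|^p\,dx-\int_\Omega b|u|^\beta\,dx=0\}$, $\mathcal N_\lambda^{+}=\{u\in\mathcal N_\lambda:\phi_u''(1)>0\}$ and $\mathcal N_\lambda^{-}=\{u\in\mathcal N_\lambda:\phi_u''(1)<0\}$, where $\phi_u''(1)=(p-1)\|u\|^p-\lambda(p-1)\int_\Omega|u|^p\,dx-(\beta-1)\int_\Omega b|u|^\beta\,dx$. Let $\lambda_1=\inf\{\|u\|^p:u\in X_0,\ \int_\Omega|u|^p\,dx=1\}$ be the smallest eigenvalue of $-\mathcal L_K$ (which is simple), and let $\phi_1\in X_0$ be the corresponding non-negative eigenfunction, normalized by $\|\phi_1\|=1$. *)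

(* Defs.v *)
From HB Require Import structures.
From mathcomp Require Import all_boot all_order all_algebra.
From mathcomp Require Import all_classical all_reals all_analysis.

Set Implicit Arguments.
Unset Strict Implicit.
Unset Printing Implicit Defensive.

Import Order.TTheory GRing.Theory Num.Theory.
Import numFieldNormedType.Exports.

Local Open Scope classical_set_scope.
Local Open Scope ring_scope.

(* 'rV[T]_n carries the product sigma-algebra; for T = R it is the Borel
   sigma-algebra of R^n. *)
Definition measure_rV_display : measure_display -> measure_display.
Proof. exact. Qed.

Section measurable_rV.
Context {d : measure_display} {T : measurableType d}.
Variable n : nat.

Let coors : 'I_n -> 'rV[T]_n -> T := fun i v => v ord0 i.

Let rV_set0 : g_sigma_preimage coors set0.
Proof. exact: sigma_algebra0. Qed.

Let rV_setC A : g_sigma_preimage coors A -> g_sigma_preimage coors (~` A).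
Proof. exact: sigma_algebraC. Qed.

Let rV_bigcup (F : (set 'rV[T]_n)^nat) :
  (forall i, g_sigma_preimage coors (F i)) ->
  g_sigma_preimage coors (\bigcup_i (F i)).
Proof. exact: sigma_algebra_bigcup. Qed.

HB.instance Definition _ := @isMeasurable.Build (measure_rV_display d)
  'rV[T]_n (g_sigma_preimage coors) rV_set0 rV_setC rV_bigcup.

End measurable_rV.

Lemma measurable_fun_rVP d1 d2 (T1 : measurableType d1)
    (T2 : measurableType d2) n (f : T1 -> 'rV[T2]_n) :
  measurable_fun [set: T1] f <->
  forall i, measurable_fun [set: T1] (fun x => f x ord0 i).
Proof.
pose c : 'I_n -> 'rV[T2]_n -> T2 := fun i v => v ord0 i.
apply: (@iff_trans _ (g_sigma_preimage (fun i => c i \o f) `<=` measurable)).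
  rewrite g_sigma_preimage_comp; split=> [mf A [/= C preC <-]|prefS].
    exact: mf.
  by move=> _ A mA; apply: prefS; exists A.
split=> [fS i|mf].
- move=> _ A mA.
  apply: fS; apply: sub_sigma_algebra.
  case: n i => [[] []//|n i] in f c *.
  rewrite -bigcup_mkord_ord.
  exists i; first exact: ltn_ord.
  by exists A => //; rewrite inord_val.
- apply: smallest_sub; first exact: sigma_algebra_measurable.
  case: n => [|n] in f c mf *; first by rewrite big_ord0.
  rewrite -bigcup_mkord_ord; apply: bigcup_sub => i Ii.
  by move=> A [B mB <-]; exact: mf.
Qed.

Lemma measurable_rV_coord d (T : measurableType d) n (i : 'I_n) :
  measurable_fun [set: 'rV[T]_n] (fun v : 'rV[T]_n => v ord0 i).
Proof. by move: i; apply/measurable_fun_rVP; exact: measurable_id. Qed.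

Definition rV_cons {T : Type} n (z : T * 'rV[T]_n) : 'rV[T]_n.+1 :=
  \row_i oapp (z.2 ord0) z.1 (unlift ord0 i).

Definition rV_head {T : Type} n (v : 'rV[T]_n.+1) : T := v ord0 ord0.

Definition rV_behead {T : Type} n (v : 'rV[T]_n.+1) : 'rV[T]_n :=
  \row_i v ord0 (lift ord0 i).

Lemma measurable_rV_cons d (T : measurableType d) n :
  measurable_fun [set: T * 'rV[T]_n] (@rV_cons T n).
Proof.
apply/measurable_fun_rVP => i; rewrite /rV_cons.
under eq_fun do rewrite mxE.
case: (unliftP ord0 i) => [j _|_] /=; last exact: measurable_fst.
exact: (measurableT_comp (measurable_rV_coord j) measurable_snd).
Qed.

Lemma measurable_rV_head d (T : measurableType d) n :
  measurable_fun [set: 'rV[T]_n.+1] (@rV_head T n).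
Proof. exact: measurable_rV_coord. Qed.

Lemma measurable_rV_behead d (T : measurableType d) n :
  measurable_fun [set: 'rV[T]_n.+1] (@rV_behead T n).
Proof.
apply/measurable_fun_rVP => i; rewrite /rV_behead.
by under eq_fun do rewrite mxE; exact: measurable_rV_coord.
Qed.

Section measure_rV_cons.
Context {d : measure_display} {T : measurableType d} {R : realType} {n : nat}.
Variables (m1 : {sigma_finite_measure set T -> \bar R})
  (m2 : {sigma_finite_measure set 'rV[T]_n -> \bar R}).

Definition measure_rV_cons : set 'rV[T]_n.+1 -> \bar R :=
  pushforward (m1 \x m2)%E (@rV_cons T n).

Let measure_rV_cons0 : measure_rV_cons set0 = 0%E.
Proof. by rewrite /measure_rV_cons /pushforward preimage_set0 measure0. Qed.

Let measure_rV_cons_ge0 A : (0 <= measure_rV_cons A)%E.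
Proof. by rewrite /measure_rV_cons /pushforward measure_ge0. Qed.

Let measure_rV_cons_sigma_additive : semi_sigma_additive measure_rV_cons.
Proof.
have mc A : measurable A -> measurable (@rV_cons T n @^-1` A).
  by move=> mA; rewrite -[X in measurable X]setTI; exact: measurable_rV_cons.
move=> F mF tF mUF; rewrite /measure_rV_cons /pushforward preimage_bigcup.
apply: measure_semi_sigma_additive => [k||]; first exact: mc.
- apply/trivIsetP => /= i j _ _ ij; rewrite -preimage_setI.
  by move/trivIsetP : tF => /(_ _ _ _ _ ij) ->//; rewrite preimage_set0.
- by rewrite -preimage_bigcup; exact: mc.
Qed.

HB.instance Definition _ := isMeasure.Build _ _ _ measure_rV_cons
  measure_rV_cons0 measure_rV_cons_ge0 measure_rV_cons_sigma_additive.

Let sigma_finite_measure_rV_cons : sigma_finite setT measure_rV_cons.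
Proof.
have /sigma_finiteP[F [TF ndF Foo]] := sigma_finiteT m1.
have /sigma_finiteP[G [TG ndG Goo]] := sigma_finiteT m2.
exists (fun k => @rV_head T n @^-1` F k `&` @rV_behead T n @^-1` G k).
  apply/esym; rewrite -subTset => v _.
  have [i _ Fi] : (\bigcup_i F i) (rV_head v) by rewrite -TF.
  have [j _ Gj] : (\bigcup_i G i) (rV_behead v) by rewrite -TG.
  exists (maxn i j) => //; split.
  - by apply: (subsetPset _ _ (ndF _ _ (leq_maxl i j))).
  - by apply: (subsetPset _ _ (ndG _ _ (leq_maxr i j))).
move=> k; have [mF Fk] := Foo k; have [mG Gk] := Goo k; split.
  apply: measurableI; rewrite -[X in measurable X]setTI.
  - exact: measurable_rV_head.
  - exact: measurable_rV_behead.
rewrite /measure_rV_cons /pushforward (_ : _ @^-1` _ = F k `*` G k).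
  by rewrite product_measure1E// lte_mul_pinfty// ge0_fin_numE.
have headK z : rV_head (@rV_cons T n z) = z.1.
  by rewrite /rV_head mxE unlift_none.
have beheadK z : rV_behead (@rV_cons T n z) = z.2.
  by apply/rowP => i; rewrite !mxE liftK.
by apply/seteqP; split=> z /=; rewrite headK beheadK.
Qed.

HB.instance Definition _ := Measure_isSigmaFinite.Build _ _ _ measure_rV_cons
  sigma_finite_measure_rV_cons.
End measure_rV_cons.

(* Lebesgue measure for the canonical measurable structure of R, whose display
   differs from that of measurableTypeR R. *)
Section lebesgue_real.
Context {R : realType}.

Definition lebesgue_real : set R -> \bar R := @lebesgue_measure R.

Let lebesgue_real0 : lebesgue_real set0 = 0%E.
Proof. exact: (@measure0 _ _ _ (@lebesgue_measure R)). Qed.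

Let lebesgue_real_ge0 A : (0 <= lebesgue_real A)%E.
Proof. exact: (@measure_ge0 _ _ _ (@lebesgue_measure R)). Qed.

Let lebesgue_real_sigma_additive : semi_sigma_additive lebesgue_real.
Proof. exact: (@measure_semi_sigma_additive _ _ _ (@lebesgue_measure R)). Qed.

HB.instance Definition _ := isMeasure.Build _ _ _ lebesgue_real
  lebesgue_real0 lebesgue_real_ge0 lebesgue_real_sigma_additive.

Let sigma_finite_lebesgue_real : sigma_finite setT lebesgue_real.
Proof. exact: (@sigma_finiteT _ _ _ (@lebesgue_measure R)). Qed.

HB.instance Definition _ := Measure_isSigmaFinite.Build _ _ _ lebesgue_real
  sigma_finite_lebesgue_real.
End lebesgue_real.

Section lebesgue_rV.
Context {R : realType}.

Definition dirac_rV0 : set 'rV[R]_0 -> \bar R := dirac (0 : 'rV[R]_0).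

HB.instance Definition _ := Measure.on dirac_rV0.

Let sigma_finite_dirac_rV0 : sigma_finite setT dirac_rV0.
Proof.
exists (fun=> setT); first by rewrite bigcup_const.
by move=> _; split; [exact: measurableT|rewrite /dirac_rV0 diracT ltry].
Qed.

HB.instance Definition _ := Measure_isSigmaFinite.Build _ _ _ dirac_rV0
  sigma_finite_dirac_rV0.

Fixpoint lebesgue_rV (n : nat) :
    {sigma_finite_measure set 'rV[R]_n -> \bar R} :=
  match n with
  | 0 => dirac_rV0
  | m.+1 => measure_rV_cons lebesgue_real (lebesgue_rV m)
  end.

Lemma lebesgue_rV_box n (A : 'I_n -> set R) :
  (forall i, measurable (A i)) ->
  lebesgue_rV n [set x | forall i, A i (x ord0 i)] =
  (\prod_(i < n) lebesgue_measure (A i))%E.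
Proof.
elim: n A => [|n IH] A mA /=.
  rewrite big_ord0 -[RHS](diracT R (0 : 'rV[R]_0)).
  by congr dirac_rV0; apply/seteqP; split=> // x _ [].
rewrite big_ord_recl -(IH (fun i => A (lift ord0 i)))//.
rewrite /measure_rV_cons /pushforward.
rewrite (_ : _ @^-1` _ =
    A ord0 `*` [set x : 'rV[R]_n | forall i, A (lift ord0 i) (x ord0 i)]).
  rewrite product_measure1E// (_ : mkset _ =
      \bigcap_(i in [set: 'I_n]) ((fun x : 'rV[R]_n => x ord0 i) @^-1`
        A (lift ord0 i))).
    apply: fin_bigcap_measurable => // i _.
    by rewrite -[X in measurable X]setTI; exact: measurable_rV_coord.
  by apply/seteqP; split=> x /= H i => [_|]; exact: H.
apply/seteqP; split=> -[x v] /=.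
  move=> H; split=> [|i]; first by have := H ord0; rewrite mxE unlift_none.
  by have := H (lift ord0 i); rewrite mxE liftK.
move=> [H0 H] i; rewrite mxE.
by case: (unliftP ord0 i) => [j|] -> //=; exact: H.
Qed.
End lebesgue_rV.

(* The library's sigma-algebras on R^n are Borel.  A function is Lebesgue
   measurable on D when it agrees on D, outside a negligible set, with a Borel
   function.  The library's integral is a supremum over measurable simple
   functions, so it depends only on the class of f up to equality a.e. *)
Definition ae_measurable d (T : measurableType d) (R : realType)
    (mu : {measure set T -> \bar R}) (D : set T) (f : T -> R) : Prop :=
  exists2 g : T -> R, measurable_fun D g &
    {ae mu, forall x, D x -> f x = g x}.

Definition in_Lp d (T : measurableType d) (R : realType)
    (mu : {measure set T -> \bar R}) (D : set T) (r : R) (f : T -> R) : Prop :=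
  ae_measurable mu D f /\ (\int[mu]_(x in D) (`|f x| `^ r)%:E < +oo)%E.

Section domains.
Context {R : realType}.

(* The norm that the library puts on 'rV[R]_n is the sup norm. *)
Definition enorm n (x : 'rV[R]_n) : R := Num.sqrt (\sum_i x ord0 i ^+ 2).

Fixpoint is_Ck n (k : nat) (f : 'rV[R]_n -> R) : Prop :=
  continuous f /\
  if k is k'.+1 then
    forall i : 'I_n, (forall x, derivable f x (delta_mx ord0 i)) /\
      is_Ck k' (fun x => 'D_(delta_mx ord0 i) f x)
  else True.

Definition is_smooth n (f : 'rV[R]_n -> R) : Prop := forall k, is_Ck k f.

(* Near each boundary point, up to the choice of the vertical axis i and of its
   orientation s, Omega is the region above the graph of a smooth function g of
   the other coordinates. *)
Definition smooth_boundary n (Omega : set 'rV[R]_n) : Prop :=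
  forall x0, (closure Omega `\` interior Omega) x0 ->
  exists (i : 'I_n) (s : bool) (g : 'rV[R]_n.-1 -> R), is_smooth g /\
    \forall x \near x0,
      Omega x <-> (-1) ^+ s * g (col' i x) < (-1) ^+ s * x ord0 i.

Definition smooth_bounded_domain n (Omega : set 'rV[R]_n) : Prop :=
  [/\ open Omega, connected Omega, Omega !=set0, bounded_set Omega &
      smooth_boundary Omega].

(* K is a function on R^n \ {0}; its value at 0 is irrelevant. *)
Definition is_kernel n (p alpha : R) (K : 'rV[R]_n -> R) : Prop :=
  [/\ forall x, x != 0 -> 0 < K x,
      in_Lp (lebesgue_rV n) setT 1 (fun x => Num.min 1 (enorm x `^ p) * K x),
      exists2 theta : R, 0 < theta &
        forall x, x != 0 -> theta * enorm x `^ (- (n%:R + p * alpha)) <= K x &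
      forall x, x != 0 -> K (- x) = K x].

Definition is_weight n (Omega : set 'rV[R]_n) (b : 'rV[R]_n -> R) : Prop :=
  [/\ {within Omega, continuous b},
      exists M : R, forall x, Omega x -> `|b x| <= M,
      exists2 x, Omega x & 0 < b x &
      exists2 x, Omega x & b x < 0].

End domains.

Section variational.
Context {R : realType} {n : nat}.
Variables (Omega : set 'rV[R]_n) (K : 'rV[R]_n -> R) (p : R).

Local Notation mu := (lebesgue_rV n).
Local Notation mu2 := ((lebesgue_rV n : {measure set 'rV[R]_n -> \bar R})
  \x lebesgue_rV n)%E.
Implicit Types (u v w : 'rV[R]_n -> R).

Definition Qset : set ('rV[R]_n * 'rV[R]_n) :=
  ~` ((~` Omega) `*` (~` Omega)).

Definition X0 : set ('rV[R]_n -> R) := [set u |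
  [/\ ae_measurable mu setT u,
      in_Lp mu Omega p u,
      in_Lp mu2 Qset p (fun z => (u z.1 - u z.2) * K (z.1 - z.2) `^ p^-1) &
      {ae mu, forall x, ~ Omega x -> u x = 0}]].

Definition X0norm u : R :=
  (\int[mu2]_(z in Qset) (`|u z.1 - u z.2| `^ p * K (z.1 - z.2))) `^ p^-1.

Definition energy_form u v : R :=
  \int[mu2]_(z in Qset) (`|u z.1 - u z.2| `^ (p - 2) * (u z.1 - u z.2) *
    (v z.1 - v z.2) * K (z.1 - z.2)).

Definition lambda1 : R := inf [set X0norm u `^ p | u in
  [set u | X0 u /\ \int[mu]_(x in Omega) (`|u x| `^ p) = 1]].

Definition is_eigenfunction (lambda : R) u : Prop :=
  [/\ X0 u, ~ {ae mu, forall x, u x = 0} &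
    forall v, X0 v -> energy_form u v =
      lambda * \int[mu]_(x in Omega) (`|u x| `^ (p - 2) * u x * v x)].

Variables (b : 'rV[R]_n -> R) (beta lambda : R).

Definition is_weak_solution u : Prop :=
  X0 u /\ forall v, X0 v -> energy_form u v =
    lambda * \int[mu]_(x in Omega) (`|u x| `^ (p - 2) * u x * v x) +
    \int[mu]_(x in Omega) (b x * `|u x| `^ (beta - 2) * u x * v x).

Definition J u : R :=
  p^-1 * X0norm u `^ p - lambda / p * \int[mu]_(x in Omega) (`|u x| `^ p) -
  beta^-1 * \int[mu]_(x in Omega) (b x * `|u x| `^ beta).

Definition fibering u (t : R) : R := J (fun x => t * u x).

Definition Nehari : set ('rV[R]_n -> R) := [set u | X0 u /\
  X0norm u `^ p - lambda * \int[mu]_(x in Omega) (`|u x| `^ p) -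
  \int[mu]_(x in Omega) (b x * `|u x| `^ beta) = 0].

Definition Nehari_plus : set ('rV[R]_n -> R) :=
  [set u | Nehari u /\ 0 < derive1n 2 (fibering u) 1].

Definition Nehari_minus : set ('rV[R]_n -> R) :=
  [set u | Nehari u /\ derive1n 2 (fibering u) 1 < 0].

Definition J_minimizer (N : set ('rV[R]_n -> R)) u : Prop :=
  N u /\ forall v, N v -> J u <= J v.

End variational.

Definition ae_nonneg {R : realType} n (u : 'rV[R]_n -> R) : Prop :=
  {ae lebesgue_rV n, forall x, 0 <= u x}.

(* Main.v *)
Require Import Defs.
From mathcomp Require Import all_boot all_order all_algebra.
From mathcomp Require Import all_classical all_reals all_analysis.
From mathcomp Require Import measurable_realfun ring lra.

(** Let N u = ||u||^p, S u = int |u|^p and B u = int b |u|^beta, over Omega for the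
last two, and let A u = N u - lambda S u. Along the ray of u the energy is
t^p A u / p - t^beta B u / beta. Since beta < p, it has a positive critical point
exactly when A u and B u have the same sign; this point is unique, a minimum if
both are positive and a maximum if both are negative. The ray then meets the
Nehari manifold at this single point, in its positive or negative part
respectively, and there A = B and the energy is - (1/beta - 1/p) B.

The result rests on a spectral gap (spectral_gap): there are d, e > 0 such that
N u <= (l1 + d) S u implies B u <= - e (S u)^(beta/p), where l1 is the first
eigenvalue. If it failed, compactness would produce a ground state w, that is,
N w = l1 S w and S w > 0, with B w >= 0. But ground states are multiples of the
first eigenfunction up to sign, and B is negative on that one.

Let l1 < lambda < l1 + d. On the negative part, e S^(beta/p) <= - B = - A <=
(lambda - l1) S, so S is at least a negative power of lambda - l1
(nminus_S, nminus_energy). As N >= l1 S and the energy is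
(1/beta - 1/p) |B|, this yields both limit statements. On the positive part, the
gap gives A >= c N, whence c N <= A = B <= C N^(beta/p) bounds N. In both parts
minimizing sequences are therefore bounded, with a limit w at which A w <= B w and
B w is the limit of the values of B. Projecting |w| to the manifold along its ray
does not raise the energy, which gives a non-negative minimizer (nehari_limit).

Minimizers are weak solutions by comparison along rays: with w = u + s v and t w on
the manifold, one has J (u) <= J (t w) <= J (w) on the positive part and
J (t u) <= J (u) <= J (t w) on the negative part, with t tending to 1 as s tends
to 0. Dividing by s gives a sign of the first variation in every direction v, and
hence its vanishing (minimizer_critical).

Two facts about the space are proved directly. Compactness (compact_Vb): the lower
bound on the kernel shows that, on small cubes, u is close in L^p to one of its
values, with an error controlled by the norm; the finitely many constants converge
along an ultrafilter, and a rapidly Cauchy subsequence converges almost everywhere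
under an integrable bound. Simplicity (ground_proportional): for non-negative
ground states u and v, the function (u^p + v^p)^(1/p) has S-value S u + S v, and
Minkowski's inequality in the l^p plane bounds its N-value by N u + N v, with
equality only if (u x, v x) and (u y, v y) are parallel for almost all x, y.

All of this is carried out for Borel functions that vanish off Omega and for an
everywhere positive Borel kernel. The quantities of the problem do not change under
modification on null sets, which transfers the conclusions to the space of the
problem. *)

Set Implicit Arguments.
Unset Strict Implicit.
Unset Printing Implicit Defensive.
Import Order.TTheory GRing.Theory Num.Theory.
Import numFieldNormedType.Exports.
Local Open Scope classical_set_scope.
Local Open Scope ring_scope.

(** * The Nehari manifold of an abstract three-term energy *)

Lemma eq_cvg_nat {R : realType} (f g : nat -> R) (l : R) : f =1 g ->
  f m @[m --> \oo] --> l -> g m @[m --> \oo] --> l.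
Proof. by move=> /funext ->. Qed.

Lemma continuous_normr_powR {R : realType} (r : R) : 0 < r ->
  continuous (fun x : R => `|x| `^ r).
Proof.
move=> r0 a; have [->|a0] := eqVneq a 0.
  rewrite /continuous_at normr0 powR0 ?gt_eqF//; apply/cvgrPdist_lt => e e0.
  near=> x; rewrite sub0r normrN ger0_norm ?powR_ge0//.
  have -> : e = (e `^ r^-1) `^ r by rewrite -powRrM mulVf ?gt_eqF// powRr1// ltW.
  apply: gt0_ltr_powR; rewrite ?nnegrE ?powR_ge0//.
  by near: x; apply: (@nbhs0_lt R R^o); exact: powR_gt0.
apply: (@continuous_comp _ _ _ (fun x : R => `|x|) (fun x : R => x `^ r)).
  exact: norm_continuous.
apply: differentiable_continuous; apply/derivable1_diffP.
by apply: derivable_powR; rewrite in_itv/= andbT normr_gt0.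
Unshelve. all: by end_near. Qed.

Lemma cvg_normr_powR {R : realType} (f : nat -> R) (a r : R) : 0 < r ->
  f m @[m --> \oo] --> a -> `|f m| `^ r @[m --> \oo] --> `|a| `^ r.
Proof.
by move=> r0 fa; apply: (continuous_cvg _ (@continuous_normr_powR R r r0 a) fa).
Qed.

Section abstract.
Context {R : realType} {T : Type}.
Implicit Types u v w : T -> R.
(** The arguments of the theory are honest functions, not classes: [linef u s v]
stands for u + s v, the segment along which first variations are taken. *)
Definition scalef (t : R) u : T -> R := fun x => t * u x.
Definition linef u (s : R) v : T -> R := fun x => u x + s * v x.
Definition absf u : T -> R := fun x => `|u x|.

(** What the variational argument consumes. N, S and B are the p-th power of the
norm, the p-th power of the L^p norm and the weighted term; E, P and Q are their
first variations in the direction of the second argument.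

The derivatives are taken along the single sequence of steps 1/(m+1). A minimizer
u only has to be compared with u + v/(m+1) and u - v/(m+1), so [fE_opp], [fP_opp]
and [fQ_opp] then give both signs of the variation.

[fcompact] packages the compact embedding together with the weak lower
semicontinuity of N; the latter is phrased with eventual upper bounds instead of
a lower limit. [fB_ground] is the only place where the sign condition on the
first eigenfunction enters. *)
Record functionals (p beta l1 : R) (X : set (T -> R)) (N S B : (T -> R) -> R)
    (E P Q : (T -> R) -> (T -> R) -> R) : Prop := Functionals {
  fX_scale : forall t u, X u -> X (scalef t u);
  fX_line : forall u s v, X u -> X v -> X (linef u s v);
  fX_abs : forall u, X u -> X (absf u);
  fN_ge0 : forall u, 0 <= N u;
  fS_ge0 : forall u, 0 <= S u;
  fN_scale : forall t u, 0 <= t -> X u -> N (scalef t u) = t `^ p * N u;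
  fS_scale : forall t u, 0 <= t -> X u -> S (scalef t u) = t `^ p * S u;
  fB_scale : forall t u, 0 <= t -> X u -> B (scalef t u) = t `^ beta * B u;
  fN_abs : forall u, X u -> N (absf u) <= N u;
  fS_abs : forall u, X u -> S (absf u) = S u;
  fB_abs : forall u, X u -> B (absf u) = B u;
  fl1_gt0 : 0 < l1;
  fN_ge : forall u, X u -> l1 * S u <= N u;
  fB_ground : forall u, X u -> 0 < S u -> N u = l1 * S u -> B u < 0;
  fB_bound : exists C, forall u, X u -> `|B u| <= C * (1 + S u);
  fcompact : forall (u : nat -> T -> R) M, (forall k, X (u k)) ->
    (forall k, N (u k) <= M) -> (forall k, S (u k) <= M) ->
    exists (k : nat -> nat) w, [/\ forall m, (m <= k m)%N, X w,
      S (u (k m)) @[m --> \oo] --> S w, B (u (k m)) @[m --> \oo] --> B w &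
      forall c, (\forall m \near \oo, N (u (k m)) <= c) -> N w <= c];
  fN_deriv : forall u v, X u -> X v ->
    (N (linef u m.+1%:R^-1 v) - N u) * m.+1%:R @[m --> \oo] --> p * E u v;
  fS_deriv : forall u v, X u -> X v ->
    (S (linef u m.+1%:R^-1 v) - S u) * m.+1%:R @[m --> \oo] --> p * P u v;
  fB_deriv : forall u v, X u -> X v ->
    (B (linef u m.+1%:R^-1 v) - B u) * m.+1%:R @[m --> \oo] --> beta * Q u v;
  fE_opp : forall u v, X u -> X v -> E u (scalef (-1) v) = - E u v;
  fP_opp : forall u v, X u -> X v -> P u (scalef (-1) v) = - P u v;
  fQ_opp : forall u v, X u -> X v -> Q u (scalef (-1) v) = - Q u v
}.

Section theory.
Variables (p beta l1 : R) (X : set (T -> R)) (N S B : (T -> R) -> R)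
    (E P Q : (T -> R) -> (T -> R) -> R).
Hypothesis F : functionals p beta l1 X N S B E P Q.
Hypothesis hbeta : 1 < beta < p.

Let b1 : 1 < beta. Proof. by case/andP: hbeta. Qed.
Let bp : beta < p. Proof. by case/andP: hbeta. Qed.
Let b0 : 0 < beta. Proof. exact: lt_trans b1. Qed.
Let p0 : 0 < p. Proof. exact: lt_trans bp. Qed.
Let q0 : 0 < p - beta. Proof. by rewrite subr_gt0. Qed.

(** The energy is p^-1 excess - beta^-1 B, so on the Nehari manifold, where the
excess equals B, it is - gap * B. *)
Definition excess lam u := N u - lam * S u.
Definition energy lam u := p^-1 * N u - lam / p * S u - beta^-1 * B u.
Definition nehari lam u := X u /\ excess lam u = B u.
Definition gap : R := beta^-1 - p^-1.

Lemma gap_gt0 : 0 < gap.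
Proof. by rewrite subr_gt0 ltf_pV2 ?posrE. Qed.

Lemma energyE lam u : energy lam u = p^-1 * excess lam u - beta^-1 * B u.
Proof. by rewrite /energy /excess; ring. Qed.

Lemma excess_scale lam t u : 0 <= t -> X u ->
  excess lam (scalef t u) = t `^ p * excess lam u.
Proof. by move=> t0 Xu; rewrite /excess (fN_scale F)// (fS_scale F)//; ring. Qed.

Lemma energy_scale lam t u : 0 <= t -> X u -> energy lam (scalef t u) =
  p^-1 * (t `^ p * excess lam u) - beta^-1 * (t `^ beta * B u).
Proof. by move=> t0 Xu; rewrite energyE excess_scale// (fB_scale F). Qed.

Lemma energy_nehari lam u : nehari lam u -> energy lam u = - gap * B u.
Proof. by move=> [_ e]; rewrite energyE e /gap; ring. Qed.

(** The critical point of the energy along the ray of u: t^(p - beta) must equal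
B / excess, which is possible exactly when these have the same sign. *)
Definition fib lam u := (B u / excess lam u) `^ (p - beta)^-1.

Lemma fib_ge0 lam u : 0 <= fib lam u. Proof. exact: powR_ge0. Qed.

Lemma fib_gt0 lam u : 0 < B u / excess lam u -> 0 < fib lam u.
Proof. by move=> h; apply: powR_gt0. Qed.

Lemma fib_nehari lam u : X u -> 0 < B u / excess lam u ->
  nehari lam (scalef (fib lam u) u).
Proof.
move=> Xu h; split; first exact: (fX_scale F).
rewrite excess_scale ?fib_ge0// (fB_scale F) ?fib_ge0//.
have t0 := fib_gt0 h.
have -> : fib lam u `^ p = fib lam u `^ (p - beta) * fib lam u `^ beta.
  by rewrite -powRD ?subrK//; apply/implyP => _; rewrite gt_eqF.
rewrite {1}/fib -powRrM mulVf ?gt_eqF// powRr1 ?ltW//.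
have : excess lam u != 0.
  by apply: contraPneq h => ->; rewrite invr0 mulr0 ltxx.
by move=> e0; field.
Qed.

(** The function s^p / p - s^beta / beta is least at s = 1. Multiplied by B u it
is the energy along the ray of a point u of the Nehari manifold, so u is the
minimum of its ray when B u is positive and the maximum when B u is negative. *)
Lemma young s : 0 <= s -> p^-1 - beta^-1 <= p^-1 * s `^ p - beta^-1 * s `^ beta.
Proof.
move=> s0.
pose a := p / beta; pose b := p / (p - beta).
have := @conjugate_powR R (s `^ beta) 1 a b (powR_ge0 _ _) ler01.
have a0 : 0 < a by rewrite divr_gt0.
have B0 : 0 < b by rewrite divr_gt0.
move=> /(_ a0 B0); rewrite powR1 -powRrM mulr1.
have -> : a^-1 + b^-1 = 1 by rewrite /a /b; field; rewrite !gt_eqF.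
move=> /(_ erefl).
have -> : beta * a = p by rewrite /a; field; rewrite gt_eqF.
have -> : s `^ p / a = beta * (p^-1 * s `^ p) by rewrite /a; field; rewrite !gt_eqF.
have -> : 1 / b = beta * (beta^-1 - p^-1) by rewrite /b; field; rewrite !gt_eqF.
rewrite -mulrDr -ler_pdivrMl//; lra.
Qed.

(** The bound of B by 1 + S becomes homogeneous by rescaling u to N u = 1. When
N u = 0, S u vanishes as well, and large multiples of u would violate the bound
unless B u = 0. *)
Lemma B_le_N : exists2 C, 0 <= C & forall u, X u -> `|B u| <= C * N u `^ (beta / p).
Proof.
have [C hC] := fB_bound F.
exists (`|C| * (1 + l1^-1)).
  by rewrite mulr_ge0// addr_ge0// invr_ge0 ltW// (fl1_gt0 F).
move=> u Xu.
have [/eqP N0|N0] := boolP (N u == 0); last first.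
  have {N0}N0 : 0 < N u by rewrite lt_def N0 (fN_ge0 F).
  pose t := N u `^ (- p^-1).
  have t0 : 0 < t by rewrite powR_gt0.
  have tX : t `^ p * N u = 1.
    rewrite /t -powRrM mulNr mulVf ?gt_eqF// -{2}(powRr1 (ltW N0)) -powRD.
      by rewrite addNr powRr0.
    by rewrite (gt_eqF N0) implybT.
  have := hC _ (fX_scale F t Xu).
  rewrite (fB_scale F (ltW t0) Xu) normrM (ger0_norm (powR_ge0 _ _)) => h.
  have S1 : S (scalef t u) <= l1^-1.
    rewrite -[leRHS]mulr1 ler_pdivlMl ?(fl1_gt0 F)//.
    by have := fN_ge F (fX_scale F t Xu); rewrite (fN_scale F (ltW t0) Xu) tX.
  have tb : t `^ beta * N u `^ (beta / p) = 1.
    rewrite /t -powRrM -powRD.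
      by rewrite (_ : _ + _ = 0) ?powRr0//; field; rewrite gt_eqF.
    by rewrite (gt_eqF N0) implybT.
  have tb0 : 0 < t `^ beta by rewrite powR_gt0.
  have -> : N u `^ (beta / p) = (t `^ beta)^-1.
    by apply: (mulfI (lt0r_neq0 tb0)); rewrite tb mulfV// gt_eqF.
  rewrite ler_pdivlMr// mulrC (le_trans h)//.
  have S0 := fS_ge0 F (scalef t u).
  rewrite (@le_trans _ _ (`|C| * (1 + S (scalef t u))))//.
    by rewrite ler_wpM2r ?addr_ge0// ler_norm.
  by rewrite ler_wpM2l// lerD2l.
rewrite N0 powR0 ?mulr0 ?mulf_neq0 ?invr_eq0 ?gt_eqF//.
have S0 : S u = 0.
  apply/eqP; rewrite eq_le (fS_ge0 F) andbT.
  by have := fN_ge F Xu; rewrite N0 pmulr_rle0 ?(fl1_gt0 F).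
rewrite leNgt; apply/negP => B0.
have C0 : 0 <= C.
  by have := hC _ Xu; rewrite S0 addr0 mulr1; apply: le_trans.
pose t := ((C + 1) / `|B u|) `^ beta^-1.
have t0 : 0 <= t by exact: powR_ge0.
have := hC _ (fX_scale F t Xu).
rewrite (fB_scale F)// (fS_scale F)// S0 mulr0 addr0 mulr1 normrM.
rewrite (ger0_norm (powR_ge0 _ _)) /t -powRrM mulVf ?gt_eqF//.
rewrite powRr1 ?divr_ge0 ?addr_ge0// divfK ?gt_eqF//; lra.
Qed.

Lemma normalize u : X u -> 0 < S u -> exists2 t, 0 < t &
   [/\ S (scalef t u) = 1, N (scalef t u) = N u / S u &
       B (scalef t u) = B u / S u `^ (beta / p)].
Proof.
move=> Xu S0; exists (S u `^ (- p^-1)); first exact: powR_gt0.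
have t0 := powR_ge0 (S u) (- p^-1).
have e : (S u `^ (- p^-1)) `^ p = (S u)^-1.
  by rewrite -powRrM mulNr mulVf ?gt_eqF// powR_inv1 ?ltW.
split.
- by rewrite (fS_scale F)// e mulVf ?gt_eqF.
- by rewrite (fN_scale F)// e mulrC.
- rewrite (fB_scale F)// mulrC -powRrM (_ : - p^-1 * beta = - (beta / p)).
    by rewrite powRN.
  by rewrite mulNr mulrC.
Qed.

(** The heart of the matter: near the first eigenvalue, excess <= 0 forces B to be
negative with a quantitative bound. Otherwise there are u_k with S u_k = 1,
N u_k -> l1 and lower limit of B u_k at least 0; by compactness they have a limit
w that is a ground state with 0 <= B w, against [fB_ground]. *)
Lemma spectral_gap : exists2 d, 0 < d & exists2 e, 0 < e & forall u, X u ->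
  N u <= (l1 + d) * S u -> B u <= - e * S u `^ (beta / p).
Proof.
suff [d d0 h] : exists2 d, 0 < d & forall u, X u -> S u = 1 -> N u <= l1 + d ->
    B u <= - d.
  exists d => //; exists d => // u Xu hu.
  (* if S u = 0 the claim is B u <= 0, and then N u = 0 too *)
  have [/eqP S0|S0] := boolP (S u == 0); last first.
    have {S0}S0 : 0 < S u by rewrite lt_def S0 (fS_ge0 F).
    have [t t0 [S1 N1 B1]] := normalize Xu S0.
    have := h _ (fX_scale F t Xu) S1.
    by rewrite N1 B1 ler_pdivrMr// ler_pdivrMr ?powR_gt0//; apply.
  have N0 : N u = 0.
    by apply/eqP; rewrite eq_le (fN_ge0 F) andbT; rewrite S0 mulr0 in hu.
  have [C _ hC] := B_le_N.
  have b0p : beta / p != 0 by rewrite mulf_neq0 ?invr_eq0 ?gt_eqF.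
  have := hC _ Xu; rewrite N0 S0 powR0// !mulr0.
  by apply: le_trans; exact: ler_norm.
apply: contrapT => nh.
have /choice[u hu] : forall k : nat, exists u, [/\ X u, S u = 1,
    N u <= l1 + k.+1%:R^-1 & - k.+1%:R^-1 <= B u].
  move=> k; apply: contrapT => nk; apply: nh; exists k.+1%:R^-1 => // u Xu S1 N1.
  rewrite leNgt; apply/negP => hB; apply: nk; exists u; split => //.
  exact: ltW.
have X_u k : X (u k) by case: (hu k).
have S_u k : S (u k) = 1 by case: (hu k).
have i1 k : k.+1%:R^-1 <= 1 :> R by rewrite invf_le1// ler1n.
have l0 := fl1_gt0 F.
have [||k [w [km Xw Sw Bw Nw]]] := fcompact F (M := l1 + 1) X_u.
- by move=> k; case: (hu k) => _ _ h _; rewrite (le_trans h)// lerD2l.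
- by move=> k; rewrite S_u lerDr ltW.
have Sw1 : S w = 1.
  have e1 : (fun m => S (u (k m))) = fun=> 1 by apply/funext => m; exact: S_u.
  by move: Sw; rewrite e1 => /(cvg_lim (@Rhausdorff R)) <-; rewrite lim_cst.
have inv0 : (fun m => m.+1%:R^-1) @ \oo --> (0 : R).
  exact: cvg_harmonic.
have kinv m : (k m).+1%:R^-1 <= m.+1%:R^-1 :> R.
  by rewrite lef_pV2 ?posrE// ler_nat ltnS.
have Bw0 : 0 <= B w.
  have : (fun m : nat => - m.+1%:R^-1) @ \oo --> - (0 : R) by exact: cvgN.
  rewrite oppr0 => /ler_cvg_to; apply; [exact: Bw|].
  apply: nearW => m /=; case: (hu (k m)) => _ _ _; apply: le_trans.
  by rewrite lerN2.
have Nw1 : N w <= l1.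
  apply/ler_addgt0Pr => e e0; apply: Nw.
  have /cvgrPdist_lt/(_ _ e0) := inv0.
  apply: filterS => m; rewrite sub0r normrN ger0_norm// => he.
  case: (hu (k m)) => _ _ h _; rewrite (le_trans h)// lerD2l ltW//.
  exact: le_lt_trans he.
have := fB_ground F Xw.
rewrite Sw1 ltr01 mulr1 => /(_ erefl) h; move: Bw0; rewrite leNgt h//.
by apply/eqP; rewrite eq_le Nw1 /=; have := fN_ge F Xw; rewrite Sw1 mulr1.
Qed.

(** Existence of minimizers on either part of the Nehari manifold. Along a bounded
minimizing sequence B = - energy / gap converges, so the limit w has
B w = - m / gap, while semicontinuity only gives excess w <= B w. Passing to |w|
preserves this. Projecting |w| to the manifold by the factor
t = (B / excess)^(1 / (p - beta)) gives the energy - gap t^beta B w = t^beta m: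
if m < 0 < B w then t >= 1, and if B w < 0 < m then excess <= B w < 0 gives t <= 1.
In both cases the energy does not exceed m.

The last premise, that B w and excess w have the same sign, is where the two parts
of the manifold differ. *)
Lemma nehari_limit lam (u : nat -> T -> R) (M m : R) : m != 0 ->
  (forall k, nehari lam (u k)) -> (forall k, N (u k) <= M) ->
  (forall k, S (u k) <= M) -> energy lam (u k) @[k --> \oo] --> m ->
  (forall w, X w -> B w = - m / gap -> excess lam w <= B w ->
     0 < B w / excess lam w) ->
  exists w, [/\ nehari lam w, B w * m < 0, energy lam w <= m &
    forall x, 0 <= w x].
Proof.
move=> m0 hu hN hS hm hpos.
have g0 := gap_gt0.
have Xu k : X (u k) by case: (hu k).
have [k [w [km Xw Sw Bw Nw]]] := fcompact F Xu hN hS.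
have Jk : energy lam (u (k i)) @[i --> \oo] --> m.
  apply: (@cvg_comp _ _ _ k (fun k => energy lam (u k)) _ _ _ _ hm) => A [n _ nA].
  by exists n => // i /= ni; apply: nA => /=; rewrite (leq_trans ni).
have Bm : B w = - m / gap.
  have : - gap^-1 * energy lam (u (k i)) @[i --> \oo] --> - gap^-1 * m.
    by apply: cvgM => //; exact: cvg_cst.
  have -> : (fun i => - gap^-1 * energy lam (u (k i))) = (fun i => B (u (k i))).
    by apply/funext => i; rewrite energy_nehari//; field; rewrite gt_eqF.
  move=> /(cvg_lim (@Rhausdorff R)); move/(cvg_lim (@Rhausdorff R)): Bw => -> ->.
  by ring.
have Aw : excess lam w <= B w.
  rewrite /excess lerBlDr; apply/ler_addgt0Pr => e e0; apply: Nw.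
  have : B (u (k i)) + lam * S (u (k i)) @[i --> \oo] --> B w + lam * S w.
    by apply: cvgD => //; apply: cvgM => //; exact: cvg_cst.
  move=> /cvgrPdist_lt/(_ _ e0); apply: filterS => i.
  have [_ <-] := hu (k i); rewrite /excess subrK => h.
  by move: h; rewrite ltr_norml => /andP[]; lra.
pose v := absf w.
have Xv : X v := fX_abs F Xw.
have Bv : B v = B w := fB_abs F Xw.
have Av : excess lam v <= excess lam w.
  by rewrite /excess (fS_abs F Xw) lerD2r (fN_abs F).
have hv : 0 < B v / excess lam v.
  by apply: hpos; rewrite ?Bv//; exact: le_trans Aw.
pose t := fib lam v.
have nt := fib_nehari Xv hv.
have t0 : 0 < t := fib_gt0 hv.
have tB : B (scalef t v) = t `^ beta * B w.
  by rewrite (fB_scale F) ?ltW// Bv.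
exists (scalef t v); split => //.
- rewrite tB Bm; have tb : 0 < t `^ beta by rewrite powR_gt0.
  have m2 : 0 < m ^+ 2 by rewrite exprn_even_gt0.
  rewrite (_ : _ * m = - (t `^ beta / gap * m ^+ 2)); last by ring.
  by rewrite oppr_lt0 mulr_gt0// divr_gt0.
- rewrite energy_nehari// -/t tB.
  rewrite (_ : m = - gap * B w); last first.
    by rewrite Bm; field; rewrite gt_eqF.
  rewrite !mulNr lerN2 ler_pM2l// /t /fib -powRrM.
  set e := _ * beta.
  have e0 : 0 <= e by rewrite mulr_ge0 ?invr_ge0 ?ltW.
  have e1 : 1 `^ e = 1 :> R by rewrite powR1.
  have AB : excess lam v <= B v by rewrite Bv (le_trans Av).
  have : B v != 0 by apply: contraPneq hv => ->; rewrite mul0r ltxx.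
  rewrite -Bv neq_lt => /orP[Bn|Bp].
    have An : excess lam v < 0 by exact: le_lt_trans Bn.
    apply: ler_niMl; first exact: ltW.
    rewrite -[leRHS]e1 ge0_ler_powR ?nnegrE ?ler01 ?(ltW hv) ?Bv//=.
    rewrite -?Bv; by rewrite ler_ndivrMr// mul1r.
  have Ap : 0 < excess lam v.
    by move: hv; rewrite pmulr_rgt0// invr_gt0.
  apply: ler_peMl; first exact: ltW.
  rewrite -[leLHS]e1 ge0_ler_powR ?nnegrE ?ler01 ?(ltW hv) ?Bv//=.
  rewrite -?Bv; by rewrite ler_pdivlMr// mul1r.
- by move=> x; exact: mulr_ge0 (ltW t0) (normr_ge0 _).
Qed.

Definition nplus lam u := nehari lam u /\ 0 < excess lam u.
Definition nminus lam u := nehari lam u /\ excess lam u < 0.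
Definition minimizer lam (A : set (T -> R)) u :=
  A u /\ forall v, A v -> energy lam u <= energy lam v.

(** The upper bound inf + 1 along the whole sequence is what keeps the sequence
bounded on the negative part of the manifold. *)
Lemma minimizing_sequence lam (A : set (T -> R)) L : A !=set0 ->
  (forall u, A u -> L <= energy lam u) ->
  exists2 u : nat -> T -> R, (forall k, A (u k)) &
    energy lam (u k) @[k --> \oo] --> inf (energy lam @` A) /\
    (forall k, energy lam (u k) <= inf (energy lam @` A) + 1).
Proof.
move=> [a Aa] hL; set m := inf _.
have hi : has_inf (energy lam @` A).
  by split; [exists (energy lam a), a|exists L => _ [u Au <-]; exact: hL].
have mle u : A u -> m <= energy lam u.
  by move=> Au; apply: ge_inf; [case: hi|exists u].
have /choice[u hu] : forall k : nat, exists u, A u /\ energy lam u < m + k.+1%:R^-1.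
  move=> k; have k0 : 0 < k.+1%:R^-1 :> R by [].
  by have [_ [u Au <-] ?] := inf_adherent k0 hi; exists u.
exists u; first by move=> k; case: (hu k).
split; last first.
  move=> k; case: (hu k) => _ /ltW h; rewrite (le_trans h)// lerD2l.
  by rewrite invf_le1// ler1n.
apply/cvgrPdist_lt => e e0.
have /cvgrPdist_lt/(_ _ e0) := @cvg_harmonic R.
apply: filterS => k; rewrite sub0r normrN ger0_norm//= => h.
have [/mle h1 h2] := hu k.
rewrite distrC ger0_norm ?subr_ge0// ltrBlDl (lt_trans h2)// ltrD2l.
exact: h.
Qed.

Lemma inf_minimizer lam (A : set (T -> R)) L u :
  (forall u, A u -> L <= energy lam u) -> A u ->
  energy lam u <= inf (energy lam @` A) -> minimizer lam A u.
Proof.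
move=> hL Au hu; split => // v Av; apply: (le_trans hu); apply: ge_inf.
  by exists L => _ [w Aw <-]; exact: hL.
by exists v.
Qed.

Definition variation lam u v := E u v - lam * P u v - Q u v.

Lemma variation_opp lam u v : X u -> X v ->
  variation lam u (scalef (-1) v) = - variation lam u v.
Proof.
move=> Xu Xv; rewrite /variation (fE_opp F)// (fP_opp F)// (fQ_opp F)//; ring.
Qed.

Lemma cvg_of_quotient (f : nat -> R) (a l : R) :
  (f m - a) * m.+1%:R @[m --> \oo] --> l -> f m @[m --> \oo] --> a.
Proof.
move=> h.
have : (f m - a) * m.+1%:R * m.+1%:R^-1 + a @[m --> \oo] --> l * 0 + a.
  apply: cvgD; last exact: cvg_cst.
  by apply: cvgM => //; exact: cvg_harmonic.
rewrite mulr0 add0r; apply: eq_cvg_nat => m.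
by rewrite mulfK ?subrK ?gt_eqF.
Qed.

Section critical.
Variables (lam : R) (u v : T -> R).
Hypotheses (Xu : X u) (Xv : X v).
Let um m := linef u m.+1%:R^-1 v.

Lemma excess_deriv :
  (excess lam (um m) - excess lam u) * m.+1%:R @[m --> \oo] -->
  p * (E u v - lam * P u v).
Proof.
have : (N (um m) - N u) * m.+1%:R - lam * ((S (um m) - S u) * m.+1%:R)
    @[m --> \oo] --> p * E u v - lam * (p * P u v).
  apply: cvgB; first exact: fN_deriv F _ _ Xu Xv.
  by apply: cvgM; [exact: cvg_cst|exact: fS_deriv F _ _ Xu Xv].
have -> : p * E u v - lam * (p * P u v) = p * (E u v - lam * P u v) by ring.
by apply: eq_cvg_nat => m; rewrite /excess; ring.
Qed.

Let excess_cvg : excess lam (um m) @[m --> \oo] --> excess lam u.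
Proof. exact: cvg_of_quotient excess_deriv. Qed.

Let B_cvg : B (um m) @[m --> \oo] --> B u.
Proof. exact: cvg_of_quotient (fB_deriv F Xu Xv). Qed.

(** The first variation without Lagrange multipliers. If the energy does not
decrease from t_m u to t_m (u + v / (m + 1)) for some t_m tending to 1, the
difference of the two energies times m + 1 converges to the first variation at u
in the direction v. Taking the same factor t_m on both sides makes the derivative
of t_m disappear. *)
Lemma variation_ge0 (t : nat -> R) : t m @[m --> \oo] --> (1 : R) ->
  (\forall m \near \oo, 0 <= t m) ->
  (\forall m \near \oo, energy lam (scalef (t m) u) <=
     energy lam (scalef (t m) (um m))) -> 0 <= variation lam u v.
Proof.
move=> t1 t0 le_t.
have tr r : 0 < r -> (t m) `^ r @[m --> \oo] --> (1 : R).
  move=> /cvg_normr_powR/(_ t1); rewrite normr1 powR1.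
  apply: cvg_trans; apply: near_eq_cvg.
  by apply: filterS t0 => m tm; rewrite ger0_norm.
have : p^-1 * t m `^ p * ((excess lam (um m) - excess lam u) * m.+1%:R) -
    beta^-1 * t m `^ beta * ((B (um m) - B u) * m.+1%:R) @[m --> \oo] -->
    p^-1 * 1 * (p * (E u v - lam * P u v)) - beta^-1 * 1 * (beta * Q u v).
  apply: cvgB; (apply: cvgM; first (apply: cvgM; [exact: cvg_cst|exact: tr])).
    exact: excess_deriv.
  exact: fB_deriv F _ _ Xu Xv.
have -> : p^-1 * 1 * (p * (E u v - lam * P u v)) - beta^-1 * 1 * (beta * Q u v)
  = variation lam u v.
  by rewrite /variation; field; rewrite !gt_eqF.
move=> hlim; apply: (ler_cvg_to (cvg_cst (0 : R)) hlim).
near=> m; have t0m : 0 <= t m by near: m.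
have : energy lam (scalef (t m) u) <= energy lam (scalef (t m) (um m)).
  by near: m.
have Xum : X (um m) by exact: fX_line F _ _ _ Xu Xv.
rewrite !energy_scale// -subr_ge0 => h.
have := mulr_ge0 h (ler0n R m.+1); congr (0 <= _); ring.
Unshelve. all: by end_near. Qed.

(** A small perturbation of a point of the manifold with B u <> 0 stays in the
cone in which the ray meets the manifold, and on the side of u. *)
Lemma same_sign_near : excess lam u = B u -> B u != 0 ->
  \forall m \near \oo, 0 < B (um m) / excess lam (um m) /\
     0 < excess lam (um m) * B u.
Proof.
move=> AB B0.
have B2 : 0 < B u * B u by rewrite -expr2 exprn_even_gt0.
have h1 : B (um m) * B u @[m --> \oo] --> B u * B u.
  by apply: cvgM => //; exact: cvg_cst.
have h2 : excess lam (um m) * B u @[m --> \oo] --> excess lam u * B u.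
  by apply: cvgM => //; exact: cvg_cst.
rewrite AB in h2.
have n1 := cvgr_gt _ h1 _ B2.
have n2 := cvgr_gt _ h2 _ B2.
near=> m.
have c1 : 0 < B (um m) * B u by near: m; exact: n1.
have c2 : 0 < excess lam (um m) * B u by near: m; exact: n2.
split => //.
have e0 : excess lam (um m) != 0 by apply/eqP => e0; move: c2; rewrite e0 mul0r ltxx.
rewrite (_ : _ / _ = B (um m) * B u / (excess lam (um m) * B u)).
  by rewrite divr_gt0.
by field; rewrite B0 e0.
Unshelve. all: by end_near. Qed.

Lemma fib_cvg : excess lam u = B u -> B u != 0 ->
  fib lam (um m) @[m --> \oo] --> (1 : R).
Proof.
move=> AB B0.
have h : B (um m) / excess lam (um m) @[m --> \oo] --> (1 : R).
  rewrite -(mulfV B0) -{2}AB; apply: cvgM => //; apply: cvgV => //.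
  by rewrite AB.
have r0 : 0 < (p - beta)^-1 by rewrite invr_gt0.
have := cvg_normr_powR r0 h; rewrite normr1 powR1.
apply: cvg_trans; apply: near_eq_cvg.
have := same_sign_near AB B0; apply: filterS => m [hm _].
by rewrite /fib gtr0_norm.
Qed.

End critical.

Lemma nehari_ray_extremum lam u s : nehari lam u -> 0 <= s ->
  (0 < B u -> energy lam u <= energy lam (scalef s u)) /\
  (B u < 0 -> energy lam (scalef s u) <= energy lam u).
Proof.
move=> [Xu AB] s0; have := young s0.
rewrite energy_scale// energyE AB => hy; split => B0.
  have := ler_wpM2l (ltW B0) hy; congr (_ <= _); ring.
have := ler_wnM2l (ltW B0) hy; congr (_ <= _); ring.
Qed.

(** On the positive part a point of the manifold is the minimum of its ray. So
with w = u + v / (m + 1) projected to the manifold as t w, energy u <=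
energy (t w) <= energy w, and the factors t_m = 1 suffice. *)
Lemma nplus_ge0 lam u v : minimizer lam (nplus lam) u -> X v ->
  0 <= variation lam u v.
Proof.
move=> [[nu Ap] hm] Xv; have [Xu AB] := nu.
have B0 : 0 < B u by rewrite -AB.
apply: (variation_ge0 Xu Xv (t := fun=> 1)); first exact: cvg_cst.
  exact: nearW.
have := same_sign_near Xu Xv AB (lt0r_neq0 B0); apply: filterS => m [h1 h2].
set um := linef _ _ _ in h1 h2 *.
have Xum : X um by exact: fX_line F _ _ _ Xu Xv.
have sc1 w : scalef 1 w = w by apply/funext => x; rewrite /scalef mul1r.
rewrite !sc1; have nf := fib_nehari Xum h1.
have t0 := fib_gt0 h1.
have Aum : 0 < excess lam um by move: h2; rewrite pmulr_lgt0.
have npf : nplus lam (scalef (fib lam um) um).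
  by split => //; rewrite excess_scale ?ltW// mulr_gt0// powR_gt0.
apply: (le_trans (hm _ npf)).
have i0 : 0 <= (fib lam um)^-1 by rewrite invr_ge0 ltW.
have [+ _] := nehari_ray_extremum nf i0.
have -> : scalef (fib lam um)^-1 (scalef (fib lam um) um) = um.
  by apply/funext => x; rewrite /scalef mulKf// gt_eqF.
by apply; case: npf => -[_ <-].
Qed.

(** On the negative part a point of the manifold is the maximum of its ray. With t
the projection factor of w = u + v / (m + 1), energy (t u) <= energy u <=
energy (t w), and t tends to 1. *)
Lemma nminus_ge0 lam u v : minimizer lam (nminus lam) u -> X v ->
  0 <= variation lam u v.
Proof.
move=> [[nu Ap] hm] Xv; have [Xu AB] := nu.
have B0 : B u < 0 by rewrite -AB.
have Bn := ltr0_neq0 B0.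
apply: (variation_ge0 Xu Xv (t := fun m => fib lam (linef u m.+1%:R^-1 v))).
- exact: fib_cvg.
- by apply: nearW => m; exact: fib_ge0.
have := same_sign_near Xu Xv AB Bn; apply: filterS => m [h1 h2].
set um := linef _ _ _ in h1 h2 *.
have Xum : X um by exact: fX_line F _ _ _ Xu Xv.
have nf := fib_nehari Xum h1.
have t0 := fib_gt0 h1.
have Aum : excess lam um < 0 by move: h2; rewrite nmulr_lgt0.
have npf : nminus lam (scalef (fib lam um) um).
  by split => //; rewrite excess_scale ?ltW// pmulr_rlt0// powR_gt0.
apply: le_trans (hm _ npf).
by have [_] := nehari_ray_extremum nu (ltW t0); apply.
Qed.

Lemma minimizer_critical lam u v :
  minimizer lam (nplus lam) u \/ minimizer lam (nminus lam) u -> X v ->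
  E u v = lam * P u v + Q u v.
Proof.
move=> mu Xv; have Xu : X u by case: mu => -[[[]]].
have ge0 w : X w -> 0 <= variation lam u w.
  by case: mu => mu Xw; [exact: nplus_ge0|exact: nminus_ge0].
have h1 := ge0 _ Xv; have := ge0 _ (fX_scale F (-1) Xv).
rewrite variation_opp// oppr_ge0 => h2.
have : variation lam u v = 0 by apply/eqP; rewrite eq_le h1 h2.
by rewrite /variation; lra.
Qed.

Section near_ground.
(* d and e are the constants of spectral_gap *)
Variables d e : R.
Hypotheses (d0 : 0 < d) (e0 : 0 < e).
Hypothesis gapP : forall u, X u -> N u <= (l1 + d) * S u ->
  B u <= - e * S u `^ (beta / p).
Variable lam : R.
Hypothesis hlam : l1 < lam < l1 + d.
Let ctx : [/\ 0 < l1, 0 < d, l1 < lam & lam < l1 + d].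
Proof. by have l0 := fl1_gt0 F; case/andP: hlam. Qed.

(** The contrapositive of the spectral gap: 0 <= B u puts N u above
(l1 + d) S u, so for lambda < l1 + d the excess controls N. *)
Lemma excess_pos u : X u -> 0 <= B u -> 0 < N u ->
  (1 - lam / (l1 + d)) * N u <= excess lam u.
Proof.
move=> Xu B0 N0; have [h|h] := leP (N u) ((l1 + d) * S u).
  have := gapP Xu h; have S0 : 0 < S u.
    rewrite lt_def (fS_ge0 F) andbT; apply: contraTneq h => ->.
    by rewrite mulr0 -ltNge.
  have : 0 < e * S u `^ (beta / p) by rewrite mulr_gt0// powR_gt0.
  lra.
have [l0 dp lamp lamd] := ctx; have ld : 0 < l1 + d by lra.
have lam0 : 0 < lam by lra.
rewrite /excess mulrBl mul1r lerD2l lerN2 mulrAC -mulrA ler_pM2l//.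
by rewrite ler_pdivlMr// mulrC ltW.
Qed.

Lemma nminus_bounds u : X u -> excess lam u < 0 ->
  0 < S u /\ B u <= - e * S u `^ (beta / p).
Proof.
move=> Xu An; have [l0 dp lamp lamd] := ctx; split.
  rewrite lt_def (fS_ge0 F) andbT; apply: contraTneq An => S0.
  by rewrite /excess S0 mulr0 subr0 -leNgt (fN_ge0 F).
apply: gapP => //; move: An; rewrite /excess subr_lt0 => /ltW/le_trans; apply.
by rewrite ler_wpM2r ?(fS_ge0 F)//; lra.
Qed.

(** On the negative part e S^(beta / p) <= - B = - excess <= (lambda - l1) S, and
beta < p. This is the source of both blow-up statements. *)
Lemma nminus_S u : nminus lam u ->
  (e / (lam - l1)) `^ (p / (p - beta)) <= S u.
Proof.
move=> [[Xu AB] An]; have [S0 hB] := nminus_bounds Xu An.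
have ll : 0 < lam - l1 by rewrite subr_gt0; case/andP: hlam.
have h1 : e * S u `^ (beta / p) <= (lam - l1) * S u.
  have := fN_ge F Xu; move: hB; rewrite -AB /excess; lra.
have Sp : S u = S u `^ ((p - beta) / p) * S u `^ (beta / p).
  rewrite -powRD ?(gt_eqF S0) ?implybT// -mulrDl subrK mulfV ?gt_eqF//.
  by rewrite powRr1// ltW.
have Sb : 0 < S u `^ (beta / p) by exact: powR_gt0.
rewrite {2}Sp mulrA ler_pM2r// -ler_pdivrMl// mulrC in h1.
have -> : S u = (S u `^ ((p - beta) / p)) `^ (p / (p - beta)).
  rewrite -powRrM (_ : _ * _ = 1) ?powRr1 ?ltW//.
  by field; rewrite !gt_eqF.
by apply: ge0_ler_powR; rewrite ?nnegrE ?powR_ge0//; apply: divr_ge0; exact: ltW.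
Qed.

Lemma nminus_energy u : nminus lam u ->
  gap * e * (e / (lam - l1)) `^ (beta / (p - beta)) <= energy lam u.
Proof.
move=> nu; have [nhu An] := nu; have [S0 hB] := nminus_bounds nhu.1 An.
rewrite energy_nehari// -mulrA mulNr -mulrN ler_pM2l ?gap_gt0//.
apply: (@le_trans _ _ (e * S u `^ (beta / p))); last by move: hB; lra.
rewrite ler_pM2l//.
have -> : beta / (p - beta) = p / (p - beta) * (beta / p).
  by field; rewrite !gt_eqF.
rewrite powRrM; apply: ge0_ler_powR; last exact: nminus_S.
- by apply: divr_ge0; exact: ltW.
- by rewrite nnegrE powR_ge0.
- by rewrite nnegrE ltW.
Qed.

Lemma nminus_nonempty : (exists u, [/\ X u, 0 < S u & N u = l1 * S u]) ->
  nminus lam !=set0.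
Proof.
move=> [u [Xu S0 Nu]]; have Bn := fB_ground F Xu S0 Nu.
have An : excess lam u < 0.
  by rewrite /excess Nu -mulrBl pmulr_llt0// subr_lt0; case/andP: hlam.
have h : 0 < B u / excess lam u by rewrite nmulr_rgt0// invr_lt0.
exists (scalef (fib lam u) u); split; first exact: fib_nehari.
by rewrite excess_scale ?fib_ge0// pmulr_rlt0// powR_gt0// fib_gt0.
Qed.

Lemma nplus_nonempty : (exists2 u, X u & 0 < B u) -> nplus lam !=set0.
Proof.
move=> [u Xu Bu]; have [l0 dp lamp lamd] := ctx.
have N0 : 0 < N u.
  rewrite lt_def (fN_ge0 F) andbT; apply: contraTneq Bu => N0.
  have [C _ hC] := B_le_N; have := hC _ Xu.
  rewrite N0 powR0 ?mulf_neq0 ?invr_eq0 ?gt_eqF// mulr0 normr_le0 => /eqP ->.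
  by rewrite ltxx.
have Ap : 0 < excess lam u.
  apply: lt_le_trans (excess_pos Xu (ltW Bu) N0); rewrite mulr_gt0// subr_gt0.
  by rewrite ltr_pdivrMr ?mul1r; lra.
have h : 0 < B u / excess lam u by rewrite divr_gt0.
exists (scalef (fib lam u) u); split; first exact: fib_nehari.
by rewrite excess_scale ?fib_ge0// mulr_gt0// powR_gt0// fib_gt0.
Qed.

(** There excess = B, hence c N <= excess = B <= C N^(beta / p) with beta < p. *)
Lemma nplus_bound : exists2 M, 0 <= M & forall u, nplus lam u -> N u <= M.
Proof.
have [l0 dp lamp lamd] := ctx.
have [C C0 hC] := B_le_N; pose c := 1 - lam / (l1 + d).
have c0 : 0 < c by rewrite subr_gt0 ltr_pdivrMr ?mul1r; lra.
exists ((C / c) `^ (p / (p - beta))); first exact: powR_ge0.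
move=> u [[Xu AB] Ap].
have N0 : 0 < N u.
  rewrite (lt_le_trans Ap)// /excess gerBl mulr_ge0 ?(fS_ge0 F)//; lra.
have h1 : c * N u <= C * N u `^ (beta / p).
  apply: (le_trans (excess_pos Xu _ N0)); first by rewrite -AB ltW.
  by rewrite AB (le_trans _ (hC _ Xu))// ler_norm.
have Sp : N u = N u `^ ((p - beta) / p) * N u `^ (beta / p).
  rewrite -powRD ?(gt_eqF N0) ?implybT// -mulrDl subrK mulfV ?gt_eqF//.
  by rewrite powRr1// ltW.
have Sb : 0 < N u `^ (beta / p) by exact: powR_gt0.
rewrite {1}Sp mulrA ler_pM2r// -ler_pdivlMl// [leRHS]mulrC in h1.
have -> : N u = (N u `^ ((p - beta) / p)) `^ (p / (p - beta)).
  rewrite -powRrM (_ : _ * _ = 1) ?powRr1 ?ltW//.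
  by field; rewrite !gt_eqF.
apply: ge0_ler_powR; rewrite ?nnegrE ?powR_ge0//.
- by apply: divr_ge0; exact: ltW.
- by apply: divr_ge0 => //; exact: ltW.
Qed.

(** The infimum m is negative because the energy is - gap * B on the manifold. So
the limit w of a minimizing sequence has B w > 0, and [excess_pos] makes its
excess positive. *)
Lemma nplus_minimizer : (exists2 u, X u & 0 < B u) ->
  exists2 u, minimizer lam (nplus lam) u & forall x, 0 <= u x.
Proof.
move=> /nplus_nonempty ne; have [l0 dp lamp lamd] := ctx; have g0 := gap_gt0.
have [M M0 hM] := nplus_bound; have [C C0 hC] := B_le_N.
have hS u : nplus lam u -> S u <= M / l1.
  move=> nu; rewrite ler_pdivlMr// mulrC (le_trans (fN_ge F nu.1.1))//.
  exact: hM.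
have hL u : nplus lam u -> - gap * (C * M `^ (beta / p)) <= energy lam u.
  move=> nu; rewrite energy_nehari; last exact: nu.1.
  rewrite !mulNr lerN2 ler_pM2l// (le_trans (ler_norm _))//.
  rewrite (le_trans (hC _ nu.1.1))// ler_wpM2l// ge0_ler_powR ?nnegrE//.
  - by rewrite divr_ge0 ?ltW.
  - exact: fN_ge0 F _.
  - exact: hM.
have [u hu [um _]] := minimizing_sequence ne hL.
set m := inf _ in um.
have mn : m < 0.
  have [v nv] := ne; have Jv : energy lam v < 0.
    rewrite energy_nehari; last exact: nv.1.
    rewrite mulNr oppr_lt0 mulr_gt0//.
    by case: nv => [[_ <-]].
  apply: le_lt_trans Jv; apply: ge_inf; last by exists v.
  by exists (- gap * (C * M `^ (beta / p))) => _ [w Aw <-]; exact: hL.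
have [|||w [nw Bm Jw w0]] := nehari_limit (M := M + M / l1) (ltr0_neq0 mn)
    (fun k => (hu k).1) _ _ um.
- by move=> k; rewrite (le_trans (hM _ (hu k)))// lerDl divr_ge0// ltW.
- by move=> k; rewrite (le_trans (hS _ (hu k)))// lerDr.
- move=> w Xw Bw AB.
  have B0 : 0 < B w by rewrite Bw divr_gt0// oppr_gt0.
  have N0 : 0 < N w.
    rewrite lt_def (fN_ge0 F) andbT; apply: contraTneq B0 => N0.
    have := hC _ Xw.
    rewrite N0 powR0 ?mulf_neq0 ?invr_eq0 ?gt_eqF// mulr0 normr_le0 => /eqP ->.
    by rewrite ltxx.
  rewrite divr_gt0//; apply: lt_le_trans (excess_pos Xw (ltW B0) N0).
  rewrite mulr_gt0// subr_gt0.
  by rewrite ltr_pdivrMr ?mul1r; lra.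
exists w => //; apply: (inf_minimizer hL) => //; split => //.
by rewrite nw.2; move: Bm; rewrite nmulr_llt0.
Qed.

(** The infimum m is positive by [nminus_energy], and an upper bound on the
energy - gap * B is an upper bound on S, again by the spectral gap. The limit w
has B w < 0, so excess w <= B w is negative as well. *)
Lemma nminus_minimizer : (exists u, [/\ X u, 0 < S u & N u = l1 * S u]) ->
  exists2 u, minimizer lam (nminus lam) u & forall x, 0 <= u x.
Proof.
move=> /nminus_nonempty ne; have [l0 dp lamp lamd] := ctx; have g0 := gap_gt0.
have ll : 0 < lam - l1 by rewrite subr_gt0; case/andP: hlam.
have [u hu [um um1]] := minimizing_sequence ne nminus_energy.
set m := inf _ in um um1.
have mp : 0 < m.
  apply: (@lt_le_trans _ _ (gap * e * (e / (lam - l1)) `^ (beta / (p - beta)))).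
    by rewrite !mulr_gt0// powR_gt0// divr_gt0.
  apply: lb_le_inf; first by case: ne => v nv; exists (energy lam v), v.
  by move=> _ [v nv <-]; exact: nminus_energy.
pose M := ((m + 1) / gap / e) `^ (p / beta).
have hS k : S (u k) <= M.
  have [S0 hB] := nminus_bounds (hu k).1.1 (hu k).2.
  have := um1 k; rewrite (energy_nehari (hu k).1) => h.
  have h1 : S (u k) `^ (beta / p) <= (m + 1) / gap / e.
    rewrite !ler_pdivlMr//; apply: le_trans h.
    rewrite mulNr -mulrN [_ * gap]mulrC ler_pM2l//; move: hB; lra.
  have -> : S (u k) = (S (u k) `^ (beta / p)) `^ (p / beta).
    by rewrite -powRrM (_ : _ * _ = 1) ?powRr1 ?ltW//; field; rewrite !gt_eqF.
  apply: ge0_ler_powR; rewrite ?nnegrE ?powR_ge0//.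
    by apply: divr_ge0; exact: ltW.
  exact: le_trans (powR_ge0 _ _) h1.
have M0 : 0 <= M by exact: powR_ge0.
have [|||w [nw Bm Jw w0]] := nehari_limit (M := M + lam * M) (lt0r_neq0 mp)
    (fun k => (hu k).1) _ _ um.
- move=> k; have [_ /ltW] := hu k; rewrite /excess subr_le0 => /le_trans; apply.
  by rewrite ler_wpDl// ler_wpM2l//; lra.
- by move=> k; rewrite (le_trans (hS k))// lerDl mulr_ge0//; lra.
- move=> w Xw Bw AB.
  have B0 : B w < 0 by rewrite Bw mulNr oppr_lt0 divr_gt0.
  by rewrite nmulr_rgt0// invr_lt0; exact: le_lt_trans B0.
exists w => //; apply: (inf_minimizer nminus_energy) => //; split => //.
by rewrite nw.2; move: Bm; rewrite pmulr_llt0.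
Qed.
End near_ground.
End theory.
End abstract.

(** * Inequalities between powers of real numbers *)

Section real_ineq.
Context {R : realType}.
Implicit Types (a b c d h r p s t x y : R).

Lemma powR_convex r t x y : 1 <= r -> 0 <= t <= 1 -> 0 <= x -> 0 <= y ->
  (t * x + (1 - t) * y) `^ r <= t * x `^ r + (1 - t) * y `^ r.
Proof.
move=> r1 /andP[t0 t1] x0 y0.
have := convex_powR r1 (Itv01 t0 t1) (x := x) (y := y).
rewrite !inE /= !in_itv/= !andbT => /(_ x0 y0).
exact.
Qed.

Lemma normr_powR_convex r t x y : 1 <= r -> 0 <= t <= 1 ->
  `|t * x + (1 - t) * y| `^ r <= t * `|x| `^ r + (1 - t) * `|y| `^ r.
Proof.
move=> r1 t01; have /andP[t0 t1] := t01.
apply: le_trans (powR_convex r1 t01 (normr_ge0 x) (normr_ge0 y)).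
have r0 : 0 <= r by rewrite (le_trans ler01).
apply: ge0_ler_powR; rewrite ?nnegrE// ?addr_ge0// ?mulr_ge0// ?subr_ge0//.
have u0 : 0 <= 1 - t by rewrite subr_ge0.
by rewrite (le_trans (ler_normD _ _))// !normrM (ger0_norm t0) (ger0_norm u0).
Qed.

Lemma normr_powR_sqr p x : `|x| `^ p = (x ^+ 2) `^ (p / 2).
Proof.
by rewrite -real_normK ?num_real// -powR_mulrn// -powRrM mulrC divfK.
Qed.

(** Strict convexity comes from |x|^p = (x^2)^(p/2): with p/2 >= 1 the outer power
is convex and increasing, and the square is strictly convex. *)
Lemma normr_powR_strict p t x y : 2 <= p -> 0 < t < 1 ->
  t * `|x| `^ p + (1 - t) * `|y| `^ p <= `|t * x + (1 - t) * y| `^ p -> x = y.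
Proof.
move=> p2 /andP[t0 t1]; rewrite !normr_powR_sqr => h; apply/eqP/negPn/negP => xy.
have q1 : 1 <= p / 2 by rewrite ler_pdivlMr// mul1r.
have t01 : 0 <= t <= 1 by rewrite !ltW.
have u0 : 0 < 1 - t by rewrite subr_gt0.
have := le_trans (powR_convex q1 t01 (sqr_ge0 x) (sqr_ge0 y)) h.
apply/negP; rewrite -ltNge; apply: gt0_ltr_powR.
- exact: lt_le_trans ltr01 q1.
- by rewrite nnegrE sqr_ge0.
- by rewrite nnegrE; apply: addr_ge0; apply: mulr_ge0; rewrite ?sqr_ge0//; exact: ltW.
rewrite -subr_gt0.
have -> : t * x ^+ 2 + (1 - t) * y ^+ 2 - (t * x + (1 - t) * y) ^+ 2 =
  t * (1 - t) * (x - y) ^+ 2 by ring.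
by apply: mulr_gt0; [exact: mulr_gt0|rewrite exprn_even_gt0//= subr_eq0].
Qed.

Lemma normrD_powR r x y : 0 < r ->
  `|x + y| `^ r <= 2 `^ r * (`|x| `^ r + `|y| `^ r).
Proof.
move=> r0.
have mx : `|x + y| <= 2 * Num.max `|x| `|y|.
  rewrite (le_trans (ler_normD _ _))// mulr_natl mulr2n lerD//.
    by rewrite le_max lexx.
  by rewrite le_max lexx orbT.
have m0 : 0 <= Num.max `|x| `|y| by rewrite le_max normr_ge0.
have := @ge0_ler_powR R r (ltW r0) `|x + y| (2 * Num.max `|x| `|y|).
rewrite !nnegrE normr_ge0 mulr_ge0// => /(_ isT isT mx).
move=> /le_trans; apply; rewrite powRM// ler_wpM2l ?powR_ge0//.
case: (leP `|x| `|y|) => _; rewrite ?lerDl ?lerDr powR_ge0//.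
Qed.

Definition pnorm p a b := (a `^ p + b `^ p) `^ p^-1.

Lemma pnorm_ge0 p a b : 0 <= pnorm p a b. Proof. exact: powR_ge0. Qed.

Lemma pnormK p a b : 0 < p -> pnorm p a b `^ p = a `^ p + b `^ p.
Proof.
move=> p0; rewrite /pnorm -powRrM mulVf ?gt_eqF// powRr1//.
by rewrite addr_ge0 ?powR_ge0.
Qed.

(** The reverse triangle inequality for the l^p norm of the plane, with its equality
case; r and s are the norms of (a, b) and (c, d). With t = s / r the point
(a, b) / r is the convex combination of (c, d) / s and
(a - c, b - d) / (r - s) with weights t and 1 - t. Summing the convexity
inequality over the two coordinates gives
1 <= t + (1 - t) (|a - c|^p + |b - d|^p) / (r - s)^p. Equality forces both
coordinates of the two points to agree, so (a, b) and (c, d) are parallel. *)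
Lemma plane_minkowski p a b c d r s : 2 <= p ->
  0 <= a -> 0 <= b -> 0 <= c -> 0 <= d -> 0 <= s -> s <= r ->
  r `^ p = a `^ p + b `^ p -> s `^ p = c `^ p + d `^ p ->
  (r - s) `^ p <= `|a - c| `^ p + `|b - d| `^ p /\
  (`|a - c| `^ p + `|b - d| `^ p <= (r - s) `^ p -> a * d = b * c).
Proof.
move=> p2 a0 b0 c0 d0 s0 rs rp sp; have p0 : 0 < p by exact: lt_le_trans p2.
have pn : p != 0 by rewrite gt_eqF.
(* r = s: equality means (a, b) = (c, d) *)
have [rs1|rs1] := eqVneq r s.
  rewrite rs1 subrr powR0//; split; first by rewrite addr_ge0 ?powR_ge0.
  move=> h3; have : `|a - c| `^ p + `|b - d| `^ p == 0.
    by rewrite eq_le h3 addr_ge0 ?powR_ge0.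
  rewrite paddr_eq0 ?powR_ge0// => /andP[/eqP/powR_eq0_eq0/normr0_eq0 h4].
  move=> /eqP/powR_eq0_eq0/normr0_eq0/subr0_eq ->.
  by rewrite (subr0_eq h4) mulrC.
have {rs rs1}rs : s < r by rewrite lt_neqAle eq_sym rs1.
have [se|s1] := eqVneq s 0.
  move: sp; rewrite se powR0// => /esym/eqP.
  rewrite paddr_eq0 ?powR_ge0// => /andP[/eqP/powR_eq0_eq0 -> /eqP/powR_eq0_eq0 ->].
  by rewrite !subr0 !mulr0 (ger0_norm a0) (ger0_norm b0) rp; split.
have {s0 s1}s0 : 0 < s by rewrite lt_def s1.
have r0 : 0 < r by exact: lt_trans rs.
have rs0 : 0 < r - s by rewrite subr_gt0.
pose t := s / r.
have t01 : 0 < t < 1 by rewrite divr_gt0//= ltr_pdivrMr// mul1r.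
have t01' : 0 <= t <= 1 by case/andP: t01 => /ltW -> /ltW ->.
have eA x y : x / r = t * (y / s) + (1 - t) * ((x - y) / (r - s)).
  rewrite /t; field; rewrite !gt_eqF//.
have dv x y : 0 < y -> `|x / y| `^ p = `|x| `^ p / y `^ p.
  move=> y0; rewrite normrM powRM// normfV (gtr0_norm y0) -[y^-1](powR_inv1 (ltW y0)).
  by rewrite -powRrM mulN1r powRN.
have p1 : 1 <= p by lra.
have ca := normr_powR_convex (c / s) ((a - c) / (r - s)) p1 t01'.
have cb := normr_powR_convex (d / s) ((b - d) / (r - s)) p1 t01'.
have sa := @normr_powR_strict p t (c / s) ((a - c) / (r - s)) p2 t01.
have sb := @normr_powR_strict p t (d / s) ((b - d) / (r - s)) p2 t01.
move: ca cb sa sb; rewrite -!eA !dv//.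
rewrite (ger0_norm a0) (ger0_norm b0) (ger0_norm c0) (ger0_norm d0).
move: (`|a - c| `^ p) (`|b - d| `^ p) => M1 M2.
have Rp : 0 < (r - s) `^ p by rewrite powR_gt0.
have rp0 : 0 < r `^ p by rewrite powR_gt0.
have sp0 : 0 < s `^ p by rewrite powR_gt0.
move=> ca cb sa sb.
have e1 : a `^ p / r `^ p + b `^ p / r `^ p = 1.
  by rewrite -mulrDl -rp mulfV// gt_eqF.
have e2 : c `^ p / s `^ p + d `^ p / s `^ p = 1.
  by rewrite -mulrDl -sp mulfV// gt_eqF.
have u0 : 0 < 1 - t by rewrite subr_gt0; case/andP: t01.
have e3 : (M1 + M2) / (r - s) `^ p = M1 / (r - s) `^ p + M2 / (r - s) `^ p.
  by rewrite mulrDl.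
have key : t * (c `^ p / s `^ p) + (1 - t) * (M1 / (r - s) `^ p) +
   (t * (d `^ p / s `^ p) + (1 - t) * (M2 / (r - s) `^ p)) =
   t + (1 - t) * ((M1 + M2) / (r - s) `^ p).
  by rewrite e3 -[X in _ = X + _]mulr1 -e2; ring.
split.
  have : (1 - t) * 1 <= (1 - t) * ((M1 + M2) / (r - s) `^ p) by lra.
  by rewrite ler_pM2l// ler_pdivlMr// mul1r.
move=> hM; have : (1 - t) * ((M1 + M2) / (r - s) `^ p) <= (1 - t) * 1.
  by rewrite ler_pM2l// ler_pdivrMr// mul1r.
move=> hM'.
have Ea : c / s = (a - c) / (r - s) by apply: sa; lra.
have Eb : d / s = (b - d) / (r - s) by apply: sb; lra.
have Fa : a / r = c / s by rewrite (eA a c) -Ea; ring.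
have Fb : b / r = d / s by rewrite (eA b d) -Eb; ring.
have -> : a = c / s * r by rewrite -Fa divfK ?gt_eqF.
have -> : b = d / s * r by rewrite -Fb divfK ?gt_eqF.
by ring.
Qed.

(** With (a, b) = (u x, v x) and (c, d) = (u y, v y) this compares the difference
quotients of (u^p + v^p)^(1/p) with those of u and v. *)
Lemma pnorm_dist p a b c d : 2 <= p -> 0 <= a -> 0 <= b -> 0 <= c -> 0 <= d ->
  `|pnorm p a b - pnorm p c d| `^ p <= `|a - c| `^ p + `|b - d| `^ p /\
  (`|a - c| `^ p + `|b - d| `^ p <= `|pnorm p a b - pnorm p c d| `^ p ->
   a * d = b * c).
Proof.
move=> p2 a0 b0 c0 d0; have p0 : 0 < p by exact: lt_le_trans p2.
have [h|/ltW h] := leP (pnorm p c d) (pnorm p a b).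
  rewrite ger0_norm ?subr_ge0//.
  exact: plane_minkowski (pnorm_ge0 _ _ _) h (pnormK _ _ p0) (pnormK _ _ p0).
rewrite distrC (distrC a) (distrC b) ger0_norm ?subr_ge0//.
have [h1 h2] := plane_minkowski p2 c0 d0 a0 b0 (pnorm_ge0 _ _ _) h
  (pnormK _ _ p0) (pnormK _ _ p0).
by split => // /h2; rewrite mulrC (mulrC d).
Qed.

(** The domination behind differentiation under the integral. Upper bound: x + s h
lies between x and x + h. Lower bound: x is the convex combination of x + s h and
x - h with weights 1 / (1 + s) and s / (1 + s). *)
Lemma quotient_bound r x h s : 1 <= r -> 0 < s <= 1 ->
  `| `|x + s * h| `^ r - `|x| `^ r| <= s * (`|x + h| `^ r + `|x - h| `^ r).
Proof.
move=> r1 /andP[s0 s1].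
have h1 := @normr_powR_convex r s (x + h) x r1.
have s01 : 0 <= s <= 1 by rewrite ltW.
have {h1} := h1 s01; rewrite (_ : s * (x + h) + _ = x + s * h); last by ring.
move=> h1.
pose t := (1 + s)^-1; have t0 : 0 < 1 + s by lra.
have t01 : 0 <= t <= 1 by rewrite invr_ge0 ltW//= invf_le1// lerDl ltW.
have := @normr_powR_convex r t (x + s * h) (x - h) r1 t01.
rewrite (_ : t * (x + s * h) + _ = x); last by rewrite /t; field; rewrite gt_eqF.
rewrite -(ler_pM2l t0).
rewrite (_ : _ * (t * _ + _) = `|x + s * h| `^ r + s * `|x - h| `^ r); last first.
  by rewrite /t; field; rewrite gt_eqF.
move=> h2; have := powR_ge0 `|x| r; have := powR_ge0 `|x - h| r.
have := powR_ge0 `|x + h| r => h3 h4 h5.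
have := mulr_ge0 (ltW s0) h3; have := mulr_ge0 (ltW s0) h4.
have := mulr_ge0 (ltW s0) h5 => h6 h7 h8.
rewrite ler_norml; apply/andP; split; lra.
Qed.

Lemma quotient_cvg r x h : 1 < r ->
  (`|x + m.+1%:R^-1 * h| `^ r - `|x| `^ r) * m.+1%:R @[m --> \oo] -->
  r * (`|x| `^ (r - 2) * x * h).
Proof.
move=> r1; have r0 : 0 < r by lra.
have H : (m.+1%:R^-1 : R) @[m --> \oo] --> (0 : R) by exact: cvg_harmonic.
have [->|h0] := eqVneq h 0.
  rewrite !mulr0; apply: eq_cvg_nat (cvg_cst 0) => m.
  by rewrite mulr0 addr0 subrr mul0r.
have [->|x0] := eqVneq x 0.
  (* at x = 0 the quotient is |h|^r (m + 1)^(1 - r) and r > 1 *)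
  rewrite mulr0 mul0r mulr0 normr0 powR0 ?gt_eqF//.
  have r10 : 0 < r - 1 by lra.
  have : `|h| `^ r * `|m.+1%:R^-1 : R| `^ (r - 1) @[m --> \oo] -->
      `|h| `^ r * `|0 : R| `^ (r - 1).
    by apply: cvgM; [exact: cvg_cst|exact: cvg_normr_powR].
  rewrite normr0 powR0 ?gt_eqF// mulr0; apply: eq_cvg_nat => m /=.
  rewrite add0r subr0 normrM powRM//.
  have m0 : 0 < m.+1%:R^-1 :> R by [].
  rewrite (gtr0_norm m0) -(mulr_powRB1 (ltW m0) r0).
  move: (_ `^ (r - 1)) (`|h| `^ r) => u v.
  have : m.+1%:R != 0 :> R by rewrite pnatr_eq0.
  by move: (m.+1%:R : R) => k k0; field.
wlog xp : x h h0 x0 / 0 < x.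
  move=> hw; case: (ltrgtP x 0) x0 => // xn _; last by apply: hw; rewrite // gt_eqF.
  have nh : - h != 0 by rewrite oppr_eq0.
  have nx : - x != 0 by rewrite oppr_eq0 lt_eqF.
  have xp : 0 < - x by rewrite oppr_gt0.
  have := hw _ _ nh nx xp; rewrite normrN.
  rewrite -mulrA mulrNN (mulrA _ x h); apply: eq_cvg_nat => m.
  by rewrite mulrN -opprD normrN.
have D := @is_derive1_powR R r x xp.
have dq : (fun k : R => k^-1 *: (((fun y : R => y `^ r) \o shift x) (k *: (1 : R)) - x `^ r))
   @ 0^' --> r * x `^ (r - 1).
  rewrite -(@derive_val _ _ _ _ _ _ _ D).
  exact: (@ex_derive _ _ _ _ _ _ _ D).
have sh : (m.+1%:R^-1 * h) @[m --> \oo] --> 0^'.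
  move=> A; rewrite /dnbhs /within/= => hA.
  have : m.+1%:R^-1 * h @[m --> \oo] --> (0 : R).
    by rewrite -[X in _ --> X](mul0r h); apply: cvgM => //; exact: cvg_cst.
  move=> /(_ _ hA) hB; apply: (@filterS nat \oo _ _ _ _ hB) => m /=; apply.
  by apply: mulf_neq0; rewrite ?invr_eq0 ?pnatr_eq0.
have := cvg_comp _ _ sh dq; move=> dq'.
have : h * ((fun k : R => k^-1 *: (((fun y : R => y `^ r) \o shift x) (k *: (1 : R)) - x `^ r))
    (m.+1%:R^-1 * h)) @[m --> \oo] --> h * (r * x `^ (r - 1)).
  by apply: cvgM; [exact: cvg_cst|exact: dq'].
have -> : r * (`|x| `^ (r - 2) * x * h) = h * (r * x `^ (r - 1)).
  rewrite gtr0_norm//.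
  have -> : r - 1 = r - 2 + 1 by ring.
  rewrite (@powRD _ x (r - 2) 1); last by rewrite (gt_eqF xp) implybT.
  by rewrite powRr1 ?ltW//; ring.
apply: cvg_trans; apply: near_eq_cvg.
have xs : x + m.+1%:R^-1 * h @[m --> \oo] --> x.
  rewrite -[X in _ --> X]addr0; apply: cvgD; first exact: cvg_cst.
  by rewrite -[X in _ --> X](mul0r h); apply: cvgM => //; exact: cvg_cst.
have xs0 := cvgr_gt _ xs _ xp.
near=> m.
have xm : 0 < x + m.+1%:R^-1 * h by near: m; exact: xs0.
rewrite /= /GRing.scale/= mulr1 (gtr0_norm xm) (gtr0_norm xp) (addrC _ x).
by rewrite invfM invrK; field.
Unshelve. all: by end_near. Qed.

End real_ineq.

(** * Lebesgue measure on R^n *)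

Section rV.
Context {R : realType}.

Lemma rV_ballP n (x y : 'rV[R]_n) (e : R) : 0 < e ->
  ball x e y <-> forall i, `|x ord0 i - y ord0 i| < e.
Proof.
move=> e0; split => [[_ h] i|h]; first exact: h.
by split => // i j; rewrite ord1; exact: h.
Qed.

Lemma measurable_rV_box n (A : 'I_n -> set R) :
  (forall i, measurable (A i)) ->
  measurable [set x : 'rV[R]_n | forall i, A i (x ord0 i)].
Proof.
move=> mA; rewrite (_ : mkset _ =
    \bigcap_(i in [set: 'I_n]) ((fun x : 'rV[R]_n => x ord0 i) @^-1` A i)).
  apply: fin_bigcap_measurable => // i _.
  by rewrite -[X in measurable X]setTI; exact: measurable_rV_coord.
by apply/seteqP; split=> x /= H i => [_|]; exact: H.
Qed.

Lemma measurable_rV_ball n (x : 'rV[R]_n) (e : R) : 0 < e -> measurable (ball x e).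
Proof.
move=> e0.
rewrite (_ : ball x e = [set y | forall i, (ball (x ord0 i) e) (y ord0 i)]).
  apply: (@measurable_rV_box n (fun i => ball (x ord0 i) e)) => i.
  by rewrite ball_itv; exact: measurable_itv.
by apply/seteqP; split => y /(rV_ballP _ _ e0).
Qed.

(** The sigma-algebra is generated by the coordinates, so openness has to be
reduced to boxes: an open set is the union of the countably many rational balls of
radius 1 / (k + 1) that it contains, and balls of the sup norm are boxes. *)
Lemma open_measurable_rV n (U : set 'rV[R]_n) : open U -> measurable U.
Proof.
move=> oU.
pose c (q : 'rV[rat]_n) : 'rV[R]_n := \row_i ratr (q ord0 i).
pose V (qk : 'rV[rat]_n * nat) : set 'rV[R]_n :=
  if `[< ball (c qk.1) qk.2.+1%:R^-1 `<=` U >] then ball (c qk.1) qk.2.+1%:R^-1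
  else set0.
rewrite (_ : U = \bigcup_qk V qk).
  apply: countable_bigcupT_measurable => // qk; rewrite /V.
  by case: asboolP => _ //; apply: measurable_rV_ball.
apply/seteqP; split => [x Ux|x [qk _]]; last first.
  by rewrite /V; case: asboolP => // h /h.
have /nbhs_ballP[e /= e0 he] : nbhs x U by exact: open_nbhs_nbhs.
have /cvgrPdist_lt/(_ (e / 2)) := @cvg_harmonic R.
rewrite divr_gt0// => /(_ isT)[k _ /(_ k (leqnn k))].
rewrite /= sub0r normrN ger0_norm// => hk.
have k0 : 0 < k.+1%:R^-1 :> R by [].
have /choice[q hq] : forall i : 'I_n, exists q : rat, `|ratr q - x ord0 i| < k.+1%:R^-1.
  move=> i.
  have lt2 : x ord0 i - k.+1%:R^-1 < x ord0 i + k.+1%:R^-1.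
    by rewrite (@lt_trans _ _ (x ord0 i)) ?gtrBl ?ltrDl.
  have [q] := rat_in_itvoo lt2.
  by rewrite in_itv/= => h; exists q; rewrite ltr_distl.
exists (\row_i q i, k) => //; rewrite /V /=.
have hx : ball (c (\row_i q i)) k.+1%:R^-1 x.
  by apply/rV_ballP => // i; rewrite !mxE.
case: asboolP => // -[] y /(rV_ballP _ _ k0) hy; apply: he; apply/rV_ballP => // i.
rewrite (_ : _ - _ = x ord0 i - c (\row_i q i) ord0 i +
   (c (\row_i q i) ord0 i - y ord0 i)); last by ring.
move/(rV_ballP _ _ k0)/(_ i) : hx; rewrite distrC => hx.
rewrite (le_lt_trans (ler_normD _ _))// [ltRHS]splitr ltrD//.
  exact: lt_trans hx hk.
exact: lt_trans (hy i) hk.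
Qed.

Lemma measurable_refl n (c : 'rV[R]_n) :
  measurable_fun setT (fun x : 'rV[R]_n => c - x).
Proof.
apply/measurable_fun_rVP => i; under eq_fun do rewrite !mxE.
apply: measurable_funB; first exact: measurable_cst.
exact: measurable_rV_coord.
Qed.

Lemma measurable_fun_rV_sub n :
  measurable_fun setT (fun z : 'rV[R]_n * 'rV[R]_n => z.1 - z.2).
Proof.
apply/measurable_fun_rVP => i; under eq_fun do rewrite !mxE.
apply: measurable_funB.
- exact: (measurableT_comp (measurable_rV_coord i) measurable_fst).
- exact: (measurableT_comp (measurable_rV_coord i) measurable_snd).
Qed.

(** Reflections x |-> c - x are the right form of invariance here: for fixed x the
kernel is evaluated at the reflected point x - y, and two reflections make a
translation. On the line the invariance follows from the uniqueness of the measure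
that gives intervals their length. *)
Lemma lebesgue_real_refl (c : R) (A : set R) : measurable A ->
  lebesgue_real ((fun x : R => c - x) @^-1` A) = lebesgue_real A.
Proof.
move=> mA; have mr : measurable_fun setT (fun x : R => c - x : measurableTypeR R).
  by apply: measurable_funB; [exact: measurable_cst|exact: measurable_id].
suff : pushforward lebesgue_measure (fun x : R => c - x : measurableTypeR R) A =
  lebesgue_measure A by [].
apply/esym/lebesgue_measure_unique => //= _ [[a b]] _ <-.
rewrite /pushforward.
have -> : (fun x : R => c - x) @^-1` `]a, b] = `[c - b, c - a[%classic.
  by apply/seteqP; split => x /=; rewrite !in_itv/=; lra.
rewrite !lebesgue_measure_itv/= !lte_fin ltrD2l ltrN2.
by case: ifP => // _; congr (_%:E); ring.
Qed.

Lemma lebesgue_rV_refl n (c : 'rV[R]_n) (A : set 'rV[R]_n) : measurable A ->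
  lebesgue_rV n ((fun x => c - x) @^-1` A) = lebesgue_rV n A.
Proof.
elim: n c A => [|n IH] c A mA.
  by congr (lebesgue_rV 0 _); apply/seteqP; split => x /=; rewrite (thinmx0 c) (thinmx0 x) subr0.
rewrite /= /measure_rV_cons /pushforward.
have mcons B : measurable B -> measurable (@rV_cons R n @^-1` B).
  by move=> mB; rewrite -[X in measurable X]setTI; exact: measurable_rV_cons.
set m2 := lebesgue_rV n; pose c' := rV_behead c; pose c0 := rV_head c.
pose phi (x : R) := m2 (xsection (@rV_cons R n @^-1` A) x).
have mphi : measurable_fun setT phi.
  exact: measurable_fun_xsection (mcons _ mA).
transitivity (\int[lebesgue_real]_x phi (c0 - x)%R)%E.
  apply: eq_integral => x _ /=; rewrite /phi.
  rewrite -[RHS](IH c'); last by apply: measurable_xsection; exact: mcons _ mA.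
  congr (m2 _); apply/seteqP; split => v; rewrite /xsection/= !inE/=.
    by congr A; apply/rowP => i; rewrite !mxE; case: unliftP => [j|] -> /=; rewrite ?mxE.
  by congr A; apply/rowP => i; rewrite !mxE; case: unliftP => [j|] -> /=; rewrite ?mxE.
have mr : measurable_fun setT (fun x : R => c0 - x).
  by apply: measurable_funB; [exact: measurable_cst|exact: measurable_id].
transitivity (\int[pushforward lebesgue_real (fun x : R => (c0 - x)%R)]_x phi x)%E.
  rewrite ge0_integral_pushforward//.
apply: eq_measure_integral => B mB _.
exact: lebesgue_real_refl.
Qed.

Lemma integral_rV_refl n (c : 'rV[R]_n) (f : 'rV[R]_n -> \bar R) :
  measurable_fun setT f -> (forall x, 0 <= f x)%E ->
  (\int[lebesgue_rV n]_x f (c - x)%R = \int[lebesgue_rV n]_x f x)%E.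
Proof.
move=> mf f0.
transitivity (\int[pushforward (lebesgue_rV n) (fun x : 'rV[R]_n => (c - x)%R)]_x f x)%E.
  by rewrite ge0_integral_pushforward//; exact: measurable_refl.
apply: eq_measure_integral => [|mr B mB _]; first exact: measurable_refl.
exact: lebesgue_rV_refl.
Qed.

Lemma ae_prod_fst d1 d2 (T1 : measurableType d1) (T2 : measurableType d2)
  (m1 : {sigma_finite_measure set T1 -> \bar R})
  (m2 : {sigma_finite_measure set T2 -> \bar R}) (P : T1 -> Prop) :
  {ae m1, forall x, P x} -> {ae (m1 \x m2)%E, forall z, P z.1}.
Proof.
move=> [N [mN N0 sN]]; exists (N `*` setT); split.
- exact: measurableX.
- by rewrite product_measure1E//= N0 mul0e.
- by move=> z /= h; split => //; exact: sN.
Qed.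

Lemma ae_prod_snd d1 d2 (T1 : measurableType d1) (T2 : measurableType d2)
  (m1 : {sigma_finite_measure set T1 -> \bar R})
  (m2 : {sigma_finite_measure set T2 -> \bar R}) (P : T2 -> Prop) :
  {ae m2, forall x, P x} -> {ae (m1 \x m2)%E, forall z, P z.2}.
Proof.
move=> [N [mN N0 sN]]; exists (setT `*` N); split.
- exact: measurableX.
- by rewrite product_measure1E//= N0 mule0.
- by move=> z /= h; split => //; exact: sN.
Qed.

(** By Fubini: each section of the preimage of a null set under (x, y) |-> x - y is
a reflected copy of that null set. *)
Lemma ae_prod_sub n (P : 'rV[R]_n -> Prop) :
  {ae lebesgue_rV n, forall x, P x} ->
  {ae (lebesgue_rV n \x lebesgue_rV n)%E, forall z, P (z.1 - z.2)}.
Proof.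
move=> [N [mN N0 sN]].
have mS : measurable ((fun z : 'rV[R]_n * 'rV[R]_n => z.1 - z.2) @^-1` N).
  by rewrite -[X in measurable X]setTI; exact: measurable_fun_rV_sub.
exists ((fun z : 'rV[R]_n * 'rV[R]_n => z.1 - z.2) @^-1` N); split => //.
- rewrite /product_measure1; apply: integral0_eq => x _ /=.
  rewrite -[RHS]N0 -(lebesgue_rV_refl x mN); congr (lebesgue_rV n _).
  by apply/seteqP; split => y; rewrite /xsection/= inE.
- by move=> z /= h; exact: sN.
Qed.

Lemma bounded_rV_box n (D : set 'rV[R]_n) : bounded_set D ->
  exists2 M : R, 0 < M & forall x, D x -> forall i, - M <= x ord0 i < M.
Proof.
move=> /pinfty_ex_gt0[M M0 hM]; exists (M + 1); first by rewrite addr_gt0.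
move=> x Dx i; have hx : `|x| <= M by exact: hM.
have : `|x ord0 i| <= M.
  apply: le_trans hx; rewrite [leRHS](_ : _ = mx_norm x)// mx_normrE.
  exact: (le_bigmax _ (fun ij : 'I_1 * 'I_n => `|x ij.1 ij.2|) (ord0, i)).
by rewrite ler_norml => /andP[h1 h2]; apply/andP; split; lra.
Qed.

Lemma lebesgue_rV_itv n (D : set 'rV[R]_n) (a b : 'I_n -> R) : measurable D ->
  (forall x, D x -> forall i, a i <= x ord0 i < b i) ->
  (lebesgue_rV n D < +oo)%E.
Proof.
move=> mD hD.
have mA i : measurable (`[a i, b i[%classic : set R) by exact: measurable_itv.
apply: (@le_lt_trans _ _
    (\prod_(i < n) lebesgue_measure (`[a i, b i[%classic : set R))%E).
  rewrite -(lebesgue_rV_box mA); apply: le_measure.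
  - by rewrite inE.
  - by rewrite inE; exact: (measurable_rV_box mA).
  - by move=> x Dx i /=; rewrite in_itv/= hD.
have fin : (\prod_(i < n) lebesgue_measure (`[a i, b i[%classic : set R))%E
    \is a fin_num.
  by apply: prode_fin_num => i _; rewrite lebesgue_measure_itv/=; case: ifP.
by move: fin; rewrite fin_numElt => /andP[].
Qed.

End rV.

(** * Integrals up to null sets, and derivatives of power integrals *)

Section ae_integral.
Context d (T : measurableType d) (R : realType) (mu : {measure set T -> \bar R}).

Import HBNNSimple.

(** The integral is a supremum over measurable simple functions h below f, and each
h can be set to 0 on a null set outside which f = g without changing its integral.
This covers the integrands of the problem, whose functions and kernel agree with
Borel ones only almost everywhere. *)
Lemma ge0_ae_le_integral_any (f g : T -> \bar R) :
  (forall x, 0 <= f x)%E -> (forall x, 0 <= g x)%E ->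
  {ae mu, forall x, f x = g x} ->
  (\int[mu]_x f x <= \int[mu]_x g x)%E.
Proof.
move=> f0 g0 [N [mN N0 sN]]; rewrite [leLHS]ge0_integralTE// [leRHS]ge0_integralTE//.
apply: ge_ereal_sup => _ [h /= hf <-].
have mCN : measurable (~` N) by exact: measurableC.
have -> : sintegral mu h = sintegral mu (proj_nnsfun h mCN).
  rewrite -!integralT_nnsfun; apply: ge0_ae_eq_integral => //.
  - exact/measurable_EFinP.
  - exact/measurable_EFinP.
  - by move=> x _; rewrite lee_fin.
  - by move=> x _; rewrite lee_fin.
  exists N; split => // x /= /not_implyP[_ hx]; apply: contrapT => Nx.
  by apply: hx; rewrite /= mindicE mem_set ?mulr1.
apply: ereal_sup_ubound; exists (proj_nnsfun h mCN) => //= x.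
rewrite mindicE; have [Nx|Nx] := pselect (N x).
  by rewrite memNset ?mulr0//; apply.
rewrite mem_set// mulr1; have <- : f x = g x; last exact: hf.
by apply: contrapT => fg; apply: Nx; exact: sN.
Qed.

Lemma ae_eq_integral_any (D : set T) (f g : T -> \bar R) :
  {ae mu, forall x, D x -> f x = g x} ->
  (\int[mu]_(x in D) f x = \int[mu]_(x in D) g x)%E.
Proof.
move=> fg.
have ge0 (u v : T -> \bar R) : (forall x, 0 <= u x)%E -> (forall x, 0 <= v x)%E ->
    {ae mu, forall x, D x -> u x = v x} ->
    (\int[mu]_(x in D) u x = \int[mu]_(x in D) v x)%E.
  move=> u0 v0 uv; rewrite (integral_mkcond _ u) (integral_mkcond _ v).
  have u0' x : (0 <= (u \_ D) x)%E by rewrite erestrict_ge0.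
  have v0' x : (0 <= (v \_ D) x)%E by rewrite erestrict_ge0.
  apply/eqP; rewrite eq_le; apply/andP; split; apply: ge0_ae_le_integral_any => //.
    apply: filterS uv => x; rewrite /patch; case: ifPn => // xD; apply.
    exact: set_mem xD.
  apply: filterS uv => x; rewrite /patch; case: ifPn => // xD h; apply/esym/h.
  exact: set_mem xD.
rewrite integralE [RHS]integralE; congr (_ - _)%E; apply: ge0 => //.
  by apply: filterS fg => x h Dx; rewrite ?funeposE ?funenegE h.
by apply: filterS fg => x h Dx; rewrite ?funeposE ?funenegE h.
Qed.

Lemma ae_eq_Rintegral (D : set T) (f g : T -> R) :
  {ae mu, forall x, D x -> f x = g x} ->
  \int[mu]_(x in D) f x = \int[mu]_(x in D) g x.
Proof.
move=> fg; congr fine; apply: ae_eq_integral_any.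
by apply: filterS fg => x h /h ->.
Qed.
End ae_integral.

Section power_integral.
Context d (T : measurableType d) (R : realType) (mu : {measure set T -> \bar R}).
Variables (D : set T) (mD : measurable D).
Implicit Types (w f h : T -> R) (r s : R).

Lemma measurable_normr_powR r f : measurable_fun D f ->
  measurable_fun D (fun x => `|f x| `^ r).
Proof.
move=> mf; apply: (@measurableT_comp _ _ _ _ _ _ (fun x : R => x `^ r)).
  exact: measurable_powR.
exact: measurableT_comp.
Qed.

Lemma integrable_le w f : measurable_fun D f ->
  (forall x, D x -> `|f x| <= w x) -> mu.-integrable D (EFin \o w) ->
  mu.-integrable D (EFin \o f).
Proof.
move=> mf fw iw; apply: le_integrable iw => //; first exact/measurable_EFinP.
by move=> x Dx /=; rewrite lee_fin (le_trans (fw _ Dx))// ler_norm.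
Qed.

Lemma integrable_powRD w f h r s : 0 < r -> measurable_fun D w ->
  measurable_fun D f -> measurable_fun D h ->
  mu.-integrable D (EFin \o (fun x => w x * `|f x| `^ r)) ->
  mu.-integrable D (EFin \o (fun x => w x * `|h x| `^ r)) ->
  mu.-integrable D (EFin \o (fun x => w x * `|f x + s * h x| `^ r)).
Proof.
move=> r0 mw mf mh iF iH.
pose g x := 2 `^ r * `|w x * `|f x| `^ r| + 2 `^ r * `|s| `^ r * `|w x * `|h x| `^ r|.
apply: (@integrable_le g).
- apply: measurable_funM => //; apply: measurable_normr_powR.
  apply: measurable_funD => //; apply: measurable_funM => //; exact: measurable_funM.
- move=> x Dx; rewrite /g !normrM !(ger0_norm (powR_ge0 _ _)).
  rewrite [leRHS](_ : _ = `|w x| * (2 `^ r * (`|f x| `^ r + `|s * h x| `^ r))).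
    by rewrite ler_wpM2l// normrD_powR.
  by rewrite normrM powRM//; ring.
- rewrite (_ : EFin \o g = (fun x => (2 `^ r)%:E * `|(w x * `|f x| `^ r)%:E| +
     (2 `^ r * `|s| `^ r)%:E * `|(w x * `|h x| `^ r)%:E|)%E); last by apply/funext.
  apply: integrableD => //; apply: integrableZl => //; exact: integrable_abse.
Qed.

Lemma Rintegral_dominated (f_ : nat -> T -> R) f g :
  (forall m, measurable_fun D (f_ m)) -> measurable_fun D f ->
  {ae mu, forall x, D x -> f_ m x @[m --> \oo] --> f x} ->
  mu.-integrable D (EFin \o g) ->
  {ae mu, forall x, D x -> forall m, `|f_ m x| <= g x} ->
  mu.-integrable D (EFin \o f) /\
  \int[mu]_(x in D) f_ m x @[m --> \oo] --> \int[mu]_(x in D) f x.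
Proof.
move=> mf_ mf cf ig fg.
have [|||||i_f _] := @dominated_convergence _ _ _ mu D mD
  (fun m => EFin \o f_ m) (EFin \o f) (EFin \o g).
- by move=> m; exact/measurable_EFinP.
- exact/measurable_EFinP.
- apply: filterS cf => x cx Dx; apply: cvg_EFin; first exact: nearW.
  exact: cx.
- exact: ig.
- by apply: filterS fg => x fgx m Dx; rewrite /= lee_fin fgx.
move=> h; split => //.
have e : (\int[mu]_(x in D) (f x)%:E)%E = (\int[mu]_(x in D) f x)%:E.
  by rewrite fineK//; exact: integrable_fin_num.
by apply: fine_cvg; rewrite -e.
Qed.

(** Differentiation under the integral along the steps 1 / (m + 1): the difference
quotients converge pointwise and [quotient_bound] dominates them by
w |f + h|^r + w |f - h|^r. *)
Lemma power_integral_deriv w f h r : 1 < r -> measurable_fun D w ->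
  measurable_fun D f -> measurable_fun D h ->
  mu.-integrable D (EFin \o (fun x => w x * `|f x| `^ r)) ->
  mu.-integrable D (EFin \o (fun x => w x * `|h x| `^ r)) ->
  mu.-integrable D (EFin \o (fun x => w x * (`|f x| `^ (r - 2) * f x * h x))) /\
  ((\int[mu]_(x in D) (w x * `|f x + m.+1%:R^-1 * h x| `^ r) -
   \int[mu]_(x in D) (w x * `|f x| `^ r)) * m.+1%:R @[m --> \oo] -->
  r * \int[mu]_(x in D) (w x * (`|f x| `^ (r - 2) * f x * h x))).
Proof.
move=> r1 mw mf mh iF iH; have r0 : 0 < r by lra.
have iL s : mu.-integrable D (EFin \o (fun x => w x * `|f x + s * h x| `^ r)).
  exact: integrable_powRD.
pose q (m : nat) x := w x * ((`|f x + m.+1%:R^-1 * h x| `^ r - `|f x| `^ r) * m.+1%:R).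
pose l x := w x * (r * (`|f x| `^ (r - 2) * f x * h x)).
pose g x := `|w x * `|f x + 1 * h x| `^ r| + `|w x * `|f x + (-1) * h x| `^ r|.
have mq m : measurable_fun D (q m).
  apply: measurable_funM => //; apply: measurable_funM; last exact: measurable_cst.
  apply: measurable_funB; apply: measurable_normr_powR => //.
  apply: measurable_funD => //; apply: measurable_funM => //; exact: measurable_cst.
have ml : measurable_fun D l.
  apply: measurable_funM => //; apply: measurable_funM; first exact: measurable_cst.
  by do 2!apply: measurable_funM => //; exact: measurable_normr_powR.
have [|||i_l hcvg] := @Rintegral_dominated q l g mq ml.
- apply: aeW => x Dx.
  by apply: cvgM; [exact: cvg_cst|exact: quotient_cvg].
- exact: (integrableD mD (integrable_abse (iL 1)) (integrable_abse (iL (-1)))).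
- apply: aeW => x Dx m; rewrite /q /g.
  rewrite !normrM !(ger0_norm (powR_ge0 _ _)) -mulrDr ler_wpM2l//.
  have m0 : 0 < m.+1%:R :> R by [].
  have s01 : 0 < (m.+1%:R^-1 : R) <= 1 by rewrite invr_gt0 m0 invf_le1// ler1n.
  have hq := quotient_bound (f x) (h x) (ltW r1) s01.
  by rewrite (gtr0_norm m0) -ler_pdivlMr// mul1r mulN1r [leRHS]mulrC.
have il : mu.-integrable D (EFin \o (fun x => w x * (`|f x| `^ (r - 2) * f x * h x))).
  rewrite (_ : EFin \o _ = (fun x => (r^-1)%:E * (l x)%:E)%E).
    exact: integrableZl.
  apply/funext => x; rewrite /l /= -EFinM; congr (_%:E); field.
  by rewrite gt_eqF.
split => //.
have <- : \int[mu]_(x in D) l x =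
    r * \int[mu]_(x in D) (w x * (`|f x| `^ (r - 2) * f x * h x)).
  by rewrite -RintegralZl//; apply: eq_Rintegral => x _; rewrite /l mulrCA.
move: hcvg; apply: eq_cvg_nat => m; rewrite -RintegralB// -RintegralZr//; last first.
  exact: (integrableB mD (iL _) iF).
by apply: eq_Rintegral => x _; rewrite /q; ring.
Qed.

Lemma ge0_integrable f : measurable_fun D f -> (forall x, D x -> 0 <= f x) ->
  (\int[mu]_(x in D) (f x)%:E < +oo)%E -> mu.-integrable D (EFin \o f).
Proof.
move=> mf f0 foo; apply/integrableP; split; first exact/measurable_EFinP.
rewrite (eq_integral (EFin \o f))// => x /set_mem Dx /=.
by rewrite ger0_norm// f0.
Qed.

(** The dominated form of the Riesz-Fischer argument. The weights 2^m give an
integrable E = |v_0|^r + sum of |2^m (v_(m+1) - v_m)|^r; where E is finite, with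
h = E^(1/r), the increments are at most h 2^-m, so v converges and stays below
3 h. *)
Lemma fast_cauchy (v : nat -> T -> R) r : 0 < r ->
  (forall m, measurable_fun D (v m)) ->
  mu.-integrable D (EFin \o (fun x => `|v 0 x| `^ r)) ->
  (forall m, \int[mu]_(x in D) (`|2 ^+ m * (v m.+1 x - v m x)| `^ r)%:E <=
     (1 / (2 ^ (m + 1))%:R)%:E)%E ->
  exists2 H : T -> R, mu.-integrable D (EFin \o H) &
    {ae mu, forall x, D x -> cvgn (v ^~ x) /\ forall m, `|v m x| `^ r <= H x}.
Proof.
move=> r0 mv i0 hv.
pose g m x := (`|2 ^+ m * (v m.+1 x - v m x)| `^ r)%:E.
have mg m : measurable_fun D (g m).
  apply/measurable_EFinP/measurable_normr_powR/measurable_funM.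
    exact: measurable_cst.
  exact: measurable_funB.
have g0 m x : (0 <= g m x)%E by rewrite lee_fin powR_ge0.
pose G x := (\sum_(0 <= m <oo) g m x)%E.
have G0 x : (0 <= G x)%E by apply: nneseries_ge0.
have mG : measurable_fun D G by apply: ge0_emeasurable_sum.
pose E x := ((`|v 0 x| `^ r)%:E + G x)%E.
have E0 x : (0 <= E x)%E by rewrite adde_ge0 ?lee_fin ?powR_ge0.
have mE : measurable_fun D E.
  apply: emeasurable_funD => //.
  by apply/measurable_EFinP/measurable_normr_powR.
have iG : mu.-integrable D G.
  apply/integrableP; split => //.
  under eq_integral do rewrite gee0_abs//.
  rewrite integral_nneseries//; apply: (@le_lt_trans _ _
    (\sum_(0 <= m <oo) (1 / (2 ^ (m + 1))%:R)%:E)%E).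
    by apply: lee_nneseries => m *; [exact: integral_ge0|exact: hv].
  by have /cvg_lim := @cvg_geometric_eseries_half R 1 0; move=> -> //; rewrite ltry.
have iE : mu.-integrable D E by apply: integrableD.
exists (fun x => 3 `^ r * fine (E x)).
  rewrite (_ : EFin \o _ = (fun x => (3 `^ r)%:E * (fine (E x))%:E)%E)//.
  apply: integrableZl => //; apply: le_integrable iE => //.
    by apply/measurable_EFinP; apply: measurableT_comp.
  move=> x Dx /=; rewrite (ger0_norm (fine_ge0 (E0 x))) gee0_abs//.
  by case: (E x) (E0 x) => //= *; rewrite leey.
have := integrable_ae mD iE; apply: filterS => x Efin Dx.
have {}Efin := Efin Dx; set h := fine (E x) `^ r^-1.
have h0 : 0 <= h by exact: powR_ge0.
have root (a : R) : 0 <= a -> ((a `^ r)%:E <= E x)%E -> a <= h.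
  move=> a0; rewrite -(fineK Efin) lee_fin => ha.
  have -> : a = (a `^ r) `^ r^-1 by rewrite -powRrM mulfV ?gt_eqF// powRr1.
  apply: ge0_ler_powR; rewrite ?nnegrE ?powR_ge0//; last exact: fine_ge0.
  by rewrite invr_ge0 ltW.
have v0 : `|v 0 x| <= h by apply: root => //; rewrite /E leeDl.
have dv m : `|v m.+1 x - v m x| <= h * 2^-1 ^+ m.
  have : `|2 ^+ m * (v m.+1 x - v m x)| <= h.
    apply: root => //; apply: (@le_trans _ _ (G x)); last first.
      by rewrite /E leeDr// lee_fin powR_ge0.
    have := @nneseries_lim_ge _ (fun m => g m x) xpredT 0 m.+1 (fun _ _ _ => g0 _ x).
    by apply: le_trans; rewrite big_nat_recr//= leeDr// sume_ge0.
  by rewrite normrM ger0_norm// exprVn ler_pdivlMr// mulrC.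
split.
  have -> : v^~ x = (fun m => v 0 x + series (telescope (v^~ x)) m).
    by apply/funext => m; exact: (eq_sum_telescope (v^~ x) m).
  apply: is_cvgD; first exact: is_cvg_cst.
  apply: normed_cvg; apply: (@series_le_cvg _ _ (geometric h 2^-1)) => //=.
  - by move=> m; rewrite mulr_ge0.
  - by apply: is_cvg_geometric_series; rewrite ger0_norm// invf_lt1// ltr1n.
move=> m.
suff : `|v m x| <= 3 * h.
  move=> hm; apply: (@le_trans _ _ ((3 * h) `^ r)).
    by apply: ge0_ler_powR; rewrite ?nnegrE ?mulr_ge0// ltW.
  rewrite powRM// -[X in _ * X]powRrM mulVf ?gt_eqF// powRr1//.
  exact: fine_ge0.
(* 3 h - 2 h 2^-m starts at h and grows by h 2^-m, as the increments do *)
suff : `|v m x| <= 3 * h - 2 * h * 2^-1 ^+ m.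
  by move/le_trans; apply; rewrite gerBl !mulr_ge0.
elim: m => [|m IH]; first by rewrite expr0 mulr1; lra.
have -> : v m.+1 x = v m x + (v m.+1 x - v m x) by ring.
rewrite (le_trans (ler_normD _ _))//; have := dv m; rewrite exprS.
have -> : 2 * h * (2^-1 * 2^-1 ^+ m) = h * 2^-1 ^+ m by field.
by move: IH; rewrite -!mulrA; move: (h * 2^-1 ^+ m) => c; lra.
Qed.

(** The upper limit serves as a measurable pointwise limit defined everywhere. *)
Lemma measurable_lim (v : nat -> T -> R) : (forall m, measurable_fun D (v m)) ->
  exists2 w : T -> R, measurable_fun D w &
    forall x, D x -> cvgn (v ^~ x) -> v m x @[m --> \oo] --> w x.
Proof.
move=> mv; exists (fun x => fine (limn_esup (fun m => (v m x)%:E))).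
  apply: measurableT_comp => //; apply: measurable_fun_limn_esup => m.
  exact/measurable_EFinP.
move=> x Dx cv.
have h : (v m x)%:E @[m --> \oo] --> (limn (v^~ x))%:E.
  by apply: cvg_EFin; [exact: nearW|exact: cv].
have [_ ->] := cvg_limn_einf_sup h.
exact: cv.
Qed.

End power_integral.

(** * The functionals of the problem on Borel functions *)

Section pint.
Context d (T : measurableType d) (R : realType) (mu : {measure set T -> \bar R}).
Variables (D : set T) (w : T -> R) (r : R).

Definition pintegrable (f : T -> R) :=
  mu.-integrable D (EFin \o (fun x => w x * `|f x| `^ r)).
Definition pint (f : T -> R) : R := \int[mu]_(x in D) (w x * `|f x| `^ r).
Definition dpint (f h : T -> R) : R :=
  \int[mu]_(x in D) (w x * (`|f x| `^ (r - 2) * f x * h x)).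

Hypothesis mD : measurable D.

Lemma pint_scale t f : 0 <= t -> pintegrable f -> pint (scalef t f) = t `^ r * pint f.
Proof.
move=> t0 iF; rewrite /pint -RintegralZl//; apply: eq_Rintegral => x _.
by rewrite /scalef normrM (ger0_norm t0) powRM//; ring.
Qed.

Lemma pintegrable_scale t f : pintegrable f -> pintegrable (scalef t f).
Proof.
move=> iF; rewrite /pintegrable (_ : EFin \o _ =
  (fun x => (`|t| `^ r)%:E * (w x * `|f x| `^ r)%:E)%E); last first.
  by apply/funext => x; rewrite /scalef /= -EFinM normrM powRM//; congr _%:E; ring.
exact: integrableZl.
Qed.

Lemma dpint_opp f h :
  mu.-integrable D (EFin \o (fun x => w x * (`|f x| `^ (r - 2) * f x * h x))) ->
  dpint f (scalef (-1) h) = - dpint f h.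
Proof.
move=> ih; rewrite /dpint -[RHS]mulN1r -RintegralZl//; apply: eq_Rintegral => x _.
by rewrite /scalef; ring.
Qed.
End pint.

Section setting.
Context {R : realType} (n : nat).
Variables (Omega : set 'rV[R]_n) (K b : 'rV[R]_n -> R) (p beta : R).
Local Notation mu := (lebesgue_rV n).
Local Notation mu2 := ((lebesgue_rV n : {measure set 'rV[R]_n -> \bar R})
  \x lebesgue_rV n)%E.
Local Notation Q := (Qset Omega).
Implicit Types u v : 'rV[R]_n -> R.

Definition diffK (z : 'rV[R]_n * 'rV[R]_n) : R := K (z.1 - z.2).
Definition pdiff u (z : 'rV[R]_n * 'rV[R]_n) : R := u z.1 - u z.2.

(** The Borel functions that vanish everywhere outside Omega and have finite norm.
Every element of the solution space equals one of them almost everywhere, and for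
a Borel kernel all integrands below are measurable. *)
Definition Vb : set ('rV[R]_n -> R) := [set u : 'rV[R]_n -> R |
  [/\ measurable_fun setT u, forall x, ~ Omega x -> u x = 0,
      pintegrable mu Omega (cst 1) p u & pintegrable mu2 Q diffK p (pdiff u)]].

Definition Nb u := pint mu2 Q diffK p (pdiff u).
Definition Sb u := pint mu Omega (cst 1) p u.
Definition Bb u := pint mu Omega b beta u.

Hypotheses (p2 : 2 <= p) (hbeta : 1 < beta < p).
Hypotheses (mO : measurable Omega) (fO : (mu Omega < +oo)%E).
Hypotheses (mK : measurable_fun setT K) (K0 : forall x, 0 < K x).
Hypotheses (mb : measurable_fun Omega b).
Variable M : R.
Hypothesis bM : forall x, Omega x -> `|b x| <= M.

Let p0 : 0 < p. Proof. exact: lt_le_trans p2. Qed.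
Let p1 : 1 < p. Proof. by apply: lt_le_trans p2; rewrite ltr1n. Qed.

Lemma measurable_Qset : measurable Q.
Proof. by apply: measurableC; apply: measurableX; exact: measurableC. Qed.
Let mQ := measurable_Qset.

Lemma measurable_diff u : measurable_fun setT u -> measurable_fun Q (pdiff u).
Proof.
move=> mu_; apply: measurable_funTS; apply: measurable_funB.
- exact: (measurableT_comp mu_ measurable_fst).
- exact: (measurableT_comp mu_ measurable_snd).
Qed.

Lemma measurable_diffK : measurable_fun Q diffK.
Proof.
by apply: measurable_funTS; exact: (measurableT_comp mK (measurable_fun_rV_sub (n := n))).
Qed.

Lemma diff_line u s v : pdiff (linef u s v) = (fun z => pdiff u z + s * pdiff v z).
Proof. by apply/funext => z; rewrite /pdiff /linef; ring. Qed.

Lemma diff_scale t u : pdiff (scalef t u) = scalef t (pdiff u).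
Proof. by apply/funext => z; rewrite /pdiff /scalef; ring. Qed.

Lemma Vb_scale t u : Vb u -> Vb (scalef t u).
Proof.
move=> [mu_ u0 iS iN]; split.
- by exact: measurable_funM.
- by move=> x Ox; rewrite /scalef u0// mulr0.
- exact: pintegrable_scale.
- by rewrite diff_scale; exact: pintegrable_scale.
Qed.

Lemma Vb_line u s v : Vb u -> Vb v -> Vb (linef u s v).
Proof.
move=> [mu_ u0 iSu iNu] [mv v0 iSv iNv]; split.
- apply: measurable_funD => //; exact: measurable_funM.
- by move=> x Ox; rewrite /linef u0// v0// mulr0 addr0.
- exact: (integrable_powRD mO s p0 (measurable_cst _) (measurable_funTS mu_)
    (measurable_funTS mv) iSu iSv).
- rewrite diff_line; exact: (integrable_powRD mQ s p0 measurable_diffK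
    (measurable_diff mu_) (measurable_diff mv) iNu iNv).
Qed.

Lemma diff_abs u z : `|pdiff (absf u) z| <= `|pdiff u z|.
Proof. exact: ler_dist_dist. Qed.

Lemma diff_abs_powR u z : diffK z * `|pdiff (absf u) z| `^ p <= diffK z * `|pdiff u z| `^ p.
Proof.
rewrite ler_wpM2l ?(ltW (K0 _))//.
apply: ge0_ler_powR; rewrite ?nnegrE//; [exact: ltW|exact: diff_abs].
Qed.

Lemma Vb_abs u : Vb u -> Vb (absf u).
Proof.
move=> [mu_ u0 iSu iNu]; have ma : measurable_fun setT (absf u).
  exact: measurableT_comp.
split => //.
- by move=> x Ox; rewrite /absf u0// normr0.
- rewrite /pintegrable (_ : (fun x => _) = (fun x => cst 1 x * `|u x| `^ p))//.
  by apply/funext => x; rewrite /absf normr_id.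
- apply: (integrable_le mQ) iNu => [|z Qz].
    apply: measurable_funM; first exact: measurable_diffK.
    by apply: measurable_normr_powR => //; exact: measurable_diff.
  by rewrite ger0_norm ?diff_abs_powR// mulr_ge0 ?powR_ge0// ltW// K0.
Qed.

Lemma Nb_ge0 u : 0 <= Nb u.
Proof. by apply: Rintegral_ge0 => z _; rewrite mulr_ge0 ?powR_ge0// ltW// K0. Qed.

Lemma Sb_ge0 u : 0 <= Sb u.
Proof. by apply: Rintegral_ge0 => z _; rewrite mulr_ge0 ?powR_ge0. Qed.

Lemma Nb_abs u : Vb u -> Nb (absf u) <= Nb u.
Proof.
move=> Vu; have [_ _ _ ia] := Vb_abs Vu; have [_ _ _ iu] := Vu.
by apply: le_Rintegral => // z _; exact: diff_abs_powR.
Qed.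

Lemma Sb_abs u : Sb (absf u) = Sb u.
Proof. by apply: eq_Rintegral => x _; rewrite /absf normr_id. Qed.

Lemma Bb_abs u : Bb (absf u) = Bb u.
Proof. by apply: eq_Rintegral => x _; rewrite /absf normr_id. Qed.

(** Since beta < p; this bounds B by the measure of Omega and S. *)
Lemma weight_bound (x : R) c : 0 <= c -> 
  c * `|x| `^ beta <= c + c * `|x| `^ p.
Proof.
move=> c0; rewrite -{2}(mulr1 c) -mulrDr ler_wpM2l//.
have /andP[b1 bp] := hbeta.
have [x1|/ltW x1] := leP `|x| 1.
  apply: (@le_trans _ _ 1); last by rewrite lerDl powR_ge0.
  have e1 : 1 `^ beta = 1 :> R by rewrite powR1.
  rewrite -[leRHS]e1.
  by apply: ge0_ler_powR; rewrite ?nnegrE//; lra.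
apply: (@le_trans _ _ (`|x| `^ p)); last by rewrite lerDr.
by apply: ler_powR => //; exact: ltW.
Qed.

Let M0 : 0 <= `|M|. Proof. exact: normr_ge0. Qed.

Lemma integrable_cst_fin (c : R) : mu.-integrable Omega (EFin \o (fun=> c)).
Proof.
apply/integrableP; split; first exact/measurable_EFinP.
rewrite (_ : (fun x => _) = cst (`|c|%:E))// integral_cst// lte_mul_pinfty//.
Qed.

Lemma weight_integrable u : Vb u ->
  mu.-integrable Omega (EFin \o (fun x => `|M| + `|M| * `|u x| `^ p)).
Proof.
move=> [_ _ iS _].
rewrite (_ : EFin \o _ =
  (fun x => (`|M|)%:E + (`|M|)%:E * (cst 1 x * `|u x| `^ p)%:E)%E); last first.
  by apply/funext => x /=; rewrite mul1r.
apply: integrableD => //; last exact: integrableZl.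
exact: integrable_cst_fin.
Qed.

Lemma weight_integrand u x : Omega x ->
  `|b x * `|u x| `^ beta| <= `|M| + `|M| * `|u x| `^ p.
Proof.
move=> Ox; apply: le_trans (weight_bound (u x) M0).
rewrite normrM (ger0_norm (powR_ge0 _ _)) ler_wpM2r ?powR_ge0//.
by rewrite (le_trans (bM Ox))// ler_norm.
Qed.

Lemma Bb_integrable u : Vb u -> pintegrable mu Omega b beta u.
Proof.
move=> Vu; have [mu_ _ _ _] := Vu.
apply: (integrable_le mO) (weight_integrable Vu).
  apply: measurable_funM => //; apply: measurable_normr_powR => //.
  exact: measurable_funTS.
by move=> x Ox; exact: weight_integrand.
Qed.

Lemma Bb_bound : exists C, forall u, Vb u -> `|Bb u| <= C * (1 + Sb u).
Proof.
exists (`|M| * fine (mu Omega) + `|M|) => u Vu.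
have [_ _ iS _] := Vu.
apply: (le_trans (le_normr_Rintegral mO (Bb_integrable Vu))).
apply: (@le_trans _ _ (`|M| * fine (mu Omega) + `|M| * Sb u)); last first.
  rewrite mulrDr mulr1 mulrDl -addrA lerD2l.
  rewrite -[leLHS]add0r lerD// lerDr ?mulr_ge0 ?Sb_ge0 ?fine_ge0//.
have := weight_integrable Vu => iw.
have <- : \int[mu]_(x in Omega) (`|M| + `|M| * `|u x| `^ p) =
    `|M| * fine (mu Omega) + `|M| * Sb u.
  rewrite RintegralD//.
  - rewrite Rintegral_cst//; congr (_ + _); rewrite /Sb /pint -RintegralZl//.
    by apply: eq_Rintegral => x _; rewrite mul1r.
  - exact: integrable_cst_fin.
  - rewrite (_ : EFin \o _ =
      (fun x => (`|M|)%:E * (cst 1 x * `|u x| `^ p)%:E)%E).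
      exact: integrableZl.
    by apply/funext => x /=; rewrite mul1r.
apply: le_Rintegral => //; last by move=> x Ox; exact: weight_integrand.
have := integrable_abse (Bb_integrable Vu).
by apply: eq_integrable.
Qed.

Lemma Nb_scale t u : 0 <= t -> Vb u -> Nb (scalef t u) = t `^ p * Nb u.
Proof. by move=> t0 [_ _ _ iN]; rewrite /Nb diff_scale pint_scale. Qed.

Lemma Sb_scale t u : 0 <= t -> Vb u -> Sb (scalef t u) = t `^ p * Sb u.
Proof. by move=> t0 [_ _ iS _]; rewrite /Sb pint_scale. Qed.

Lemma Bb_scale t u : 0 <= t -> Vb u -> Bb (scalef t u) = t `^ beta * Bb u.
Proof. by move=> t0 Vu; rewrite /Bb pint_scale//; exact: Bb_integrable. Qed.

Definition Eb u v := dpint mu2 Q diffK p (pdiff u) (pdiff v).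
Definition Pb u v := dpint mu Omega (cst 1) p u v.
Definition Qb u v := dpint mu Omega b beta u v.

Lemma Nb_deriv u v : Vb u -> Vb v ->
  mu2.-integrable Q (EFin \o (fun z => diffK z *
     (`|pdiff u z| `^ (p - 2) * pdiff u z * pdiff v z))) /\
  ((Nb (linef u m.+1%:R^-1 v) - Nb u) * m.+1%:R @[m --> \oo] --> p * Eb u v).
Proof.
move=> [mu_ _ _ iu] [mv _ _ iv].
have [ie h] := power_integral_deriv mQ p1 measurable_diffK (measurable_diff mu_)
  (measurable_diff mv) iu iv.
split; first exact: ie.
by apply: eq_cvg_nat h => m; rewrite /Nb diff_line.
Qed.

Lemma Sb_deriv u v : Vb u -> Vb v ->
  mu.-integrable Omega (EFin \o (fun x => cst 1 x *
     (`|u x| `^ (p - 2) * u x * v x))) /\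
  ((Sb (linef u m.+1%:R^-1 v) - Sb u) * m.+1%:R @[m --> \oo] --> p * Pb u v).
Proof.
move=> [mu_ _ iu _] [mv _ iv _].
exact: (power_integral_deriv mO p1 (measurable_cst _) (measurable_funTS mu_)
  (measurable_funTS mv) iu iv).
Qed.

Lemma Bb_deriv u v : Vb u -> Vb v ->
  mu.-integrable Omega (EFin \o (fun x => b x *
     (`|u x| `^ (beta - 2) * u x * v x))) /\
  ((Bb (linef u m.+1%:R^-1 v) - Bb u) * m.+1%:R @[m --> \oo] --> beta * Qb u v).
Proof.
move=> Vu Vv; have [mu_ _ _ _] := Vu; have [mv _ _ _] := Vv.
have b1 : 1 < beta by case/andP: hbeta.
exact: (power_integral_deriv mO b1 mb (measurable_funTS mu_)
  (measurable_funTS mv) (Bb_integrable Vu) (Bb_integrable Vv)).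
Qed.

End setting.

(** * Compactness *)

(** Along an ultrafilter no subsequence has to be extracted: finitely many bounded
sequences of constants converge simultaneously. *)
Lemma ultra_bounded_cvg (R : realType) (G : set_system nat) (f : nat -> R) (A : R) :
  UltraFilter G -> (forall k, `|f k| <= A) -> exists l : R, f @ G --> l.
Proof.
move=> UG fA; have cA : compact `[- A, A]%classic by exact: segment_compact.
have [|l [_ hl]] := cA (f @ G) _.
  apply: (@filterS _ G _ setT) => [k _|]; last exact: filterT.
  by rewrite /= in_itv/= -ler_norml.
exists l => B hB; have [//|hnB] := in_ultra_setVsetC (f @^-1` B) UG.
have [x [nBx Bx]] := hl (~` B) B hnB hB.
by case: nBx.
Qed.

(** Applied to g y = int |u x - u y|^p dx over a cell, this selects a value of u that
can stand in for its average over the cell. *)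
Lemma good_point d (T : measurableType d) (R : realType)
    (mu : {measure set T -> \bar R}) (D : set T) (g : T -> \bar R) (c e : R) :
  measurable D -> mu D = c%:E -> 0 < c -> 0 < e -> (forall x, 0 <= g x)%E ->
  measurable_fun D g ->
  exists2 y, D y & (g y * c%:E <= \int[mu]_(x in D) g x + e%:E)%E.
Proof.
move=> mD muD c0 e0 g0 mg.
have [y0 Dy0] : D !=set0.
  apply/set0P/eqP => D0; move: muD; rewrite D0 measure0 => -[] /eqP.
  by rewrite eq_sym gt_eqF.
have I0 : (0 <= \int[mu]_(x in D) g x)%E by exact: integral_ge0.
case EI : (\int[mu]_(x in D) g x)%E I0 => [I| |]//; last first.
  by move=> _; exists y0 => //; rewrite addye// leey.
rewrite lee_fin => I0; apply: contrapT => ng.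
have lb y : D y -> (((I + e) / c)%:E <= g y)%E.
  move=> Dy; apply: contrapT => /negP; rewrite -ltNge => gy; apply: ng; exists y => //.
  apply: (@le_trans _ _ (((I + e) / c)%:E * c%:E)%E).
    by rewrite lee_pmul2r// ltW.
  by rewrite -EFinM divfK ?gt_eqF.
have : (\int[mu]_(x in D) (cst ((I + e) / c)%:E) x <= \int[mu]_(x in D) g x)%E.
  apply: ge0_le_integral => //.
  move=> x _; rewrite lee_fin; apply: divr_ge0; last exact: ltW.
  by apply: addr_ge0 => //; exact: ltW.
rewrite integral_cst// muD -EFinM divfK ?gt_eqF// EI lee_fin.
by rewrite gerDl leNgt e0.
Qed.

Section compactness.
Context {R : realType} (n : nat).
Variables (Omega : set 'rV[R]_n) (K : 'rV[R]_n -> R) (p : R).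
Local Notation mu := (lebesgue_rV n).
Local Notation mu2 := ((lebesgue_rV n : {measure set 'rV[R]_n -> \bar R})
  \x lebesgue_rV n)%E.
Local Notation Q := (Qset Omega).
Implicit Types u v : 'rV[R]_n -> R.
Hypotheses (p2 : 2 <= p).
Hypotheses (mO : measurable Omega).
Hypotheses (mK : measurable_fun setT K) (K0 : forall x, 0 < K x).
Let p0 : 0 < p. Proof. exact: lt_le_trans p2. Qed.
Let mQ := measurable_Qset mO.

(** The last condition expresses that the cells are small: it bounds the sum over i
of the integrals of |u x - u y|^p over D_i x D_i by e c N u. *)
Definition cells (e : R) (I : finType) (D : I -> set 'rV[R]_n) (c : R) : Prop :=
  [/\ 0 < c, forall i, measurable (D i) /\ mu (D i) = c%:E, trivIset setT D,
      Omega `<=` \bigcup_i D i &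
      forall i x y, D i x -> D i y -> x <> y -> 1 <= e * c * K (x - y)].

Definition epow (D : set 'rV[R]_n) u : \bar R := (\int[mu]_(x in D) (`|u x| `^ p)%:E)%E.

(** A function of finite norm is close in L^p to a function that is constant on the
cells. The sum over i of c^-1 times the integral of |u x - u y|^p over
D_i x D_i is at most e N u, and by [good_point] a suitable y_i in D_i gives the
constant a_i = u y_i. *)
Lemma cell_constants (e : R) (I : finType) (D : I -> set 'rV[R]_n) (c : R) u :
  0 < e -> cells e D c -> Vb Omega K p u ->
  exists a : I -> R,
    (\sum_(i : I) epow (D i) (fun x => (u x - a i)%R) <=
      (e * (Nb Omega K p u + 1))%:E)%E.
Proof.
move=> e0 [c0 mD tD OD hD] [mu_ u0 iS iN].
have [I0|/card_gt0P[i0 _]] := posnP #|I|.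
  exists (fun=> 0); rewrite big_pred0 ?lee_fin ?mulr_ge0 ?addr_ge0 ?Nb_ge0 ?ltW//.
  by move=> i; have := max_card (pred1 i); rewrite card1 I0.
have I1 : 0 < #|I|%:R :> R by rewrite ltr0n; apply/card_gt0P; exists i0.
pose f z := (`|pdiff u z| `^ p)%:E.
have mf : measurable_fun setT f.
  apply/measurable_EFinP; apply: measurable_normr_powR => //.
  apply: measurable_funB.
  - exact: (measurableT_comp mu_ measurable_fst).
  - exact: (measurableT_comp mu_ measurable_snd).
have f0 z : (0 <= f z)%E by rewrite lee_fin powR_ge0.
pose DD i := D i `*` D i.
have mDD i : measurable (DD i) by apply: measurableX; case: (mD i).
pose F i := f \_ (DD i).
have mF i : measurable_fun setT (F i).
  by apply/(measurable_restrictT _ _).1 => //; exact: measurable_funTS.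
have F0 i z : (0 <= F i z)%E by exact: erestrict_ge0.
pose G i y := (\int[mu]_x F i (x, y))%E.
have mG i : measurable_fun setT (G i).
  exact: (measurable_fun_fubini_tonelli_G (m1 := mu) (F i) (mF i) (F0 i)).
have G0 i y : (0 <= G i y)%E by exact: integral_ge0.
have FG i : (\int[mu2]_z F i z = \int[mu]_y G i y)%E.
  exact: (fubini_tonelli2 (m1 := mu) (m2 := mu) (F i) (mF i) (F0 i)).
pose d := e * c / #|I|%:R.
have d0 : 0 < d by rewrite !mulr_gt0// invr_gt0.
have /choice[y hy] : forall i, exists y, D i y /\
    (G i y * c%:E <= \int[mu2]_z F i z + d%:E)%E.
  move=> i; have [mDi muDi] := mD i.
  have [y Dy hy] := good_point mDi muDi c0 d0 (G0 i) (measurable_funTS (mG i)).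
  exists y; split => //; apply: (le_trans hy); rewrite FG leeD2r//.
  by apply: ge0_subset_integral.
exists (fun i => u (y i)).
have GE i : epow (D i) (fun x => (u x - u (y i))%R) = G i (y i).
  rewrite /G /epow [LHS]integral_mkcond; apply: eq_integral => x _.
  rewrite /F /f /patch /pdiff /=; have [Dy _] := hy i.
  case: ifPn => [/set_mem Dx|Dx]; first by rewrite mem_set.
  by rewrite memNset// => -[/= Dx' _]; move: Dx; rewrite mem_set.
under eq_bigr do rewrite GE.
suff : ((\sum_(i : I) G i (y i)) * c%:E <= (e * (Nb Omega K p u + 1) * c)%:E)%E.
  by rewrite EFinM lee_pmul2r.
rewrite ge0_sume_distrl//.
apply: (@le_trans _ _ (\sum_(i : I) (\int[mu2]_z F i z + d%:E))%E).
  by apply: lee_sum => i _; case: (hy i).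
rewrite big_split/= sumEFin sumr_const -mulr_natr.
have -> : e * (Nb Omega K p u + 1) * c = e * c * Nb Omega K p u + d * #|I|%:R.
  by rewrite /d; field; rewrite gt_eqF.
rewrite EFinD leeD2r//.
pose W := \big[setU/set0]_(i <- enum I) DD i.
have WE : (\sum_(i : I) \int[mu2]_z F i z = \int[mu2]_(z in W) f z)%E.
  rewrite ge0_integral_bigsetU//.
  - by rewrite big_enum/=; apply: eq_bigr => i _; rewrite [RHS]integral_mkcond.
  - exact: enum_uniq.
  - apply/trivIsetP => i j _ _ ij; apply/seteqP; split => // -[x1 x2].
    move=> -[[/= h1 _] [/= h2 _]]; have := (trivIsetP.1 tD) i j Logic.I Logic.I ij.
    by move=> /seteqP[/(_ x1 (conj h1 h2))].
  - by apply: measurable_funTS.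
rewrite WE.
have mW : measurable W by apply: bigsetU_measurable.
pose g z := ((e * c)%:E * (diffK K z * `|pdiff u z| `^ p)%:E)%E.
have g0 z : (0 <= g z)%E.
  by rewrite mule_ge0// lee_fin mulr_ge0 ?powR_ge0 ?ltW// ?K0//; exact: mulr_gt0.
have mg : measurable_fun setT g.
  apply: measurable_funeM; apply/measurable_EFinP; apply: measurable_funM.
    exact: (measurableT_comp mK (measurable_fun_rV_sub (n := n))).
  exact/measurable_EFinP.
apply: (@le_trans _ _ (\int[mu2]_(z in W) g z)%E).
  apply: ge0_le_integral => //; try exact: measurable_funTS.
  move=> z; rewrite /W -bigcup_seq => -[i _ [/= D1 D2]]; rewrite /g /f -EFinM lee_fin.
  (* the kernel bound excludes the diagonal, where the integrand is 0 *)
  have [e1|e1] := eqVneq z.1 z.2.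
    by rewrite /pdiff e1 subrr normr0 powR0 ?gt_eqF// !mulr0.
  rewrite mulrA ler_peMl ?powR_ge0//; apply: (hD i) => //; exact/eqP.
apply: (@le_trans _ _ (\int[mu2]_z g z)%E); first exact: ge0_subset_integral.
(* outside Q both values of u are 0 *)
have -> : (\int[mu2]_z g z = \int[mu2]_(z in Q) g z)%E.
  rewrite [RHS]integral_mkcond; apply: eq_integral => z _; rewrite /patch.
  case: ifPn => // zQ; rewrite /g /pdiff.
  have [n1 n2] : ~ Omega z.1 /\ ~ Omega z.2.
    by apply: contrapT => h; move/negP: zQ; apply; rewrite inE.
  by rewrite !u0// subrr normr0 powR0 ?gt_eqF// mulr0 mule0.
rewrite ge0_integralZl_EFin//; last 3 first.
- by move=> z _; rewrite lee_fin mulr_ge0 ?powR_ge0// ltW// K0.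
- by case/integrableP: iN.
- by rewrite mulr_ge0// ltW.
rewrite [leRHS]EFinM lee_pmul2l//; last by rewrite lte_fin mulr_gt0.
by rewrite /Nb /pint /Rintegral fineK//; exact: integrable_fin_num.
Qed.

Hypothesis hcells : forall e, 0 < e ->
  exists (I : finType) (D : I -> set 'rV[R]_n) c, cells e D c.

Lemma epow_Sb u : Vb Omega K p u -> epow Omega u = (Sb Omega p u)%:E.
Proof.
move=> [_ _ iS _]; rewrite /Sb /pint /Rintegral fineK; last first.
  exact: integrable_fin_num.
by apply: eq_integral => x _; rewrite mul1r.
Qed.

Lemma epow_ge0 D u : (0 <= epow D u)%E.
Proof. by apply: integral_ge0 => x _; rewrite lee_fin powR_ge0. Qed.

Lemma epowD D u v : measurable D -> measurable_fun setT u -> measurable_fun setT v ->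
  (epow D (fun x => (u x + v x)%R) <= (2 `^ p)%:E * (epow D u + epow D v))%E.
Proof.
move=> mD mu_ mv.
have mp (f : 'rV[R]_n -> R) : measurable_fun setT f -> measurable_fun D (fun x => (`|f x| `^ p)%:E).
  by move=> mf; apply/measurable_EFinP/measurable_normr_powR; exact: measurable_funTS.
have g0 (f : 'rV[R]_n -> R) x : D x -> (0 <= (`|f x| `^ p)%:E)%E.
  by move=> _; rewrite lee_fin powR_ge0.
rewrite /epow -ge0_integralD//; try exact: mp; try exact: g0.
rewrite -ge0_integralZl_EFin ?powR_ge0//; last 2 first.
- by move=> x Dx; rewrite adde_ge0// g0.
- by apply: emeasurable_funD; exact: mp.
apply: ge0_le_integral.
- exact: mD.
- by move=> x _; rewrite lee_fin powR_ge0.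
- by apply: mp; exact: measurable_funD.
- by apply: measurable_funeM; apply: emeasurable_funD; exact: mp.
- by move=> x Dx; rewrite -EFinD -EFinM lee_fin normrD_powR.
Qed.

Lemma epowN D u : epow D (fun x => - u x)%R = epow D u.
Proof. by apply: eq_integral => x _; rewrite normrN. Qed.

Lemma epow_cst D (c a : R) : measurable D -> mu D = c%:E ->
  epow D (fun=> a) = (`|a| `^ p * c)%:E.
Proof. by move=> mD muD; rewrite EFinM -muD; exact: integral_cst. Qed.

(** A bounded sequence is Cauchy in L^p along any ultrafilter: the constants of
[cell_constants] are bounded, hence converge along it, and u_k - u_l differs from
the step function with values a_k - a_l by two small errors. *)
Lemma total_bounded (G : set_system nat) (u : nat -> 'rV[R]_n -> R) (M e : R) :
  UltraFilter G -> 0 <= M -> (forall k, Vb Omega K p (u k)) ->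
  (forall k, Nb Omega K p (u k) <= M) -> (forall k, Sb Omega p (u k) <= M) ->
  0 < e -> exists2 A, G A & forall k l, A k -> A l ->
    (epow Omega (fun x => (u k x - u l x)%R) <= e%:E)%E.
Proof.
move=> UG M0 Vu hN hS e0.
have mM : 0 < M + 1 by lra.
pose q : R := 2 `^ p.
have q1 : 1 <= q by rewrite -(powRr0 2); apply: ler_powR; rewrite ?ler1n// ltW.
have q0 : 0 < q by exact: lt_le_trans q1.
(* q is the constant of |x + y|^p <= q (|x|^p + |y|^p); the split of u_k - u_l into
   three terms costs q for the first error and q^2 for the other two terms, each
   error is then at most e / 4 and the step function contributes at most e / 2 *)
pose e1 := e / (4 * q * q * (M + 1)).
have e10 : 0 < e1 by rewrite divr_gt0// !mulr_gt0.
have [I [D [c hc]]] := hcells e10; have [c0 mD tD OD _] := hc.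
have mu_ k : measurable_fun setT (u k) by case: (Vu k).
have /choice[a ha] : forall k, exists a : I -> R,
    (\sum_(i : I) epow (D i) (fun x => (u k x - a i)%R) <= (e1 * (M + 1))%:E)%E.
  move=> k; have [a ha] := cell_constants e10 hc (Vu k); exists a.
  by apply: (le_trans ha); rewrite lee_fin ler_pM2l// lerD2r.
have ha1 k i : (epow (D i) (fun x => (u k x - a k i)%R) <= (e1 * (M + 1))%:E)%E.
  apply: le_trans (ha k); rewrite (bigD1 i)//= leeDl// sume_ge0// => j _.
  exact: epow_ge0.
have uD k i : (epow (D i) (u k) <= M%:E)%E.
  apply: (@le_trans _ _ (epow Omega (u k))); last first.
    by rewrite epow_Sb// lee_fin.
  have [_ u0 _ _] := Vu k; rewrite /epow [leRHS]integral_mkcond.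
  rewrite (_ : (fun x => _) \_ Omega = (fun x => (`|u k x| `^ p)%:E)); last first.
    apply/funext => x; rewrite /patch; case: ifPn => // /negP xO.
    by rewrite u0 ?normr0 ?powR0 ?gt_eqF// => Ox; apply: xO; rewrite inE.
  apply: ge0_subset_integral => //; first by case: (mD i).
    by apply/measurable_EFinP/measurable_normr_powR.
pose B := (q * (M + e1 * (M + 1)) / c) `^ p^-1.
have aB k i : `|a k i| <= B.
  have h : `|a k i| `^ p * c <= q * (M + e1 * (M + 1)).
    rewrite -lee_fin -(epow_cst _ (mD i).1 (mD i).2).
    rewrite (_ : (fun=> a k i) = (fun x => (u k x + - (u k x - a k i))%R)); last first.
      by apply/funext => x; ring.
    apply: (le_trans (epowD (mD i).1 (mu_ k) _)).
      apply: measurableT_comp => //; apply: measurable_funB => //.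
    rewrite EFinM lee_pmul2l ?lte_fin//; rewrite epowN EFinD.
    by apply: leeD; [exact: uD|exact: ha1].
  have -> : `|a k i| = (`|a k i| `^ p) `^ p^-1.
    by rewrite -powRrM mulfV ?gt_eqF// powRr1.
  apply: ge0_ler_powR; rewrite ?nnegrE ?powR_ge0//.
  - by rewrite invr_ge0 ltW.
  - apply: divr_ge0; last exact: ltW.
    apply: mulr_ge0; first exact: ltW.
    by apply: addr_ge0 => //; apply: mulr_ge0; exact: ltW.
  - by rewrite ler_pdivlMr.
(* + 1 because there may be no cell at all *)
pose m1 : R := #|I|%:R + 1.
have m10 : 0 < m1 by rewrite ltr_wpDl.
pose t := e / (2 * q * q * c * m1).
have t0 : 0 < t by rewrite divr_gt0// !mulr_gt0.
pose eta := t `^ p^-1.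
have eta0 : 0 < eta by exact: powR_gt0.
have /choice[l hl] : forall i, exists l : R, (fun k => a k i) @ G --> l.
  by move=> i; apply: (ultra_bounded_cvg (A := B)) => k; exact: aB.
have GA : G [set k | forall i, `|l i - a k i| < eta / 2].
  apply: filter_forall => i; move: (hl i) => /cvgrPdist_lt; apply.
  by rewrite divr_gt0.
exists [set k | forall i, `|l i - a k i| < eta / 2] => // k j hk hj.
have aij i : `|a k i - a j i| `^ p <= t.
  have -> : t = eta `^ p by rewrite /eta -powRrM mulVf ?gt_eqF// powRr1// ltW.
  apply: ge0_ler_powR; rewrite ?nnegrE//; [exact: ltW|exact: ltW|].
  rewrite (_ : _ - _ = (l i - a j i) - (l i - a k i)); last by ring.
  rewrite (le_trans (ler_normB _ _))// [leRHS]splitr.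
  exact: lerD (ltW (hj i)) (ltW (hk i)).
have mW : measurable (\big[setU/set0]_(i <- enum I) D i).
  by apply: bigsetU_measurable => i _; case: (mD i).
have mf : measurable_fun setT (fun x => (`|u k x - u j x| `^ p)%:E).
  by apply/measurable_EFinP/measurable_normr_powR/measurable_funB.
apply: (@le_trans _ _ (\sum_(i : I) epow (D i) (fun x => (u k x - u j x)%R))%E).
  rewrite (_ : (\sum_(i : I) _ = epow (\big[setU/set0]_(i <- enum I) D i)
      (fun x => (u k x - u j x)%R))%E); last first.
    rewrite /epow ge0_integral_bigsetU//.
    - by rewrite big_enum.
    - by move=> i; case: (mD i).
    - exact: enum_uniq.
    - by apply: sub_trivIset tD.
    - exact: measurable_funTS.
  apply: ge0_subset_integral => //.
  - exact: measurable_funTS.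
  - by move=> x /OD [i _ Dx]; rewrite -bigcup_seq; exists i => //=; rewrite mem_enum.
apply: (@le_trans _ _ (\sum_(i : I) (q%:E * (epow (D i) (fun x => (u k x - a k i)%R) +
   q%:E * ((t * c)%:E + epow (D i) (fun x => (u j x - a j i)%R)))))%E).
  apply: lee_sum => i _.
  rewrite [X in epow _ X](_ : _ =
    (fun x => ((u k x - a k i) + ((a k i - a j i) + - (u j x - a j i)))%R)); last first.
    by apply/funext => x; ring.
  have mj : measurable_fun setT (fun x => - (u j x - a j i)).
    by apply: measurableT_comp => //; exact: measurable_funB.
  have mk : measurable_fun setT (fun x => u k x - a k i) by exact: measurable_funB.
  have mkj : measurable_fun setT (fun x => (a k i - a j i) + - (u j x - a j i)).
    exact: measurable_funD.
  apply: (le_trans (epowD (mD i).1 mk mkj)).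
  rewrite lee_pmul2l ?lte_fin// leeD2l//.
  have mc : measurable_fun [set: 'rV[R]_n] (fun=> a k i - a j i) by exact: measurable_cst.
  apply: (le_trans (epowD (mD i).1 mc mj)).
  rewrite lee_pmul2l ?lte_fin// epowN leeD2r// (epow_cst _ (mD i).1 (mD i).2) lee_fin.
  by rewrite ler_pM2r.
have dist (F : I -> \bar R) : (forall i, 0 <= F i)%E ->
    (\sum_(i : I) (q%:E * F i) = q%:E * \sum_(i : I) F i)%E.
  by move=> F0; rewrite ge0_sume_distrr.
have g0 i : (0 <= (t * c)%:E + epow (D i) (fun x => (u j x - a j i)%R))%E.
  by rewrite adde_ge0 ?epow_ge0// lee_fin mulr_ge0// ltW.
rewrite dist; last first.
  by move=> i; rewrite adde_ge0 ?epow_ge0// mule_ge0 ?g0// lee_fin ltW.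
rewrite big_split/= dist// [X in (_ + q%:E * X)%E]big_split/= sumEFin sumr_const -mulr_natr.
apply: (@le_trans _ _ (q%:E * ((e1 * (M + 1))%:E +
   q%:E * ((t * c * #|I|%:R)%:E + (e1 * (M + 1))%:E)))%E).
  rewrite lee_pmul2l ?lte_fin// leeD ?ha// lee_pmul2l ?lte_fin// leeD2l//.
rewrite -!(EFinD, EFinM) lee_fin.
have E1 : q * q * (e1 * (M + 1)) = e / 4.
  by rewrite /e1; field; rewrite !gt_eqF.
have E2 : q * (e1 * (M + 1)) <= e / 4.
  rewrite -E1 -mulrA ler_peMl// ltW//; apply: mulr_gt0 => //; exact: mulr_gt0.
have E3 : q * q * (t * c * m1) = e / 2 by rewrite /t; field; rewrite !gt_eqF.
have E4 : q * q * (t * c * #|I|%:R) <= e / 2.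
  rewrite -E3; apply: ler_wpM2l; first exact: mulr_ge0 (ltW q0) (ltW q0).
  apply: ler_wpM2l; first exact: mulr_ge0 (ltW t0) (ltW c0).
  by rewrite /m1 lerDl.
have -> : q * (e1 * (M + 1) + q * (t * c * #|I|%:R + e1 * (M + 1))) =
  q * (e1 * (M + 1)) + q * q * (t * c * #|I|%:R) + q * q * (e1 * (M + 1)) by ring.
lra.
Qed.

Lemma limn_einf_le_near (f : nat -> \bar R) (c : \bar R) :
  (\forall m \near \oo, f m <= c)%E -> (limn_einf f <= c)%E.
Proof.
move=> fc; rewrite limn_einf_lim; apply: lime_le; first exact: is_cvg_einfs.
apply: filterS fc => m; apply: le_trans; apply: ereal_inf_lbound.
by exists m => //=.
Qed.

Lemma pdiff_ae (P : 'rV[R]_n -> Prop) : {ae mu, forall x, P x} ->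
  {ae mu2, forall z, P z.1 /\ P z.2}.
Proof.
move=> aeP; have h1 := ae_prod_fst mu aeP; have h2 := ae_prod_snd mu aeP.
by apply: filterS2 h1 h2 => z.
Qed.

(** The compact embedding into L^p, in the form of dominated almost everywhere
convergence, which serves S and B alike. A diagonal choice inside an ultrafilter
gives a subsequence whose consecutive distances satisfy the hypothesis of
[fast_cauchy]; the bound on the limit norm is Fatou's lemma. *)
Lemma compact_Vb (u : nat -> 'rV[R]_n -> R) (M : R) :
  (forall k, Vb Omega K p (u k)) ->
  (forall k, Nb Omega K p (u k) <= M) -> (forall k, Sb Omega p (u k) <= M) ->
  exists (k : nat -> nat) w, [/\ forall m, (m <= k m)%N, Vb Omega K p w,
    forall c, (\forall m \near \oo, Nb Omega K p (u (k m)) <= c) -> Nb Omega K p w <= c &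
    exists2 H : 'rV[R]_n -> R, mu.-integrable Omega (EFin \o H) &
      {ae mu, forall x, Omega x -> u (k m) x @[m --> \oo] --> w x /\
        forall m, `|u (k m) x| `^ p <= H x}].
Proof.
move=> Vu hN hS; have M0 : 0 <= M by apply: (le_trans _ (hS 0%N)); exact: Sb_ge0.
have [G [UG sG]] := ultraFilterLemma (_ : ProperFilter \oo).
pose em (m : nat) : R := 1 / (2 ^ (m + 1))%:R / (2 ^+ m) `^ p.
have em0 m : 0 < em m.
  apply: divr_gt0; last by apply: powR_gt0; exact: exprn_gt0.
  by apply: divr_gt0 => //; rewrite ltr0n expn_gt0.
have /choice[A hA] : forall m, exists A, G A /\ forall k l, A k -> A l ->
    (epow Omega (fun x => (u k x - u l x)%R) <= (em m)%:E)%E.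
  by move=> m; have [A GA hA] := total_bounded UG M0 Vu hN hS (em0 m); exists A.
have /choice[k hk] : forall m : nat, exists k, [set k | (m <= k)%N] k /\
    forall i : 'I_m.+1, A i k.
  move=> m; have G1 : G [set k | (m <= k)%N] by apply: sG; exists m.
  have G2 : G [set k | forall i : 'I_m.+1, A i k].
    by apply: filter_forall => i; case: (hA i).
  have [j [j1 j2]] := @filter_ex _ G _ _ (filterI G1 G2); by exists j.
have km m : (m <= k m)%N by case: (hk m).
have Ak m j : (m <= j)%N -> A m (k j).
  move=> mj; have [_ h] := hk j; have := h (Ordinal (mj : (m < j.+1)%N)); exact.
pose v m := u (k m).
have mv m : measurable_fun setT (v m) by case: (Vu (k m)).
have v0 m x : ~ Omega x -> v m x = 0 by case: (Vu (k m)) => _ h _ _; exact: h.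
have [|||H iH hH] := @fast_cauchy _ _ _ mu Omega mO v p p0.
- by move=> m; exact: measurable_funTS.
- have [_ _ iS _] := Vu (k 0%N); apply: eq_integrable iS => // x _ /=.
  by rewrite mul1r.
- move=> m; have [_ hm] := hA m.
  have := hm (k m.+1) (k m) (Ak _ _ (leqnSn m)) (Ak _ _ (leqnn m)).
  have q0 : 0 < (2 ^+ m) `^ p :> R by rewrite powR_gt0// exprn_gt0.
  move=> hX.
  have -> : (1 / (2 ^ (m + 1))%:R)%:E = (((2 ^+ m) `^ p)%:E * (em m)%:E)%E.
    by rewrite -EFinM /em; congr _%:E; rewrite mulrCA mulfV ?mulr1// gt_eqF.
  apply: (@le_trans _ _ (((2 ^+ m) `^ p)%:E *
      epow Omega (fun x => (u (k m.+1) x - u (k m) x)%R))%E); last first.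
    by rewrite lee_pmul2l.
  have mm : measurable_fun Omega
      (fun x => (`|(u (k m.+1) x - u (k m) x)%R| `^ p)%:E).
    apply/measurable_EFinP/measurable_normr_powR; apply: measurable_funTS.
    exact: measurable_funB (mv m.+1) (mv m).
  rewrite -ge0_integralZl_EFin//.
  rewrite le_eqVlt; apply/orP; left; apply/eqP; apply: eq_integral => x _.
  by rewrite -EFinM normrM powRM// ger0_norm// exprn_ge0.
have [w mw hw] := @measurable_lim _ _ _ setT v mv.
have w0 x : ~ Omega x -> w x = 0.
  move=> Ox; have cv : cvgn (v^~ x).
    by rewrite (_ : v^~ x = fun=> 0); [exact: is_cvg_cst|apply/funext => m; exact: v0].
  have := hw x I cv; rewrite (_ : (fun m => v m x) = fun=> 0); last first.
    by apply/funext => m; exact: v0.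
  by move/(cvg_lim (@Rhausdorff R)); rewrite lim_cst.
have cvx : {ae mu, forall x, v m x @[m --> \oo] --> w x}.
  apply: filterS hH => x hx; have [Ox|Ox] := pselect (Omega x).
    by apply: hw => //; have [] := hx Ox.
  rewrite w0// (_ : (fun m => v m x) = fun=> 0); first exact: cvg_cst.
  by apply/funext => m; exact: v0.
have iwS : pintegrable mu Omega (cst 1) p w.
  have [|||||h _] := @Rintegral_dominated _ _ _ mu Omega mO
    (fun m x => cst 1 x * `|v m x| `^ p) (fun x => cst 1 x * `|w x| `^ p) H.
  - move=> m; apply: measurable_funM => //; apply: measurable_normr_powR.
    exact: measurable_funTS.
  - by apply: measurable_funM => //; apply: measurable_normr_powR; exact: measurable_funTS.
  - apply: filterS cvx => x hx _; apply: cvgM; first exact: cvg_cst.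
    exact: cvg_normr_powR.
  - exact: iH.
  - apply: filterS hH => x hx Ox m; rewrite mul1r ger0_norm ?powR_ge0//.
    by have [_] := hx Ox; apply.
  - exact: h.
have mKd := measurable_diffK (Omega := Omega) mK.
pose f (m : nat) z := (diffK K z * `|pdiff (v m) z| `^ p)%:E.
have mfg (g : 'rV[R]_n -> R) : measurable_fun setT g ->
    measurable_fun Q (fun z => (diffK K z * `|pdiff g z| `^ p)%:E).
  move=> mg; apply/measurable_EFinP; apply: measurable_funM => //.
  by apply: measurable_normr_powR; exact: measurable_diff.
have f0 (g : 'rV[R]_n -> R) z : (0 <= (diffK K z * `|pdiff g z| `^ p)%:E)%E.
  by rewrite lee_fin mulr_ge0 ?powR_ge0// ltW// K0.
have fat : (\int[mu2]_(z in Q) (diffK K z * `|pdiff w z| `^ p)%:E <=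
   limn_einf (fun m => \int[mu2]_(z in Q) f m z))%E.
  rewrite (_ : (\int[mu2]_(z in Q) _ = \int[mu2]_(z in Q) limn_einf (f^~ z))%E).
    exact: (fatou mu2 mQ (fun m => mfg _ (mv m)) (fun m z _ => f0 (v m) z)).
  apply: ae_eq_integral_any; apply: filterS (pdiff_ae cvx) => z [h1 h2] Qz.
  have h : f m z @[m --> \oo] --> (diffK K z * `|pdiff w z| `^ p)%:E.
    apply: cvg_EFin; first exact: nearW.
    apply: cvgM; first exact: cvg_cst.
    by apply: cvg_normr_powR => //; exact: cvgB.
  by have [<- _] := cvg_limn_einf_sup h.
have NE m : (\int[mu2]_(z in Q) f m z = (Nb Omega K p (v m))%:E)%E.
  have [_ _ _ iN] := Vu (k m).
  by rewrite /Nb /pint /Rintegral fineK//; exact: integrable_fin_num.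
have Nle c : (\forall m \near \oo, Nb Omega K p (v m) <= c) ->
   (\int[mu2]_(z in Q) (diffK K z * `|pdiff w z| `^ p)%:E <= c%:E)%E.
  move=> hc; apply: (le_trans fat); apply: limn_einf_le_near.
  by apply: filterS hc => m; rewrite NE lee_fin.
have iwN : pintegrable mu2 Q (diffK K) p (pdiff w).
  apply: ge0_integrable => //.
  - by apply/measurable_EFinP; exact: mfg.
  - by move=> z _; rewrite -lee_fin.
  - apply: (@le_lt_trans _ _ M%:E); last exact: ltry.
    by apply: Nle; apply: nearW => m; exact: hN.
exists k, w; split => //.
- move=> c hc; rewrite -lee_fin {1}/Nb /pint /Rintegral fineK.
    exact: Nle.
  exact: integrable_fin_num.
- exists H => //; apply: filterS2 cvx hH => x h1 h2 Ox; split; first exact: h1.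
  by have [] := h2 Ox.
Qed.

End compactness.

(** * The Euclidean norm and the covering by cubes *)

Section enorm_theory.
Context {R : realType}.

Lemma enorm_ge0 n (x : 'rV[R]_n) : 0 <= enorm x.
Proof. exact: sqrtr_ge0. Qed.

Lemma coord_le_enorm n (x : 'rV[R]_n) i : `|x ord0 i| <= enorm x.
Proof.
rewrite -sqrtr_sqr ler_wsqrtr// (bigD1 i)//= lerDl sumr_ge0// => j _.
exact: sqr_ge0.
Qed.

Lemma enorm_gt0 n (x : 'rV[R]_n) : x != 0 -> 0 < enorm x.
Proof.
move=> x0; rewrite lt_def enorm_ge0 andbT; apply: contraNneq x0 => e0.
apply/eqP/rowP => i; rewrite mxE; apply/eqP; rewrite -normr_le0.
by have := coord_le_enorm x i; rewrite e0.
Qed.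

Lemma enorm_le n (x : 'rV[R]_n) (h : R) : 0 <= h ->
  (forall i, `|x ord0 i| <= h) -> enorm x <= Num.sqrt n%:R * h.
Proof.
move=> h0 hx; rewrite -[X in _ * X](ger0_norm h0) -sqrtr_sqr -sqrtrM// ler_wsqrtr//.
apply: (@le_trans _ _ (\sum_(i < n) h ^+ 2)).
  apply: ler_sum => i _; rewrite -real_normK ?num_real//.
  by rewrite lerXn2r ?nnegrE.
by rewrite sumr_const card_ord mulr_natl.
Qed.

Lemma measurable_enorm n : measurable_fun setT (@enorm R n).
Proof.
rewrite (_ : @enorm R n = (fun x => (\sum_i x ord0 i ^+ 2) `^ 2^-1)); last first.
  apply/funext => x; rewrite powR12_sqrt// sumr_ge0// => i _; exact: sqr_ge0.
apply: (@measurableT_comp _ _ _ _ _ _ (fun x : R => x `^ 2^-1)).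
  exact: measurable_powR.
apply: measurable_sum => i; apply: measurable_funX; exact: measurable_rV_coord.
Qed.

Lemma min1_powR (a p : R) : 0 < p -> 0 <= a -> Num.min 1 (a `^ p) = (Num.min 1 a) `^ p.
Proof.
move=> p0 a0; have e1 : 1 `^ p = 1 :> R by rewrite powR1.
case: (leP 1 a) => h.
  rewrite (min_idPl _) ?e1// -{1}e1.
  by apply: ge0_ler_powR; rewrite ?nnegrE ?(ltW p0).
rewrite (min_idPr _)// -[leRHS]e1.
by apply: ge0_ler_powR; rewrite ?nnegrE ?(ltW p0)// ltW.
Qed.

(** Continuity within the open set Omega makes preimages of intervals relatively
open, hence measurable. *)
Lemma measurable_weight n (Omega : set 'rV[R]_n) (b : 'rV[R]_n -> R) :
  open Omega -> {within Omega, continuous b} -> measurable_fun Omega b.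
Proof.
have mO := @open_measurable_rV R n Omega.
move=> oO /continuousP cf; apply: (measurability _ (RGenOpens.measurableE R)).
move=> _ [_ [a [c ->] <-]].
have oI : open (`]a, c[%classic : set R) by exact: interval_open.
have /open_subspaceP[V oV VE] := cf _ oI.
rewrite setIC -VE; apply: measurableI; exact: open_measurable_rV.
Qed.
End enorm_theory.

Section cells_exist.
Context {R : realType} (n : nat).
Variables (Omega : set 'rV[R]_n) (K : 'rV[R]_n -> R) (M0 theta a : R).
Local Notation mu := (lebesgue_rV n).
Hypotheses (M00 : 0 < M0) (hO : forall x, Omega x -> forall i, - M0 <= x ord0 i < M0).
Hypotheses (t0 : 0 < theta) (a0 : 0 < a) (n0 : (0 < n)%N).
Hypothesis hK : forall x, x != 0 -> theta * enorm x `^ (- (n%:R + a)) <= K x.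

(** Cubes of side h, for h small. Their measure is h^n and their diameter is
sqrt n * h, so the lower bound on the kernel gives
h^n K >= theta sqrt n ^(- n - a) h^(- a), which is large. *)
Lemma cells_exist e : 0 < e ->
  exists (I : finType) (D : I -> set 'rV[R]_n) c, cells Omega K e D c.
Proof.
move=> e0.
have nR0 : 0 < n%:R :> R by rewrite ltr0n.
pose sn : R := Num.sqrt n%:R.
have sn0 : 0 < sn by rewrite sqrtr_gt0.
pose s : R := n%:R + a; have s0 : 0 < s by rewrite addr_gt0.
(* the side below which e h^n K >= 1 within a cube *)
pose bound := (e * theta * sn `^ (- s)) `^ a^-1.
have b0 : 0 < bound by rewrite powR_gt0// !mulr_gt0// powR_gt0.
pose N := (Num.truncn (2 * M0 / bound)).+1.
have NR0 : 0 < N%:R :> R by rewrite ltr0n.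
pose h := 2 * M0 / N%:R.
have h0 : 0 < h by rewrite divr_gt0// mulr_gt0.
have hb : h <= bound.
  rewrite /h ler_pdivrMr// [leRHS]mulrC -ler_pdivrMr//.
  have /truncn_itv/andP[_ /ltW] : 0 <= 2 * M0 / bound.
    by rewrite divr_ge0 ?ltW// mulr_gt0.
  exact.
pose lo (c : {ffun 'I_n -> 'I_N}) i := - M0 + (c i)%:R * h.
pose D c := [set x : 'rV[R]_n | forall i, `[lo c i, lo c i + h[%classic (x ord0 i)].
exists {ffun 'I_n -> 'I_N}, D, (h ^+ n).
have mA c i : measurable (`[lo c i, lo c i + h[%classic : set R).
  exact: measurable_itv.
split.
- exact: exprn_gt0.
- move=> c; split; first exact: (measurable_rV_box (mA c)).
  rewrite /D (lebesgue_rV_box (mA c)).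
  rewrite (eq_bigr (fun=> h%:E)); last first.
    move=> i _; rewrite lebesgue_measure_itv/= lte_fin ltrDl h0 -EFinB.
    by congr _%:E; ring.
  by rewrite prodEFin prodr_const card_ord.
- apply/trivIsetP => c c' _ _ cc'; apply/seteqP; split => // x [h1 h2].
  move/eqP: cc'; apply; apply/ffunP => i; apply/val_inj/eqP => /=.
  have := h1 i; have := h2 i; rewrite /= !in_itv/= /lo => /andP[a1 a2] /andP[b1 b2].
  have lt1 : (c i)%:R * h < ((c' i)%:R + 1) * h :> R by rewrite mulrDl mul1r; lra.
  have lt2 : (c' i)%:R * h < ((c i)%:R + 1) * h :> R by rewrite mulrDl mul1r; lra.
  move: lt1 lt2; rewrite !ltr_pM2r// !natr1 !ltr_nat !ltnS => l1 l2.
  by rewrite eqn_leq l1 l2.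
- move=> x Ox.
  have hx i : 0 <= (x ord0 i + M0) / h < N%:R.
    have /andP[x1 x2] := hO Ox i; rewrite divr_ge0 ?(ltW h0)//=; last by lra.
    rewrite ltr_pdivrMr// /h mulrC divfK ?gt_eqF//; lra.
  have tN i : (Num.truncn ((x ord0 i + M0) / h) < N)%N.
    have /andP[x1 x2] := hx i; have /andP[x3 x4] := truncn_itv x1.
    by rewrite -(ltr_nat R); exact: le_lt_trans x2.
  exists [ffun i => Ordinal (tN i)] => // i /=; rewrite in_itv/= /lo ffunE/=.
  have /andP[x1 _] := hx i; have /andP[] := truncn_itv x1.
  set t := (Num.truncn _)%:R; rewrite ler_pdivlMr// ltr_pdivrMr// -natr1 => h1 h2.
  have {}h2 : x ord0 i + M0 < t * h + h.
    by apply: lt_le_trans h2 _; rewrite mulrDl mul1r.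
  by apply/andP; split; lra.
- move=> c x y Dx Dy /eqP xy.
  have z0 : x - y != 0 by rewrite subr_eq0.
  have ze : enorm (x - y) <= sn * h.
    apply: enorm_le; first exact: ltW.
    move=> i; rewrite !mxE; have := Dx i; have := Dy i; rewrite /= !in_itv/=.
    by move=> /andP[a1 a2] /andP[b1 b2]; rewrite ler_norml; apply/andP; split; lra.
  have Kz := hK z0.
  have sh0 : 0 < sn * h by rewrite mulr_gt0.
  have l1 : (sn * h) `^ (- s) <= enorm (x - y) `^ (- s).
    rewrite !powRN lef_pV2 ?posrE ?powR_gt0 ?enorm_gt0//.
    apply: ge0_ler_powR; rewrite ?nnegrE ?(ltW s0) ?(ltW sh0)//; exact: enorm_ge0.
  apply: (@le_trans _ _ (e * h ^+ n * (theta * (sn * h) `^ (- s)))); last first.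
    rewrite ler_pM2l ?mulr_gt0 ?exprn_gt0//; apply: le_trans Kz.
    by rewrite ler_pM2l.
  have -> : e * h ^+ n * (theta * (sn * h) `^ (- s)) = bound `^ a * h `^ (- a).
    have -> : bound `^ a = e * theta * sn `^ (- s).
      rewrite /bound -powRrM mulVf ?gt_eqF// powRr1// !mulr_ge0// ?powR_ge0//.
      - exact: ltW.
      - exact: ltW.
    rewrite powRM ?(ltW sn0) ?(ltW h0)//.
    have -> : h `^ (- a) = h ^+ n * h `^ (- s).
      rewrite -powR_mulrn ?(ltW h0)// -powRD ?(gt_eqF h0) ?implybT//.
      by congr (_ `^ _); rewrite /s; ring.
    by ring.
  rewrite powRN ler_pdivlMr ?powR_gt0// mul1r.
  by apply: ge0_ler_powR; rewrite ?nnegrE ?(ltW a0) ?(ltW h0) ?(ltW b0).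
Qed.
End cells_exist.

(** * A Borel kernel, and a function with positive weighted integral *)

Section kernel_rep.
Context {R : realType}.

Lemma rV_set1_box n : [set (0 : 'rV[R]_n)] = [set x | forall i, [set (0 : R)] (x ord0 i)].
Proof.
apply/seteqP; split => x /=; first by move=> -> i; rewrite mxE.
by move=> h; apply/rowP => i; rewrite h mxE.
Qed.

Lemma measurable_rV0 n : measurable [set (0 : 'rV[R]_n)].
Proof.
rewrite rV_set1_box; apply: (@measurable_rV_box R n (fun=> [set 0])) => i.
exact: measurable_set1.
Qed.

Lemma lebesgue_rV0 n : (0 < n)%N -> lebesgue_rV n [set (0 : 'rV[R]_n)] = 0%E.
Proof.
case: n => // n _; have m0 (i : 'I_n.+1) : measurable [set (0 : R)] by exact: measurable_set1.
rewrite rV_set1_box (lebesgue_rV_box m0) big_ord_recl.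
by rewrite (@lebesgue_measure_set1 R) mul0e.
Qed.

Definition minpow n (p : R) (x : 'rV[R]_n) := Num.min 1 (enorm x `^ p).

(** Lebesgue measurability of min(1, |x|^p) K provides a Borel function g equal to it
almost everywhere. The maximum of g / min(1, |x|^p) with the lower bound of K is
Borel, agrees with K almost everywhere, and satisfies the lower bound at every
point; points are null, so the value at 0 is free. *)
Lemma kernel_rep n (p alpha : R) (K : 'rV[R]_n -> R) : (0 < n)%N -> 0 < p ->
  is_kernel p alpha K -> exists2 theta : R, 0 < theta & exists K' : 'rV[R]_n -> R,
  [/\ measurable_fun setT K', forall x, 0 < K' x,
      forall x, x != 0 -> theta * enorm x `^ (- (n%:R + p * alpha)) <= K' x,
      {ae lebesgue_rV n, forall x, K x = K' x} &
      (\int[lebesgue_rV n]_x (minpow p x * K' x)%:E < +oo)%E].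
Proof.
move=> n0 p0 [Kpos [[g mg Kg] Kint] [theta t0 Klow] _].
pose s := - (n%:R + p * alpha).
have mpow r : measurable_fun setT (fun x : 'rV[R]_n => enorm x `^ r).
  apply: (@measurableT_comp _ _ _ _ _ _ (fun x : R => x `^ r)).
    exact: measurable_powR.
  exact: measurable_enorm.
have mmin : measurable_fun setT (@minpow n p).
  by apply: measurable_minr => //; exact: measurable_cst.
have min0 (x : 'rV[R]_n) : x != 0 -> 0 < minpow p x.
  by move=> x0; rewrite lt_min ltr01 powR_gt0// enorm_gt0.
pose K1 x := Num.max (g x * (minpow p x) `^ (-1)) (theta * enorm x `^ s).
pose K' x := if x == 0 then 1 else K1 x.
have mK1 : measurable_fun setT K1.
  apply: measurable_maxr; last by apply: measurable_funM.
  apply: measurable_funM => //.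
  by apply: (@measurableT_comp _ _ _ _ _ _ (fun x : R => x `^ (-1))); [exact: measurable_powR|].
have mK' : measurable_fun setT K'.
  apply: measurable_fun_ifT => //.
  apply: (measurable_fun_bool true).
  rewrite setTI (_ : _ @^-1` _ = [set 0]); first exact: measurable_rV0.
  by apply/seteqP; split => x /= /eqP.
have KK' : {ae lebesgue_rV n, forall x, K x = K' x}.
  have ae0 : {ae lebesgue_rV n, forall x : 'rV[R]_n, x != 0}.
    exists [set 0]; split; [exact: measurable_rV0|exact: lebesgue_rV0|].
    by move=> x /= /negP; rewrite negbK => /eqP.
  apply: filterS2 Kg ae0 => x Kgx x0; rewrite /K' (negbTE x0) /K1 -(Kgx I).
  have m0 := min0 _ x0.
  rewrite -/(minpow p x) (powR_inv1 (ltW m0)) mulrAC mulfV ?gt_eqF// mul1r.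
  by rewrite (max_idPl _)//; exact: Klow.
exists theta => //; exists K'; split => //.
- move=> x; rewrite /K'; case: eqP => // /eqP x0.
  rewrite /K1 lt_max; apply/orP; right; rewrite mulr_gt0// powR_gt0//.
  exact: enorm_gt0.
- by move=> x x0; rewrite /K' (negbTE x0) /K1 le_max lexx orbT.
- apply: le_lt_trans Kint; rewrite le_eqVlt; apply/orP; left; apply/eqP.
  apply: ae_eq_integral_any; apply: filterS KK' => x -> _.
  have [->|x0] := eqVneq x 0.
    rewrite /minpow (_ : enorm 0 = 0) ?powR0 ?gt_eqF//.
      by rewrite (min_idPr _)// !mul0r normr0 powRr1.
    by rewrite /enorm big1 ?sqrtr0// => i _; rewrite mxE expr0n.
  rewrite powRr1// ger0_norm// mulr_ge0 ?(ltW (min0 _ x0))//.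
  rewrite /K' (negbTE x0) /K1 le_max; apply/orP; right.
  by rewrite mulr_ge0 ?powR_ge0// ltW.
Qed.
End kernel_rep.

Section bump.
Context {R : realType} (n : nat).
Variables (Omega : set 'rV[R]_n) (K b : 'rV[R]_n -> R) (p beta : R).
Local Notation mu := (lebesgue_rV n).
Local Notation mu2 := ((lebesgue_rV n : {measure set 'rV[R]_n -> \bar R})
  \x lebesgue_rV n)%E.
Local Notation Q := (Qset Omega).
Hypotheses (p2 : 2 <= p) (hbeta : 1 < beta < p) (n0 : (0 < n)%N).
Hypotheses (oO : open Omega) (fO : (mu Omega < +oo)%E).
Hypotheses (mK : measurable_fun setT K) (K0 : forall x, 0 < K x).
Hypothesis Kint : (\int[mu]_x (minpow p x * K x)%:E < +oo)%E.
Hypothesis cb : {within Omega, continuous b}.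
Variable M : R.
Hypothesis bM : forall x, Omega x -> `|b x| <= M.

Let p0 : 0 < p. Proof. exact: lt_le_trans p2. Qed.
Let mO : measurable Omega. Proof. exact: open_measurable_rV. Qed.
Let mQ := measurable_Qset mO.
Let mk (x : 'rV[R]_n) : \bar R := (minpow p x * K x)%:E.

Let mmk : measurable_fun setT mk.
Proof.
apply/measurable_EFinP; apply: measurable_funM => //.
apply: measurable_minr; first exact: measurable_cst.
apply: (@measurableT_comp _ _ _ _ _ _ (fun x : R => x `^ p)).
  exact: measurable_powR.
exact: measurable_enorm.
Qed.

Lemma minpow_ge0 (x : 'rV[R]_n) : 0 <= minpow p x.
Proof. by rewrite le_min ler01 powR_ge0. Qed.

Let mk0 x : (0 <= mk x)%E.
Proof. by rewrite lee_fin mulr_ge0 ?minpow_ge0// ltW. Qed.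

(** Q is the union of Omega x R^n and R^n x Omega, and on each of them integrating
first over the free variable gives the finite integral over R^n, times the measure
of Omega. *)
Lemma Q_integral_minpow : (\int[mu2]_(z in Q) mk (z.1 - z.2)%R < +oo)%E.
Proof.
pose f (z : 'rV[R]_n * 'rV[R]_n) := mk (z.1 - z.2).
have mf : measurable_fun setT f.
  exact: (measurableT_comp mmk (measurable_fun_rV_sub (n := n))).
have f0 z : (0 <= f z)%E by exact: mk0.
pose A := Omega `*` [set: 'rV[R]_n]; pose B := [set: 'rV[R]_n] `*` Omega.
have mA : measurable A by exact: measurableX.
have mB : measurable B by exact: measurableX.
have I0 : (0 <= \int[mu]_x mk x)%E by exact: integral_ge0.
have fin : (\int[mu]_x mk x * mu Omega < +oo)%E.
  by apply: lte_mul_pinfty => //; rewrite ge0_fin_numE.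
have intA : (\int[mu2]_(z in A) f z = \int[mu]_x mk x * mu Omega)%E.
  rewrite integral_mkcond fubini_tonelli1//; last 2 first.
  - by apply/(measurable_restrictT _ _).1 => //; exact: measurable_funTS.
  - by move=> z; exact: erestrict_ge0.
  rewrite -(integral_cst mu mO) [RHS]integral_mkcond; apply: eq_integral => x _.
  rewrite /fubini_F /patch; have [Ox|Ox] := pselect (Omega x).
    rewrite mem_set// -(integral_rV_refl x mmk mk0); apply: eq_integral => y _.
    by rewrite mem_set.
  rewrite memNset//; apply: integral0_eq => y _; rewrite memNset// => -[].
  by [].
have intB : (\int[mu2]_(z in B) f z = \int[mu]_x mk x * mu Omega)%E.
  rewrite integral_mkcond fubini_tonelli2//; last 2 first.
  - by apply/(measurable_restrictT _ _).1 => //; exact: measurable_funTS.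
  - by move=> z; exact: erestrict_ge0.
  rewrite -(integral_cst mu mO) [RHS]integral_mkcond; apply: eq_integral => y _.
  rewrite /fubini_G /patch; have [Oy|Oy] := pselect (Omega y).
    rewrite mem_set//.
    have mm : measurable_fun setT (fun x : 'rV[R]_n => mk (0 - x)).
      exact: (measurableT_comp mmk (measurable_refl 0)).
    rewrite -(integral_rV_refl 0 mmk mk0) -(integral_rV_refl y mm (fun x => mk0 _)).
    apply: eq_integral => x _; rewrite mem_set// /f /=; congr mk.
    by rewrite sub0r opprB.
  rewrite memNset//; apply: integral0_eq => x _; rewrite memNset// => -[].
  by [].
apply: (@le_lt_trans _ _ (\int[mu2]_(z in A `|` B) f z)%E).
  apply: ge0_subset_integral => //; first exact: measurableU.
    exact: measurable_funTS.
  move=> z Qz; have [Oz|Oz] := pselect (Omega z.1); first by left.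
  by right; split => //; apply: contrapT => Oz2; exact: Qz.
apply: (@le_lt_trans _ _ (\int[mu2]_(z in A) f z + \int[mu2]_(z in B) f z)%E).
  have -> : A `|` B = A `|` (B `\` A).
    apply/seteqP; split => z [Az|Bz]; [by left| |by left|by right; case: Bz].
    by have [Az|Az] := pselect (A z); [left|right].
  have mBA : measurable (B `\` A) by exact: measurableD.
  rewrite ge0_integral_setU//.
  - by rewrite leeD2l//; apply: ge0_subset_integral => //; exact: measurable_funTS.
  - exact: measurable_funTS.
  - by apply/disj_setPS => z [Az [_ nAz]].
by rewrite intA intB lte_add_pinfty.
Qed.

(** The bump below is a function of the l^1 distance, a Lipschitz function that is
visibly Borel in the coordinates. *)
Definition ell1 (x : 'rV[R]_n) : R := \sum_i `|x ord0 i|.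

Let ell1_ge0 x : 0 <= ell1 x. Proof. exact: sumr_ge0. Qed.

Let ell1_le x : ell1 x <= n%:R * enorm x.
Proof.
apply: (@le_trans _ _ (\sum_(i < n) enorm x)).
  by apply: ler_sum => i _; exact: coord_le_enorm.
by rewrite sumr_const card_ord mulr_natl.
Qed.

Let ell1_dist (c x y : 'rV[R]_n) : `|ell1 (x - c) - ell1 (y - c)| <= ell1 (x - y).
Proof.
rewrite /ell1 -sumrB (le_trans (ler_norm_sum _ _ _))// ler_sum// => i _.
rewrite !mxE (le_trans (ler_dist_dist _ _))//.
by rewrite (_ : _ - _ = x ord0 i - y ord0 i)//; ring.
Qed.

(** A cone max(0, r - |x - c|_1) around a point c with b c > 0, where r is so small
that its support lies in Omega and b > b c / 2 there. Being bounded and Lipschitz,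
it satisfies |u x - u y|^p <= n^p min(1, |x - y|^p), so its norm is finite. *)
Lemma bump_exists : (exists2 x, Omega x & 0 < b x) ->
  exists2 u, Vb Omega K p u & 0 < Bb Omega b beta u.
Proof.
move=> [c Oc bc].
have [r /andP[r0 r1] hr] : exists2 r : R, 0 < r <= 1 &
    forall x, ell1 (x - c) < r -> Omega x /\ b c / 2 < b x.
  have ccb : {for c, continuous b}.
    by move: cb; rewrite (continuous_open_subspace _ oO); apply; rewrite inE.
  have nb : nbhs c (fun x => Omega x /\ b c / 2 < b x).
    apply: filterI; first exact: open_nbhs_nbhs.
    move: ccb => /cvgrPdist_lt/(_ (b c / 2)); rewrite divr_gt0// => /(_ isT).
    apply: filterS => x; rewrite ltr_norml => /andP[_ h].
    by rewrite [ltRHS](_ : _ = b c - (b c - b x)); lra.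
  have /nbhs_ballP[r /= r0 hr] := nb.
  exists (Num.min r 1); first by rewrite lt_min r0 ltr01 ge_min lexx orbT.
  move=> x; rewrite lt_min => /andP[xr _]; apply: hr; apply/rV_ballP => // i.
  apply: le_lt_trans xr; rewrite distrC /ell1 (bigD1 i)//= !mxE.
  by rewrite lerDl sumr_ge0.
pose u x := Num.max 0 (r - ell1 (x - c)).
have u0 x : 0 <= u x by rewrite le_max lexx.
have uO x : u x != 0 -> Omega x /\ b c / 2 < b x.
  rewrite /u; case: (leP 0 (r - ell1 (x - c))) => h; last by rewrite eqxx.
  move=> h2; apply: hr; rewrite -subr_gt0 lt_def h2.
  exact: h.
have ur x : u x <= 1.
  by rewrite /u ge_max ler01 (le_trans _ r1)// gerBl.
have mu_ : measurable_fun setT u.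
  apply: measurable_maxr; first exact: measurable_cst.
  apply: measurable_funB; first exact: measurable_cst.
  apply: measurable_sum => i; apply: measurableT_comp => //.
  under eq_fun do rewrite !mxE.
  by apply: measurable_funB; [exact: measurable_rV_coord|exact: measurable_cst].
have ud x y : `|u x - u y| <= n%:R * Num.min 1 (enorm (x - y)).
  have n1 : 1 <= n%:R :> R by rewrite ler1n.
  rewrite minr_pMr ?ler0n// mulr1 le_min; apply/andP; split.
    apply: le_trans n1; rewrite ler_norml; apply/andP; split.
      by have := u0 x; have := ur y; lra.
    by have := u0 y; have := ur x; lra.
  apply: le_trans (ell1_le _); apply: le_trans (ell1_dist c x y).
  rewrite /u; set A := ell1 (x - c); set B := ell1 (y - c).
  rewrite ler_norml; have := ler_norm (A - B); have := ler_norm (B - A).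
  rewrite distrC => h1 h2.
  by apply/andP; split; case: (leP 0 (r - A)); case: (leP 0 (r - B)) => *; lra.
have Vu : Vb Omega K p u.
  split => //.
  - by move=> x Ox; apply/eqP/negPn/negP => /uO[].
  - apply: (@integrable_le _ _ _ _ _ mO (fun=> 1)).
    + apply: measurable_funM => //; apply: measurable_normr_powR => //.
      exact: measurable_funTS.
    + move=> x Ox; rewrite mul1r ger0_norm ?powR_ge0// ger0_norm//.
      have e1 : 1 `^ p = 1 :> R by rewrite powR1.
      by rewrite -[leRHS]e1; apply: ge0_ler_powR; rewrite ?nnegrE ?(ltW p0).
    + exact: integrable_cst_fin.
  - apply: ge0_integrable => //.
    + apply: measurable_funM; first exact: measurable_diffK.
      by apply: measurable_normr_powR => //; exact: measurable_diff.
    + by move=> z _; rewrite mulr_ge0 ?powR_ge0// ltW// K0.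
    + apply: (@le_lt_trans _ _ (\int[mu2]_(z in Q)
         ((n%:R `^ p)%:E * mk (z.1 - z.2)%R))%E).
        apply: ge0_le_integral => //.
        * by move=> z _; rewrite lee_fin mulr_ge0 ?powR_ge0// ltW// K0.
        * apply/measurable_EFinP; apply: measurable_funM; first exact: measurable_diffK.
          by apply: measurable_normr_powR => //; exact: measurable_diff.
        * apply: measurable_funTS; apply: measurable_funeM.
          exact: (measurableT_comp mmk (measurable_fun_rV_sub (n := n))).
        * move=> z _; rewrite -EFinM lee_fin /diffK mulrA [leLHS]mulrC.
          rewrite ler_wpM2r ?(ltW (K0 _))// /minpow min1_powR ?enorm_ge0//.
          rewrite -powRM ?le_min ?ler01 ?enorm_ge0//.
          apply: ge0_ler_powR; rewrite ?nnegrE ?(ltW p0)//; last exact: ud.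
          by rewrite mulr_ge0// le_min ler01 enorm_ge0.
      rewrite ge0_integralZl_EFin ?powR_ge0//.
      * by apply: lte_mul_pinfty => //; exact: Q_integral_minpow.
      * apply: measurable_funTS.
        exact: (measurableT_comp mmk (measurable_fun_rV_sub (n := n))).
exists u => //.
have mb : measurable_fun Omega b by exact: measurable_weight.
(* on this box the l^1 distance to c is at most r / 2, so u >= r / 2 *)
pose d := r / (2 * n%:R).
have nR0 : 0 < n%:R :> R by rewrite ltr0n.
have d0 : 0 < d by rewrite divr_gt0// mulr_gt0.
pose box := [set x : 'rV[R]_n | forall i,
   `[c ord0 i - d, c ord0 i + d[%classic (x ord0 i)].
have mA i : measurable (`[c ord0 i - d, c ord0 i + d[%classic : set R).
  exact: measurable_itv.
have mbox : measurable box := measurable_rV_box mA.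
have hbox x : box x -> ell1 (x - c) <= r / 2.
  move=> hx; apply: (@le_trans _ _ (\sum_(i < n) d)).
    apply: ler_sum => i _; have := hx i; rewrite /= in_itv/= !mxE ler_norml.
    by move=> /andP[h1 h2]; apply/andP; split; lra.
  rewrite sumr_const card_ord -mulr_natl /d le_eqVlt.
  by apply/orP; left; apply/eqP; field; rewrite gt_eqF.
have r2 : r / 2 < r by rewrite ltr_pdivrMr// ltr_pMr// ltr1n.
have boxO : box `<=` Omega.
  by move=> x /hbox h; have [] := hr x (le_lt_trans h r2).
have mubox : (0 < mu box)%E.
  rewrite /box (lebesgue_rV_box mA) (eq_bigr (fun=> (2 * d)%:E)); last first.
    move=> i _; rewrite lebesgue_measure_itv/= lte_fin ifT; last by lra.
    by rewrite -EFinB; congr _%:E; ring.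
  by rewrite prodEFin prodr_const lte_fin exprn_gt0// mulr_gt0.
pose k := b c / 2 * (r / 2) `^ beta.
have k0 : 0 < k by rewrite mulr_gt0 ?divr_gt0// powR_gt0// divr_gt0.
have iB := Bb_integrable hbeta mO fO mb bM Vu.
have g0 x : 0 <= b x * `|u x| `^ beta.
  have [->|ux] := eqVneq (u x) 0.
    rewrite normr0 powR0 ?mulr0// gt_eqF//; case/andP: hbeta => h _.
    exact: lt_trans h.
  have [_ h] := uO _ ux; rewrite mulr_ge0 ?powR_ge0//; lra.
rewrite /Bb /pint -lte_fin /Rintegral fineK; last exact: integrable_fin_num.
apply: (@lt_le_trans _ _ (\int[mu]_(x in box) (cst k%:E) x)%E).
  by rewrite integral_cst// mule_gt0.
apply: (@le_trans _ _ (\int[mu]_(x in box) (b x * `|u x| `^ beta)%:E)%E).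
  apply: ge0_le_integral => //.
  - by move=> x _; rewrite lee_fin ltW.
  - apply: (measurable_funS mO boxO); case/integrableP: iB => + _.
    exact.
  - move=> x /hbox hx; rewrite lee_fin /k.
    have ux : r / 2 <= u x by rewrite le_max; apply/orP; right; lra.
    have [_ hb] := hr x (le_lt_trans hx r2).
    rewrite ler_pM ?powR_ge0//; [by lra|by lra|].
    apply: ge0_ler_powR; rewrite ?nnegrE//.
    + by case/andP: hbeta => h _; apply: ltW; apply: lt_trans h.
    + by lra.
    + by rewrite ger0_norm.
apply: ge0_subset_integral => //; first by case/integrableP: iB.
by move=> x _; rewrite lee_fin.
Qed.

End bump.

(** * Simplicity of the first eigenvalue *)

Lemma ae_xsection d1 d2 (T1 : measurableType d1) (T2 : measurableType d2)
  (R : realType) (m1 : {sigma_finite_measure set T1 -> \bar R})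
  (m2 : {sigma_finite_measure set T2 -> \bar R}) (P : T1 * T2 -> Prop) :
  {ae (m1 \x m2)%E, forall z, P z} ->
  {ae m1, forall x, {ae m2, forall y, P (x, y)}}.
Proof.
move=> [N [mN N0 sN]].
have mf : measurable_fun setT (m2 \o xsection N) by exact: measurable_fun_xsection.
have : (\int[m1]_x `|(m2 \o xsection N) x| = 0)%E.
  rewrite -N0 /product_measure1; apply: eq_integral => x _.
  by rewrite gee0_abs.
move=> /(ae_eq_integral_abs m1 measurableT mf); apply: filterS => x /(_ I) hx.
exists (xsection N x); split => //; first exact: measurable_xsection.
by move=> y /= h; rewrite /xsection/= inE; exact: sN.
Qed.

Lemma ae_eq0_of_integral0 d (T : measurableType d) (R : realType)
  (mu : {measure set T -> \bar R}) (D : set T) (f : T -> R) :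
  measurable D -> (forall x, D x -> 0 <= f x) ->
  mu.-integrable D (EFin \o f) -> \int[mu]_(x in D) f x <= 0 ->
  {ae mu, forall x, D x -> f x = 0}.
Proof.
move=> mD f0 iF f1; have mf : measurable_fun D (EFin \o f) by case/integrableP: iF.
have : (\int[mu]_(x in D) `|(EFin \o f) x| = 0)%E.
  have -> : (\int[mu]_(x in D) `|(EFin \o f) x| = \int[mu]_(x in D) (f x)%:E)%E.
    by apply: eq_integral => x /set_mem Dx; rewrite /= ger0_norm// f0.
  rewrite -(fineK (integrable_fin_num mD iF)); congr _%:E.
  by apply/eqP; rewrite eq_le f1; exact: Rintegral_ge0.
move=> /(ae_eq_integral_abs mu mD mf); apply: filterS => x hx Dx.
by have := hx Dx => -[].
Qed.

Section ground.
Context {R : realType} (n : nat).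
Variables (Omega : set 'rV[R]_n) (K b : 'rV[R]_n -> R) (p beta l1 : R).
Local Notation mu := (lebesgue_rV n).
Local Notation mu2 := ((lebesgue_rV n : {measure set 'rV[R]_n -> \bar R})
  \x lebesgue_rV n)%E.
Local Notation Q := (Qset Omega).
Hypotheses (p2 : 2 <= p) (hbeta : 1 < beta < p).
Hypotheses (mO : measurable Omega) (fO : (mu Omega < +oo)%E).
Hypotheses (mK : measurable_fun setT K) (K0 : forall x, 0 < K x).
Hypotheses (mb : measurable_fun Omega b).
Variable M : R.
Hypothesis bM : forall x, Omega x -> `|b x| <= M.
Local Notation V := (Vb Omega K p).
Local Notation N := (Nb Omega K p).
Local Notation S := (Sb Omega p).
Local Notation B := (Bb Omega b beta).
Hypothesis N_ge : forall u, V u -> l1 * S u <= N u.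
Implicit Types u v : 'rV[R]_n -> R.

Let p0 : 0 < p. Proof. exact: lt_le_trans p2. Qed.
Let mQ := measurable_Qset mO.

Lemma abs_ground u : V u -> N u = l1 * S u -> N (absf u) = l1 * S (absf u).
Proof.
move=> Vu Nu; have Va := Vb_abs p2 mO mK K0 Vu.
by apply/eqP; rewrite eq_le N_ge// andbT Sb_abs -Nu Nb_abs.
Qed.

(** Let u and v be non-negative ground states and w = (u^p + v^p)^(1/p). Then
S w = S u + S v, and by [pnorm_dist] the integrand of N w is at most that of
N u + N v. Since l1 S w <= N w, the two integrands are equal almost everywhere, and
the equality case makes (u, v) at x parallel to (u, v) at y. *)
Lemma ground_proportional u v : V u -> V v ->
  (forall x, 0 <= u x) -> (forall x, 0 <= v x) ->
  N u = l1 * S u -> N v = l1 * S v ->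
  {ae mu2, forall z, Q z -> u z.1 * v z.2 = v z.1 * u z.2}.
Proof.
move=> Vu Vv u0 v0 Nu Nv.
have [mu_ zu iSu iNu] := Vu; have [mv zv iSv iNv] := Vv.
pose w x := pnorm p (u x) (v x).
have mw : measurable_fun setT w.
  apply: (@measurableT_comp _ _ _ _ _ _ (fun x : R => x `^ p^-1)).
    exact: measurable_powR.
  by apply: measurable_funD; apply: (@measurableT_comp _ _ _ _ _ _ (fun x : R => x `^ p)) => //;
    exact: measurable_powR.
have w0 x : 0 <= w x by exact: pnorm_ge0.
have wp x : `|w x| `^ p = `|u x| `^ p + `|v x| `^ p.
  by rewrite !ger0_norm// /w pnormK.
have dw z : `|pdiff w z| `^ p <= `|pdiff u z| `^ p + `|pdiff v z| `^ p.
  by have [] := pnorm_dist p2 (u0 z.1) (v0 z.1) (u0 z.2) (v0 z.2).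
have mKd := measurable_diffK (Omega := Omega) mK.
have iT : mu2.-integrable Q (EFin \o (fun z => diffK K z * `|pdiff u z| `^ p +
    diffK K z * `|pdiff v z| `^ p)).
  exact: (integrableD mQ iNu iNv).
have Vw : V w.
  split => //.
  - move=> x Ox; rewrite /w zu// zv// /pnorm powR0 ?gt_eqF// addr0 powR0//.
    by rewrite invr_eq0 gt_eqF.
  - rewrite /pintegrable (_ : EFin \o _ =
      (fun x => (cst 1 x * `|u x| `^ p)%:E + (cst 1 x * `|v x| `^ p)%:E)%E).
      exact: (integrableD mO iSu iSv).
    by apply/funext => x /=; rewrite wp mulrDr EFinD.
  - apply: (integrable_le mQ) iT => [|z Qz].
      apply: measurable_funM => //.
      by apply: measurable_normr_powR => //; exact: measurable_diff.
    rewrite ger0_norm; last by rewrite mulr_ge0 ?powR_ge0// ltW// K0.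
    by rewrite -mulrDr ler_wpM2l// ltW// K0.
have [_ _ _ iNw] := Vw.
have Sw : S w = S u + S v.
  rewrite /Sb /pint -RintegralD//; apply: eq_Rintegral => x _.
  by rewrite wp mulrDr.
pose g z := diffK K z * `|pdiff u z| `^ p + diffK K z * `|pdiff v z| `^ p -
  diffK K z * `|pdiff w z| `^ p.
have ig : mu2.-integrable Q (EFin \o g) by exact: (integrableB mQ iT iNw).
have Ig : \int[mu2]_(z in Q) g z = N u + N v - N w.
  by rewrite RintegralB// RintegralD.
have g0 z : 0 <= g z.
  by rewrite /g -mulrDr -mulrBr mulr_ge0 ?subr_ge0// ltW// K0.
have : \int[mu2]_(z in Q) g z <= 0.
  by rewrite Ig Nu Nv -mulrDr -Sw subr_le0 N_ge.
move=> /(ae_eq0_of_integral0 mQ (fun z _ => g0 z) ig).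
apply: filterS => z hz Qz; have := hz Qz.
rewrite /g -mulrDr -mulrBr => /eqP; rewrite mulf_eq0 gt_eqF ?K0//= subr_eq0 => /eqP e.
have [_ h] := pnorm_dist p2 (u0 z.1) (v0 z.1) (u0 z.2) (v0 z.2).
by apply: h; move: e; rewrite /pdiff => ->.
Qed.

(** By Fubini, fix x with f x > 0 for which the proportionality holds for almost
every y; then g = (g x / f x) f almost everywhere, because {x} x R^n lies in Q. *)
Lemma ground_B_lt0_nonneg f g : V f -> V g -> (forall x, 0 <= f x) -> (forall x, 0 <= g x) ->
  N f = l1 * S f -> N g = l1 * S g -> 0 < S f -> 0 < S g -> B f < 0 -> B g < 0.
Proof.
move=> Vf Vg f0 g0 Nf Ng Sp Su Bp.
have := ae_xsection (ground_proportional Vf Vg f0 g0 Nf Ng).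
move=> aeP.
have [x [Ox fx hx]] : exists x, [/\ Omega x, 0 < f x &
    {ae mu, forall y, Q (x, y) -> f x * g y = g x * f y}].
  apply: contrapT => nx; move: Sp; apply/negP; rewrite -leNgt.
  rewrite le_eqVlt; apply/orP; left; apply/eqP.
  rewrite /Sb /pint (ae_eq_Rintegral (g := cst 0)).
    by rewrite Rintegral_cst// mul0r.
  apply: filterS aeP => y hy Oy /=.
  have [fy|fy] := eqVneq (f y) 0; first by rewrite fy normr0 powR0 ?mulr0// gt_eqF.
  by exfalso; apply: nx; exists y; split => //; rewrite lt_def fy f0.
pose t := g x / f x.
have gE : {ae mu, forall y, g y = scalef t f y}.
  apply: filterS hx => y h; have Qxy : Q (x, y) by move=> [].
  rewrite /scalef /t mulrAC -(h Qxy) mulrAC mulfV ?mul1r// gt_eqF//.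
have t0 : 0 <= t by rewrite divr_ge0.
have Sg : S g = t `^ p * S f.
  rewrite -(Sb_scale mO t0 Vf) /Sb /pint; apply: ae_eq_Rintegral.
  by apply: filterS gE => y -> _.
have tp : 0 < t.
  rewrite lt_def t0 andbT; apply: contraTneq Su => te.
  by rewrite Sg te powR0 ?mul0r ?ltxx// gt_eqF.
have -> : B g = t `^ beta * B f.
  rewrite -(Bb_scale hbeta mO fO mb bM t0 Vf) /Bb /pint; apply: ae_eq_Rintegral.
  by apply: filterS gE => y -> _.
by rewrite pmulr_rlt0// powR_gt0.
Qed.

(** |f| is a ground state when f is, with the same S and B. *)
Lemma ground_B_lt0 f g : V f -> V g ->
  N f = l1 * S f -> N g = l1 * S g -> 0 < S f -> 0 < S g -> B f < 0 -> B g < 0.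
Proof.
move=> Vf Vg /(abs_ground Vf) Nf /(abs_ground Vg) Ng.
rewrite -(Sb_abs Omega p f) -(Sb_abs Omega p g) -(Bb_abs Omega b beta f)
  -(Bb_abs Omega b beta g).
apply: ground_B_lt0_nonneg Nf Ng => //; try exact: Vb_abs.
  by move=> x; exact: normr_ge0.
by move=> x; exact: normr_ge0.
Qed.
End ground.

(** * The concrete functionals and the passage to Borel representatives *)

Section assemble.
Context {R : realType} (n : nat).
Variables (Omega : set 'rV[R]_n) (K b : 'rV[R]_n -> R) (p beta l1 : R).
Local Notation mu := (lebesgue_rV n).
Hypotheses (p2 : 2 <= p) (hbeta : 1 < beta < p).
Hypotheses (mO : measurable Omega) (fO : (mu Omega < +oo)%E).
Hypotheses (mK : measurable_fun setT K) (K0 : forall x, 0 < K x).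
Hypotheses (mb : measurable_fun Omega b).
Variable M : R.
Hypothesis bM : forall x, Omega x -> `|b x| <= M.
Hypothesis hcells : forall e, 0 < e ->
  exists (I : finType) (D : I -> set 'rV[R]_n) c, cells Omega K e D c.
Local Notation V := (Vb Omega K p).
Local Notation N := (Nb Omega K p).
Local Notation S := (Sb Omega p).
Local Notation B := (Bb Omega b beta).
Hypothesis l10 : 0 < l1.
Hypothesis N_ge : forall u, V u -> l1 * S u <= N u.
Variable f : 'rV[R]_n -> R.
Hypotheses (Vf : V f) (Nf : N f = l1 * S f) (Sf : 0 < S f) (Bf : B f < 0).

Let p0 : 0 < p. Proof. exact: lt_le_trans p2. Qed.

Lemma compact_SB (u : nat -> 'rV[R]_n -> R) (A : R) : (forall k, V (u k)) ->
    (forall k, N (u k) <= A) -> (forall k, S (u k) <= A) ->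
    exists (k : nat -> nat) w, [/\ forall m, (m <= k m)%N, V w,
      S (u (k m)) @[m --> \oo] --> S w, B (u (k m)) @[m --> \oo] --> B w &
      forall c, (\forall m \near \oo, N (u (k m)) <= c) -> N w <= c].
Proof.
move=> Vu hN hS.
have [k [w [km Vw Nw [H iH hH]]]] := compact_Vb p2 mO mK K0 hcells Vu hN hS.
exists k, w; split => //.
- have [|||||_ h] := @Rintegral_dominated _ _ _ mu Omega mO
    (fun m x => cst 1 x * `|u (k m) x| `^ p) (fun x => cst 1 x * `|w x| `^ p) H.
  + move=> m; have [mu_ _ _ _] := Vu (k m); apply: measurable_funM => //.
    by apply: measurable_normr_powR; exact: measurable_funTS.
  + have [mw _ _ _] := Vw; apply: measurable_funM => //.
    by apply: measurable_normr_powR; exact: measurable_funTS.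
  + apply: filterS hH => x hx Ox; have [h1 _] := hx Ox.
    by apply: cvgM; [exact: cvg_cst|exact: cvg_normr_powR].
  + exact: iH.
  + apply: filterS hH => x hx Ox m; rewrite mul1r ger0_norm ?powR_ge0//.
    by have [_] := hx Ox; apply.
  + exact: h.
- pose H' x := `|M| + `|M| * H x.
  have b0 : 0 < beta by case/andP: hbeta => h _; exact: lt_trans h.
  have [|||||_ h] := @Rintegral_dominated _ _ _ mu Omega mO
    (fun m x => b x * `|u (k m) x| `^ beta) (fun x => b x * `|w x| `^ beta) H'.
  + move=> m; have [mu_ _ _ _] := Vu (k m); apply: measurable_funM => //.
    by apply: measurable_normr_powR; exact: measurable_funTS.
  + have [mw _ _ _] := Vw; apply: measurable_funM => //.
    by apply: measurable_normr_powR; exact: measurable_funTS.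
  + apply: filterS hH => x hx Ox; have [h1 _] := hx Ox.
    by apply: cvgM; [exact: cvg_cst|exact: cvg_normr_powR].
  + rewrite (_ : EFin \o H' = (fun x => (`|M|)%:E + (`|M|)%:E * (H x)%:E)%E)//.
    apply: integrableD => //; last exact: integrableZl.
    exact: integrable_cst_fin.
  + apply: filterS hH => x hx Ox m; have [_ hh] := hx Ox.
    apply: (le_trans (weight_integrand hbeta bM (u (k m)) Ox)).
    by rewrite lerD2l ler_wpM2l.
  + exact: h.
Qed.

Lemma functionals_Vb : functionals p beta l1 V N S B
  (Eb Omega K p) (Pb Omega p) (Qb Omega b beta).
Proof.
split.
- by move=> t u; exact: Vb_scale.
- by move=> u s v; exact: Vb_line.
- by move=> u; exact: Vb_abs.
- by move=> u; exact: Nb_ge0.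
- by move=> u; exact: Sb_ge0.
- by move=> t u; exact: Nb_scale.
- by move=> t u; exact: Sb_scale.
- by move=> t u t0 Vu; exact: (Bb_scale hbeta mO fO mb bM t0 Vu).
- by move=> u; exact: Nb_abs.
- by move=> u _; exact: Sb_abs.
- by move=> u _; exact: Bb_abs.
- exact: l10.
- exact: N_ge.
- move=> u Vu Su Nu.
  exact: (ground_B_lt0 p2 hbeta mO fO mK K0 mb bM N_ge Vf Vu Nf Nu Sf Su Bf).
- by apply: Bb_bound => //; exact: bM.
- exact: compact_SB.
- by move=> u v Vu Vv; have [] := Nb_deriv p2 mO mK Vu Vv.
- by move=> u v Vu Vv; have [] := Sb_deriv p2 mO Vu Vv.
- by move=> u v Vu Vv; have [] := Bb_deriv hbeta mO fO mb bM Vu Vv.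
- move=> u v Vu Vv; have [h _] := Nb_deriv p2 mO mK Vu Vv.
  by rewrite /Eb diff_scale dpint_opp//; exact: measurable_Qset.
- by move=> u v Vu Vv; have [h _] := Sb_deriv p2 mO Vu Vv; exact: dpint_opp.
- by move=> u v Vu Vv; have [h _] := Bb_deriv hbeta mO fO mb bM Vu Vv; exact: dpint_opp.
Qed.
End assemble.

Section transfer.
(* Every quantity of the problem depends only on the classes of u and K up to null
   sets: it is computed here on Borel representatives v and K'. *)
Context {R : realType} (n : nat).
Variables (Omega : set 'rV[R]_n) (K K' b : 'rV[R]_n -> R) (p beta : R).
Local Notation mu := (lebesgue_rV n).
Local Notation mu2 := ((lebesgue_rV n : {measure set 'rV[R]_n -> \bar R})
  \x lebesgue_rV n)%E.
Local Notation Q := (Qset Omega).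
Local Notation V := (Vb Omega K' p).
Hypotheses (p2 : 2 <= p) (mO : measurable Omega).
Hypotheses (mK : measurable_fun setT K') (K0 : forall x, 0 < K' x).
Hypothesis KK' : {ae mu, forall x, K x = K' x}.
Implicit Types u v : 'rV[R]_n -> R.
Let p0 : 0 < p. Proof. exact: lt_le_trans p2. Qed.
Let mQ := measurable_Qset mO.

Definition aeq u v := {ae mu, forall x, u x = v x}.

Lemma aeq_refl u : aeq u u. Proof. by apply: aeW. Qed.

Lemma aeq_scale t u v : aeq u v -> aeq (fun x => t * u x) (scalef t v).
Proof. by apply: filterS => x ->. Qed.

Let KK2 : {ae mu2, forall z, K (z.1 - z.2) = diffK K' z}.
Proof. exact: (ae_prod_sub KK'). Qed.

Lemma pair_ae u v u' v' : aeq u v -> aeq u' v' ->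
  {ae mu2, forall z, [/\ K (z.1 - z.2) = diffK K' z,
    u z.1 - u z.2 = pdiff v z & u' z.1 - u' z.2 = pdiff v' z]}.
Proof.
move=> /pdiff_ae uv /pdiff_ae uv'.
move: uv uv' KK2; apply: filterS3 => z [h1 h2] [h3 h4] h5.
by split => //; rewrite /pdiff ?h1 ?h2 ?h3 ?h4.
Qed.

Lemma X0norm_aeq u v : aeq u v -> X0norm Omega K p u `^ p = Nb Omega K' p v.
Proof.
move=> uv; rewrite /X0norm -powRrM mulVf ?gt_eqF//.
have -> : \int[mu2]_(z in Q) (`|u z.1 - u z.2| `^ p * K (z.1 - z.2)) =
    Nb Omega K' p v.
  apply: ae_eq_Rintegral; apply: filterS (pair_ae uv uv) => z [-> -> _] _.
  exact: mulrC.
by rewrite powRr1// Nb_ge0.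
Qed.

Lemma S_aeq u v : aeq u v -> \int[mu]_(x in Omega) (`|u x| `^ p) = Sb Omega p v.
Proof.
move=> uv; apply: ae_eq_Rintegral; apply: filterS uv => x -> _.
by rewrite mul1r.
Qed.

Lemma B_aeq u v : aeq u v ->
  \int[mu]_(x in Omega) (b x * `|u x| `^ beta) = Bb Omega b beta v.
Proof. by move=> uv; apply: ae_eq_Rintegral; apply: filterS uv => x -> _. Qed.

Lemma energy_form_aeq u v u' v' : aeq u v -> aeq u' v' ->
  energy_form Omega K p u u' = Eb Omega K' p v v'.
Proof.
move=> uv uv'; apply: ae_eq_Rintegral.
by apply: filterS (pair_ae uv uv') => z [-> -> ->] _; ring.
Qed.

Lemma P_aeq u v u' v' : aeq u v -> aeq u' v' ->
  \int[mu]_(x in Omega) (`|u x| `^ (p - 2) * u x * u' x) = Pb Omega p v v'.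
Proof.
move=> uv uv'; apply: ae_eq_Rintegral.
by apply: filterS2 uv uv' => x -> -> _; rewrite mul1r.
Qed.

Lemma Q_aeq u v u' v' : aeq u v -> aeq u' v' ->
  \int[mu]_(x in Omega) (b x * `|u x| `^ (beta - 2) * u x * u' x) =
  Qb Omega b beta v v'.
Proof.
move=> uv uv'; apply: ae_eq_Rintegral.
by apply: filterS2 uv uv' => x -> -> _; ring.
Qed.

Lemma powR_weight (x k : R) : 0 < k -> `|x * k `^ p^-1| `^ p = k * `|x| `^ p.
Proof.
move=> k0; rewrite normrM powRM// (ger0_norm (powR_ge0 _ _)) -powRrM mulVf ?gt_eqF//.
by rewrite powRr1 ?(ltW k0)// mulrC.
Qed.

(** Measurability yields a Borel function equal to u almost everywhere; its product
with the indicator of Omega vanishes outside Omega at every point. *)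
Lemma X0_rep u : X0 Omega K p u -> exists2 v, V v & aeq u v.
Proof.
move=> [[g mg ug] [_ uS] [_ uN] uO].
pose v x := g x * \1_Omega x.
have mv : measurable_fun setT v.
  by apply: measurable_funM => //; exact: measurable_indic.
have uv : aeq u v.
  apply: filterS2 ug uO => x h1 h2; rewrite /v.
  have [Ox|Ox] := pselect (Omega x).
    by rewrite indicE mem_set// mulr1 h1.
  by rewrite indicE memNset// mulr0 h2.
exists v => //; split => //.
- by move=> x Ox; rewrite /v indicE memNset// mulr0.
- apply: ge0_integrable => //.
  + by apply: measurable_funM => //; apply: measurable_normr_powR; exact: measurable_funTS.
  + by move=> x _; rewrite mul1r powR_ge0.
  + rewrite (ae_eq_integral_any (g := fun x => (`|u x| `^ p)%:E))//.
    by apply: filterS uv => x -> _; rewrite mul1r.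
- apply: ge0_integrable => //.
  + apply: measurable_funM; first exact: measurable_diffK.
    by apply: measurable_normr_powR; exact: measurable_diff.
  + by move=> z _; rewrite mulr_ge0 ?powR_ge0// ltW// K0.
  + rewrite (ae_eq_integral_any (g := fun z =>
      (`|(u z.1 - u z.2) * K (z.1 - z.2) `^ p^-1| `^ p)%:E))//.
    apply: filterS (pair_ae uv uv) => z [-> -> _] _.
    by rewrite powR_weight// K0.
Qed.

Lemma Vb_X0 u v : V v -> aeq u v -> X0 Omega K p u.
Proof.
move=> [mv v0 iS iN] uv; split.
- by exists v => //; apply: filterS uv => x h _.
- split; first by exists v; [exact: measurable_funTS|apply: filterS uv => x h _].
  case/integrableP: iS => _; apply: le_lt_trans.
  rewrite le_eqVlt; apply/orP; left; apply/eqP; apply: ae_eq_integral_any.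
  by apply: filterS uv => x -> _; rewrite /= mul1r (ger0_norm (powR_ge0 _ _)).
- split.
    exists (fun z => pdiff v z * diffK K' z `^ p^-1).
      apply: measurable_funM; first exact: measurable_diff.
      apply: (@measurableT_comp _ _ _ _ _ _ (fun x : R => x `^ p^-1)).
        exact: measurable_powR.
      exact: measurable_diffK.
    by apply: filterS (pair_ae uv uv) => z [-> -> _].
  case/integrableP: iN => _; apply: le_lt_trans.
  rewrite le_eqVlt; apply/orP; left; apply/eqP; apply: ae_eq_integral_any.
  apply: filterS (pair_ae uv uv) => z [-> -> _] _ /=.
  rewrite powR_weight ?K0// normrM (ger0_norm (powR_ge0 _ _)) gtr0_norm//.
  exact: K0.
- by apply: filterS uv => x -> Ox; exact: v0.
Qed.

Local Notation N := (Nb Omega K' p).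
Local Notation S := (Sb Omega p).
Local Notation B := (Bb Omega b beta).

Lemma J_aeq lam u v : aeq u v ->
  J Omega K p b beta lam u = energy p beta N S B lam v.
Proof. by move=> uv; rewrite /J (X0norm_aeq uv) (S_aeq uv) (B_aeq uv). Qed.

Lemma Nehari_aeq lam u v : V v -> aeq u v ->
  Nehari Omega K p b beta lam u <-> nehari V N S B lam v.
Proof.
move=> Vv uv; rewrite /Nehari /= (X0norm_aeq uv) (S_aeq uv) (B_aeq uv).
by split => -[_ h]; split => //; [apply/eqP; rewrite -subr_eq0; apply/eqP|
  exact: Vb_X0 uv|apply/eqP; rewrite subr_eq0; apply/eqP].
Qed.

End transfer.

(** * The two solutions and their blow-up *)

Section real_facts.
Context {R : realType}.

Lemma is_derive_two_powers (p q a b t : R) : 0 < t ->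
  is_derive t 1 (fun x : R => a * x `^ p - b * x `^ q)
    (a * (p * t `^ (p - 1)) - b * (q * t `^ (q - 1))).
Proof.
move=> t0; have Dp := is_derive1_powR p t0; have Dq := is_derive1_powR q t0.
exact: (is_deriveB (is_deriveZ a Dp) (is_deriveZ b Dq)).
Qed.

Lemma near_pos (t : R) : 0 < t -> \forall x \near t, 0 < x.
Proof. by move=> t0; exact: lt_nbhsr. Qed.

Lemma fibering_derive2 (p q a b : R) (phi : R -> R) : p != 0 -> q != 0 ->
  (forall t, 0 < t -> phi t = p^-1 * (t `^ p * a) - q^-1 * (t `^ q * b)) ->
  derive1n 2 phi 1 = (p - 1) * a - (q - 1) * b.
Proof.
move=> p0 q0 hphi.
have d1 t : 0 < t -> derive1 phi t = a * t `^ (p - 1) - b * t `^ (q - 1).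
  move=> t0; rewrite derive1E.
  rewrite (near_eq_derive (g := fun x : R => p^-1 * a * x `^ p - q^-1 * b * x `^ q)).
    rewrite (@derive_val _ _ _ _ _ _ _ (is_derive_two_powers p q (p^-1 * a) (q^-1 * b) t0)).
    by field; rewrite p0 q0.
  by apply: filterS (near_pos t0) => x x0; rewrite hphi//; ring.
rewrite /derive1n /= derive1E.
rewrite (near_eq_derive (g := fun x : R => a * x `^ (p - 1) - b * x `^ (q - 1))).
  rewrite (@derive_val _ _ _ _ _ _ _ (is_derive_two_powers (p - 1) (q - 1) a b ltr01)).
  by rewrite !powR1; ring.
by apply: filterS (near_pos ltr01) => x x0; rewrite d1.
Qed.

Lemma near_right_blowup (l c r A : R) : 0 < c -> 0 < r ->
  \forall x \near l^'+, A <= (c / (x - l)) `^ r.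
Proof.
move=> c0 r0; pose A' := (`|A| + 1) `^ r^-1.
have A0 : 0 < `|A| + 1 by rewrite ltr_wpDl.
have A'0 : 0 < A' by exact: powR_gt0.
have lz : l < l + c / A' by rewrite ltrDl divr_gt0.
near=> x.
have xl : 0 < x - l by rewrite subr_gt0; near: x; exact: nbhs_right_gt.
have xc : x < l + c / A' by near: x; exact: nbhs_right_lt.
have h : A' <= c / (x - l).
  by rewrite ler_pdivlMr// mulrC -ler_pdivlMr// ltW// ltrBlDl.
apply: (@le_trans _ _ (A' `^ r)).
  rewrite /A' -powRrM mulVf ?gt_eqF// powRr1 ?(ltW A0)//.
  by rewrite (le_trans (ler_norm _))// lerDl.
by apply: ge0_ler_powR; rewrite ?nnegrE ?(ltW r0) ?(ltW A'0) ?(ltW (divr_gt0 c0 xl)).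
Unshelve. all: by end_near. Qed.

Lemma near_right_seq (P : R -> Prop) (u : nat -> R) (l : R) :
  (\forall x \near l^'+, P x) -> u k @[k --> \oo] --> l -> (forall k, l < u k) ->
  \forall k \near \oo, P (u k).
Proof.
move=> hP ul lu; have hn : nbhs l (fun x => l < x -> P x) by exact: hP.
have h := ul _ hn; apply: (@filterS nat \oo _ _ _ _ h) => k /=; apply; exact: lu.
Qed.

Lemma powR_inv_root (s p : R) : 0 < s -> 0 < p -> (s `^ (- p^-1)) `^ p = s^-1.
Proof.
by move=> s0 p0; rewrite -powRrM mulNr mulVf ?gt_eqF// powR_inv1 ?ltW.
Qed.

Lemma dpint_self d (T : measurableType d) (mu : {measure set T -> \bar R})
  (D : set T) (w : T -> R) (r : R) (f : T -> R) : 0 < r ->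
  dpint mu D w r f f = pint mu D w r f.
Proof.
move=> r0; apply: eq_Rintegral => x _; congr (_ * _).
have [->|f0] := eqVneq (f x) 0; first by rewrite mulr0 normr0 powR0// gt_eqF.
rewrite -mulrA -expr2 -real_normK ?num_real// -powR_mulrn// -powRD ?subrK//.
by rewrite normr_eq0 f0 implybT.
Qed.
End real_facts.

Section nehari_parts.
Context {R : realType} (n : nat).
Variables (Omega : set 'rV[R]_n) (K K' b : 'rV[R]_n -> R) (p beta l1 : R).
Local Notation mu := (lebesgue_rV n).
Local Notation V := (Vb Omega K' p).
Local Notation N := (Nb Omega K' p).
Local Notation S := (Sb Omega p).
Local Notation B := (Bb Omega b beta).
Hypotheses (p2 : 2 <= p) (hbeta : 1 < beta < p).
Hypotheses (mK : measurable_fun setT K') (K0 : forall x, 0 < K' x).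
Hypothesis KK' : {ae mu, forall x, K x = K' x}.
Hypothesis F : functionals p beta l1 V N S B
  (Eb Omega K' p) (Pb Omega p) (Qb Omega b beta).
Implicit Types u v : 'rV[R]_n -> R.

(** For a Nehari point B = excess, so (p - 1) excess - (beta - 1) B is
(p - beta) excess: the sign of the second derivative of the fibering map is the
sign of the excess. *)
Lemma fibering_derive2_aeq lam u v : nehari V N S B lam v -> aeq u v ->
  derive1n 2 (fibering Omega K p b beta lam u) 1 = (p - beta) * excess N S lam v.
Proof.
move=> [Vv AB] uv; have [b1 bp] := andP hbeta.
rewrite (@fibering_derive2 R p beta (excess N S lam v) (B v)).
- by rewrite AB; ring.
- by rewrite gt_eqF// (lt_le_trans _ p2).
- by rewrite gt_eqF// (lt_trans _ b1).
- move=> t t0; rewrite -(energy_scale F lam (ltW t0) Vv).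
  exact: (J_aeq Omega b beta p2 K0 KK' lam (aeq_scale t uv)).
Qed.

Lemma Nehari_plus_aeq lam u v : V v -> aeq u v ->
  Nehari_plus Omega K p b beta lam u <-> nplus V N S B lam v.
Proof.
move=> Vv uv; have hN := Nehari_aeq b beta p2 mK K0 KK' lam Vv uv.
have q0 : 0 < p - beta by rewrite subr_gt0; case/andP: hbeta.
split => [[/hN h]|[h A0]].
  by rewrite (fibering_derive2_aeq h uv) pmulr_rgt0.
by split; [exact/hN|rewrite (fibering_derive2_aeq h uv) pmulr_rgt0].
Qed.

Lemma Nehari_minus_aeq lam u v : V v -> aeq u v ->
  Nehari_minus Omega K p b beta lam u <-> nminus V N S B lam v.
Proof.
move=> Vv uv; have hN := Nehari_aeq b beta p2 mK K0 KK' lam Vv uv.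
have q0 : 0 < p - beta by rewrite subr_gt0; case/andP: hbeta.
split => [[/hN h]|[h A0]].
  by rewrite (fibering_derive2_aeq h uv) pmulr_rlt0.
by split; [exact/hN|rewrite (fibering_derive2_aeq h uv) pmulr_rlt0].
Qed.

Lemma J_minimizer_aeq lam (A A' : set ('rV[R]_n -> R)) u : measurable Omega ->
  (forall w v, V v -> aeq w v -> A w <-> A' v) -> A `<=` X0 Omega K p -> V u ->
  minimizer p beta N S B lam A' u -> J_minimizer Omega K p b beta lam A u.
Proof.
move=> mO AA AX Vu [Au um]; split; first exact/(AA _ _ Vu (aeq_refl u)).
move=> w Aw; have [v Vv wv] := X0_rep p2 mO mK K0 KK' (AX _ Aw).
rewrite (J_aeq Omega b beta p2 K0 KK' lam (aeq_refl u)).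
rewrite (J_aeq Omega b beta p2 K0 KK' lam wv).
by apply: um; exact/(AA _ _ Vv wv).
Qed.

Lemma weak_solution_aeq lam u : measurable Omega -> V u ->
  (forall v, V v -> Eb Omega K' p u v =
     lam * Pb Omega p u v + Qb Omega b beta u v) ->
  is_weak_solution Omega K p b beta lam u.
Proof.
move=> mO Vu hu; split; first exact: (Vb_X0 p2 mK K0 KK' Vu (aeq_refl u)).
move=> w Xw; have [v Vv wv] := X0_rep p2 mO mK K0 KK' Xw.
rewrite (energy_form_aeq Omega p KK' (aeq_refl u) wv).
by rewrite (P_aeq Omega p (aeq_refl u) wv) (Q_aeq Omega b beta (aeq_refl u) wv) hu.
Qed.
End nehari_parts.

Section main.
Context {R : realType} (n : nat).
Variables (p alpha beta : R) (Omega : set 'rV[R]_n) (b K phi1 : 'rV[R]_n -> R).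
Hypotheses (hp : 2 <= p) (halpha : 0 < alpha < 1) (hn : p * alpha < n%:R)
    (hOmega : smooth_bounded_domain Omega)
    (hb : is_weight Omega b)
    (hK : is_kernel p alpha K)
    (hphi1 : is_eigenfunction Omega K p (lambda1 Omega K p) phi1)
    (hphi1_ge0 : ae_nonneg phi1)
    (hphi1_norm : X0norm Omega K p phi1 = 1)
    (hbeta : 1 < beta < p)
    (hbphi1 : \int[lebesgue_rV n]_(x in Omega) (b x * phi1 x `^ beta) < 0).
Local Notation mu := (lebesgue_rV n).
Local Notation l1 := (lambda1 Omega K p).
Local Notation N' := (Nb Omega).
Local Notation S := (Sb Omega p).
Local Notation B := (Bb Omega b beta).

(** The eigenvalue enters through l1 S <= N, which is the definition of lambda1 as an
infimum after rescaling to S = 1, and through the eigenfunction, which tested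
with itself attains equality. *)
Lemma variational_setting : exists K' : 'rV[R]_n -> R,
  [/\ measurable Omega, measurable_fun setT K', forall x, 0 < K' x,
      {ae mu, forall x, K x = K' x} &
   [/\ functionals p beta l1 (Vb Omega K' p) (Nb Omega K' p) S B
        (Eb Omega K' p) (Pb Omega p) (Qb Omega b beta),
      exists u, [/\ Vb Omega K' p u, 0 < S u & Nb Omega K' p u = l1 * S u] &
      exists2 u, Vb Omega K' p u & 0 < B u]].
Proof.
have p0 : 0 < p by exact: lt_le_trans hp.
have a0 : 0 < alpha by case/andP: halpha.
have pa0 : 0 < p * alpha by exact: mulr_gt0.
have n0 : (0 < n)%N by rewrite -(ltr0n R); exact: lt_trans hn.
have [oO _ _ bO _] := hOmega.
have mO : measurable Omega by exact: open_measurable_rV.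
have [M0 M00 hM0] := bounded_rV_box bO.
have fO : (mu Omega < +oo)%E.
  exact: (lebesgue_rV_itv (a := fun=> - M0) (b := fun=> M0) mO hM0).
have [cb [M bM] bpos _] := hb.
have mb : measurable_fun Omega b by exact: measurable_weight.
have [theta t0 [K' [mK K0 Klow KK' Kint]]] := kernel_rep n0 p0 hK.
have hcells := cells_exist M00 hM0 t0 pa0 n0 Klow.
have [Xphi _ Ephi] := hphi1.
have [f Vf phif] := X0_rep hp mO mK K0 KK' Xphi.
have Nf1 : Nb Omega K' p f = 1.
  by rewrite -(X0norm_aeq Omega hp K0 KK' phif) hphi1_norm powR1.
have Nf : Nb Omega K' p f = l1 * S f.
  have := Ephi _ Xphi; rewrite (energy_form_aeq Omega p KK' phif phif) (P_aeq Omega p phif phif).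
  by rewrite /Eb /Pb !dpint_self.
have Sf0 : 0 <= S f by exact: Sb_ge0.
have Sf : 0 < S f.
  rewrite lt_def Sf0 andbT; apply/eqP => S0.
  by move: Nf; rewrite Nf1 S0 mulr0 => /eqP; rewrite oner_eq0.
have l10 : 0 < l1.
  by rewrite -(pmulr_lgt0 _ Sf) -Nf Nf1.
have Bf : B f < 0.
  rewrite -(B_aeq Omega b beta phif); apply: le_lt_trans hbphi1.
  rewrite le_eqVlt; apply/orP; left; apply/eqP; apply: ae_eq_Rintegral.
  by apply: filterS hphi1_ge0 => x h _; rewrite ger0_norm.
have N_ge u : Vb Omega K' p u -> l1 * S u <= Nb Omega K' p u.
  move=> Vu; have [S0|S0] := eqVneq (S u) 0.
    by rewrite S0 mulr0; exact: Nb_ge0.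
  have {S0}S0 : 0 < S u by rewrite lt_def S0 Sb_ge0.
  pose t := S u `^ (- p^-1).
  have t0' : 0 <= t by exact: powR_ge0.
  have tp : t `^ p = (S u)^-1 by exact: powR_inv_root.
  rewrite -ler_pdivlMr// mulrC -tp -(Nb_scale mO t0' Vu).
  have Vt := Vb_scale mO t Vu.
  rewrite -(X0norm_aeq Omega hp K0 KK' (aeq_refl _)).
  apply: ge_inf; first by exists 0 => _ [w _ <-]; exact: powR_ge0.
  exists (scalef t u) => //; split; first exact: (Vb_X0 hp mK K0 KK' Vt (aeq_refl _)).
  by rewrite (S_aeq Omega p (aeq_refl _)) (Sb_scale mO t0' Vu) tp mulVf ?gt_eqF.
exists K'; split; [exact: mO|exact: mK|exact: K0|exact: KK'|split].
- exact: (functionals_Vb hp hbeta mO fO mK K0 mb bM hcells l10 N_ge Vf Nf Sf Bf).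
- by exists f.
- exact: (bump_exists hp hbeta n0 oO fO mK K0 Kint cb bM bpos).
Qed.

End main.

Theorem theorem1p3 (R : realType) (n : nat) (p alpha beta : R)
    (Omega : set 'rV[R]_n) (b K : 'rV[R]_n -> R) (phi1 : 'rV[R]_n -> R)
    (hp : 2 <= p) (halpha : 0 < alpha < 1) (hn : p * alpha < n%:R)
    (hOmega : smooth_bounded_domain Omega)
    (hb : is_weight Omega b)
    (hK : is_kernel p alpha K)
    (hphi1 : is_eigenfunction Omega K p (lambda1 Omega K p) phi1)
    (hphi1_ge0 : ae_nonneg phi1)
    (hphi1_norm : X0norm Omega K p phi1 = 1)
    (hbeta : 1 < beta < p)
    (hbphi1 : \int[lebesgue_rV n]_(x in Omega) (b x * phi1 x `^ beta) < 0) :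
  [/\ exists2 delta1 : R, 0 < delta1 &
        forall lambda : R,
          lambda1 Omega K p < lambda < lambda1 Omega K p + delta1 ->
          exists u v : 'rV[R]_n -> R,
            [/\ ae_nonneg u /\ ae_nonneg v,
                is_weak_solution Omega K p b beta lambda u,
                is_weak_solution Omega K p b beta lambda v,
                ~ {ae lebesgue_rV n, forall x, u x = v x} &
                J_minimizer Omega K p b beta lambda
                  (Nehari_plus Omega K p b beta lambda) u /\
                J_minimizer Omega K p b beta lambda
                  (Nehari_minus Omega K p b beta lambda) v],
      inf [set J Omega K p b beta lambda u | u in
            Nehari_minus Omega K p b beta lambda]
        @[lambda --> (lambda1 Omega K p)^'+] --> +oo &
      forall (l : nat -> R) (u : nat -> 'rV[R]_n -> R),
        (forall k, lambda1 Omega K p < l k) ->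
        l k @[k --> \oo] --> lambda1 Omega K p ->
        (forall k, J_minimizer Omega K p b beta (l k)
          (Nehari_minus Omega K p b beta (l k)) (u k)) ->
        X0norm Omega K p (u k) @[k --> \oo] --> +oo].

Proof.
have [K' [mO mK K0 KK' [F hground hpos]]] :=
  variational_setting hp halpha hn hOmega hb hK hphi1 hphi1_ge0 hphi1_norm hbeta hbphi1.
have [d d0 [e e0 gapP]] := spectral_gap F hbeta.
have [b1 bp] := andP hbeta.
have q0 : 0 < p - beta by rewrite subr_gt0.
have b0 : 0 < beta by exact: lt_trans b1.
have p0 : 0 < p by exact: lt_trans bp.
have l10 : 0 < lambda1 Omega K p by exact: (fl1_gt0 F).
have ld : lambda1 Omega K p < lambda1 Omega K p + d by rewrite ltrDl.
have hplus lam := @Nehari_plus_aeq _ _ _ _ _ _ _ _ _ hp hbeta mK K0 KK' F lam.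
have hminus lam := @Nehari_minus_aeq _ _ _ _ _ _ _ _ _ hp hbeta mK K0 KK' F lam.
split.
- exists d => // lam hlam.
  have [u um u0] := nplus_minimizer F hbeta d0 e0 gapP hlam hpos.
  have [v vm v0] := nminus_minimizer F hbeta d0 e0 gapP hlam hground.
  have Vu := um.1.1.1; have Vv := vm.1.1.1.
  exists u, v; split.
  + by split; apply: aeW.
  + apply: (weak_solution_aeq hp mK K0 KK' mO Vu) => w Vw.
    by apply: (minimizer_critical F hbeta _ Vw); left.
  + apply: (weak_solution_aeq hp mK K0 KK' mO Vv) => w Vw.
    by apply: (minimizer_critical F hbeta _ Vw); right.
  + move=> uv; have := um.1.2; rewrite um.1.1.2 -(B_aeq Omega b beta (aeq_refl u)).
    rewrite (B_aeq Omega b beta uv) -vm.1.1.2 => h.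
    by have := lt_trans h vm.1.2; rewrite ltxx.
  + split.
      by apply: (J_minimizer_aeq hp mK K0 KK' mO (hplus lam) _ Vu um) => w [[]].
    by apply: (J_minimizer_aeq hp mK K0 KK' mO (hminus lam) _ Vv vm) => w [[]].
- apply/cvgryPge => A; near=> lam.
  have hlam : lambda1 Omega K p < lam < lambda1 Omega K p + d.
    by apply/andP; split; near: lam; [exact: nbhs_right_gt|exact: nbhs_right_lt].
  have ge0' := mulr_gt0 (gap_gt0 hbeta) e0.
  apply: (@le_trans _ _ (gap p beta * e *
      (e / (lam - lambda1 Omega K p)) `^ (beta / (p - beta)))).
    rewrite mulrC -ler_pdivrMr//; near: lam.
    by apply: near_right_blowup => //; exact: divr_gt0.
  apply: lb_le_inf.
    have [v nv] := nminus_nonempty F hbeta hlam hground.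
    exists (J Omega K p b beta lam v), v => //.
    by apply/(hminus lam _ _ nv.1.1 (aeq_refl v)).
  move=> _ [w Nw <-].
  have [v Vv wv] := X0_rep hp mO mK K0 KK' Nw.1.1.
  rewrite (J_aeq Omega b beta hp K0 KK' lam wv).
  by apply: (nminus_energy F hbeta d0 e0 gapP hlam); exact/(hminus lam _ _ Vv wv).
- move=> l u lgt lcvg hu; apply/cvgryPge => A.
  have ll : \forall k \near \oo, l k < lambda1 Omega K p + d.
    exact: near_right_seq (nbhs_right_lt ld) lcvg lgt.
  have lb : \forall k \near \oo, `|A| `^ p / lambda1 Omega K p <=
      (e / (l k - lambda1 Omega K p)) `^ (p / (p - beta)).
    have c0 : 0 < p / (p - beta) by exact: divr_gt0.
    exact: near_right_seq (near_right_blowup _ _ e0 c0) lcvg lgt.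
  apply: filterS2 ll lb => k lk lbk.
  have hlam : lambda1 Omega K p < l k < lambda1 Omega K p + d by rewrite lgt lk.
  have [w Vw uw] := X0_rep hp mO mK K0 KK' (hu k).1.1.1.
  have /(hminus (l k) _ _ Vw uw) nw := (hu k).1.
  have : `|A| `^ p <= X0norm Omega K p (u k) `^ p.
    rewrite (X0norm_aeq Omega hp K0 KK' uw) (le_trans _ (fN_ge F Vw))//.
    rewrite mulrC -ler_pdivrMr// (le_trans lbk)//.
    exact: (nminus_S F hbeta d0 e0 gapP hlam nw).
  move=> h; apply: (le_trans (ler_norm A)); rewrite leNgt; apply/negP => hA.
  by move: h; rewrite leNgt gt0_ltr_powR// nnegrE// powR_ge0.
Unshelve. all: by end_near. Qed.
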